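(* Let $n>2$ and let $B\in U(n)$ be $$B=\begin{pmatrix}\boldsymbol 0&I_{n-1}\\ c&\boldsymbol 0\end{pmatrix},\qquad c\in\mathbb{C},\ |c|=1 .$$ Then the continuous spectrum of $P_B$ is the real line, and the discrete spectrum of $P_B$ (its set of eigenvalues) is $\bigcup_{k=1}^{n-1}\frac{1}{\ell_k}\mathbb{Z}$, where $\ell_k=\beta_{k+1}-\alpha_k$ is the length of the $k$th bounded interval $J_k$. The multiplicity of each eigenvalue $\lambda$ is $\#\{1\le k\le n-1:\ell_k\lambda\in\mathbb{Z}\}$. Hence $0$ is an eigenvalue with multiplicity $n-1$ and, counting multiplicity, the discrete spectrum has uniform density $\sum_{k=1}^{n-1}\ell_k$, in the sense that for any $a\in\mathbb{R}$ $$\frac{\text{number of eigenvalues in }[a-N,a+N]}{2N}\to\sum_{k=1}^{n-1}\ell_k\quad\text{as }N\to\infty.$$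
   Context: Fix $-\infty<\beta_1<\alpha_1<\beta_2<\alpha_2<\cdots<\beta_n<\alpha_n<\infty$ and put $J_0=(-\infty,\beta_1)$, $J_k=(\alpha_k,\beta_{k+1})$ for $1\le k\le n-1$, $J_n=(\alpha_n,\infty)$, $\Omega=\bigcup_{k=0}^nJ_k$. For $B\in U(n)$, $P_B=\frac{1}{i2\pi}\frac{d}{dx}$ is the selfadjoint operator in $L^2(\Omega)$ whose domain is the set of $f\in L^2(\Omega)$, absolutely continuous on components with $f'\in L^2(\Omega)$, and $B(f(\beta_1),\dots,f(\beta_n))^T=(f(\alpha_1),\dots,f(\alpha_n))^T$, where $f(\beta_i)$, $f(\alpha_i)$ are limits from the left, resp. right. In the block form, the first column of $B$ is $(\boldsymbol 0,c)^T$ with $\boldsymbol 0\in\mathbb{C}^{n-1}$. The continuous spectrum of $P_B$ means the spectrum of the restriction of $P_B$ to the orthogonal complement of the closed span of its eigenvectors. *)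

(* Defs.v *)
From HB Require Import structures.
From mathcomp Require Import all_boot all_order all_algebra.
From mathcomp Require Import complex.
From mathcomp Require Import all_classical all_reals all_analysis.

Set Implicit Arguments.
Unset Strict Implicit.
Unset Printing Implicit Defensive.

Import Order.TTheory GRing.Theory Num.Theory.
Import numFieldNormedType.Exports.

Local Open Scope classical_set_scope.
Local Open Scope ring_scope.
Local Open Scope complex_scope.

Section L2.
Context {R : realType}.
Local Notation mu := (@lebesgue_measure R).
Local Notation normc := ComplexField.Normc.normc.

(* Elements of the complex Hilbert space L^2(D) are represented by functions
   R -> R[i], two of them being identified when they agree almost everywhere
   on D.  Measurability and integrals are taken on real and imaginary parts. *)

Definition cmeasurable (D : set R) (f : R -> R[i]) : Prop :=
  measurable_fun D (fun x => complex.Re (f x)) /\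
  measurable_fun D (fun x => complex.Im (f x)).

Definition L2 (D : set R) : set (R -> R[i]) :=
  [set f | cmeasurable D f /\
    (\int[mu]_(x in D) ((normc (f x)) ^+ 2)%:E < +oo)%E].

Definition cintegral (D : set R) (f : R -> R[i]) : R[i] :=
  (\int[mu]_(x in D) complex.Re (f x)) +i* (\int[mu]_(x in D) complex.Im (f x)).

Definition L2dot (D : set R) (f g : R -> R[i]) : R[i] :=
  cintegral D (fun x => f x * (g x)^*).

Definition L2norm (D : set R) (f : R -> R[i]) : R :=
  Num.sqrt (\int[mu]_(x in D) (normc (f x)) ^+ 2).

Definition span (S : set (R -> R[i])) : set (R -> R[i]) :=
  [set f | exists m (c : 'I_m -> R[i]) (v : 'I_m -> (R -> R[i])),
    (forall i, S (v i)) /\ (forall x, f x = \sum_(i < m) c i * v i x)].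

Definition closed_span (D : set R) (S : set (R -> R[i])) : set (R -> R[i]) :=
  [set f | L2 D f /\
    forall e : R, 0 < e ->
      exists2 g, span S g & L2norm D (fun x => f x - g x) < e].

Definition orthocomp (D : set R) (S : set (R -> R[i])) : set (R -> R[i]) :=
  [set f | L2 D f /\ forall g, S g -> L2dot D f g = 0].

(* An unbounded operator T in L^2(D) is given by its graph: [T f g] means that
   f is in the domain of T and that T f = g. *)
Definition operator := (R -> R[i]) -> (R -> R[i]) -> Prop.

Definition eigenspace (D : set R) (T : operator) (lam : R[i]) :
    set (R -> R[i]) :=
  [set f | exists2 g, T f g & ae_eq mu D g (fun x => lam * f x)].

Definition eigenvectors (D : set R) (T : operator) (lam : R[i]) :
    set (R -> R[i]) :=
  [set f | eigenspace D T lam f /\ ~ ae_eq mu D f (fun=> 0)].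

Definition eigenvalues (D : set R) (T : operator) : set R[i] :=
  [set lam | eigenvectors D T lam !=set0].

Definition lin_indep (D : set R) (m : nat) (v : 'I_m -> (R -> R[i])) : Prop :=
  forall c : 'I_m -> R[i],
    ae_eq mu D (fun x => \sum_(i < m) c i * v i x) (fun=> 0) ->
    forall i, c i = 0.

Definition multiplicity (D : set R) (T : operator) (lam : R[i]) : \bar R :=
  ereal_sup [set (m%:R)%:E | m in [set m : nat |
    exists v : 'I_m -> (R -> R[i]),
      (forall i, eigenspace D T lam (v i)) /\ lin_indep D v]].

Definition restriction (T : operator) (H : set (R -> R[i])) : operator :=
  fun f g => T f g /\ H f.

(* For T acting in the closed subspace H of L^2(D): T - lam is a bijection from
   the domain of T onto H, with bounded inverse. *)
Definition in_resolvent_set (D : set R) (H : set (R -> R[i])) (T : operator)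
    (lam : R[i]) : Prop :=
  [/\ forall h, H h ->
        exists f g, T f g /\ ae_eq mu D (fun x => g x - lam * f x) h,
      forall f g, T f g -> ae_eq mu D (fun x => g x - lam * f x) (fun=> 0) ->
        ae_eq mu D f (fun=> 0) &
      exists C : R, forall f g, T f g ->
        L2norm D f <= C * L2norm D (fun x => g x - lam * f x)].

Definition spectrum (D : set R) (H : set (R -> R[i])) (T : operator) :
    set R[i] :=
  [set lam | ~ in_resolvent_set D H T lam].

Definition continuous_spectrum (D : set R) (T : operator) : set R[i] :=
  let H := orthocomp D
    (closed_span D (\bigcup_(lam in [set: R[i]]) eigenvectors D T lam)) in
  spectrum D H (restriction T H).

End L2.

Section momentum.
Context {R : realType}.
Local Notation mu := (@lebesgue_measure R).
Local Notation normc := ComplexField.Normc.normc.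

Definition abs_continuous (J : set R) (f : R -> R[i]) : Prop :=
  forall e : R, 0 < e -> exists2 d : R, 0 < d &
    forall (m : nat) (a b : 'I_m -> R),
      (forall i, a i < b i /\ `[a i, b i]%classic `<=` J) ->
      (forall i j, i != j -> b i <= a j \/ b j <= a i) ->
      \sum_(i < m) (b i - a i) < d ->
      \sum_(i < m) normc (f (b i) - f (a i)) < e.

Definition is_cderive (f : R -> R[i]) (x : R) (df : R[i]) : Prop :=
  is_derive x 1 (fun y => complex.Re (f y)) (complex.Re df) /\
  is_derive x 1 (fun y => complex.Im (f y)) (complex.Im df).

Definition ccvg (f : R -> R[i]) (F : set_system R) (l : R[i]) : Prop :=
  ((fun x => complex.Re (f x)) @ F --> complex.Re l) /\
  ((fun x => complex.Im (f x)) @ F --> complex.Im l).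

(* The endpoints are beta 1 < alpha 1 < ... < beta n < alpha n; the values of
   alpha and beta outside of 1, ..., n are never used. *)
Definition ordered_endpoints (n : nat) (alpha beta : nat -> R) : Prop :=
  (forall k, (1 <= k <= n)%N -> beta k < alpha k) /\
  (forall k, (1 <= k < n)%N -> alpha k < beta k.+1).

Definition Jint (n : nat) (alpha beta : nat -> R) (k : nat) : set R :=
  if k == 0%N then `]-oo, beta 1%N[%classic
  else if k == n then `]alpha n, +oo[%classic
  else `]alpha k, beta k.+1[%classic.

Definition Omega (n : nat) (alpha beta : nat -> R) : set R :=
  \bigcup_(k in [set k | (k <= n)%N]) Jint n alpha beta k.

Definition len (alpha beta : nat -> R) (k : nat) : R := beta k.+1 - alpha k.

Definition ae_derivative (D : set R) (f df : R -> R[i]) : Prop :=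
  {ae mu, forall x, D x -> is_cderive f x (df x)}.

(* i : 'I_n stands for the (i+1)-st endpoint. *)
Definition boundary_condition (n : nat) (alpha beta : nat -> R)
    (B : 'M[R[i]]_n) (f : R -> R[i]) : Prop :=
  exists u v : 'cV[R[i]]_n,
    [/\ forall i : 'I_n, ccvg f ((beta i.+1)^'-) (u i 0),
        forall i : 'I_n, ccvg f ((alpha i.+1)^'+) (v i 0) &
        B *m u = v].

Definition dom_PB (n : nat) (alpha beta : nat -> R) (B : 'M[R[i]]_n) :
    set (R -> R[i]) :=
  let D := Omega n alpha beta in
  [set f | [/\ L2 D f,
     forall k, (k <= n)%N -> abs_continuous (Jint n alpha beta k) f,
     exists2 df, L2 D df & ae_derivative D f df &
     boundary_condition alpha beta B f]].

Definition PB (n : nat) (alpha beta : nat -> R) (B : 'M[R[i]]_n) :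
    @operator R :=
  let D := Omega n alpha beta in
  fun f g => dom_PB alpha beta B f /\
    exists df, [/\ L2 D df, ae_derivative D f df &
      forall x, g x = (0 +i* (2 * pi))^-1 * df x].

(* The n x n block matrix (0 I_(n-1) ; c 0) whose first column is (0, c)^T. *)
Definition block_B (n : nat) (c : R[i]) : 'M[R[i]]_n :=
  \matrix_(i < n, j < n)
    if j == i.+1 :> nat then 1
    else if (i.+1 == n) && (j == 0%N :> nat) then c
    else 0.

Definition eigen_count (D : set R) (T : operator) (a b : R) : \bar R :=
  (\esum_(lam in eigenvalues D T `&` (real_complex R @` `[a, b]))
     multiplicity D T lam)%E.

End momentum.

(* Main.v *)
Require Import Defs.
From HB Require Import structures.
From mathcomp Require Import all_boot all_order all_algebra.
From mathcomp Require Import complex.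
From mathcomp Require Import all_classical all_reals all_analysis.
From mathcomp Require Import measurable_realfun.
From mathcomp Require Import ring lra zify.
(* Imported again so that [eigenspace], [span], etc. denote the notions of
   [Defs] and not their homonyms in linear algebra. *)
Require Import Defs.

(** Absolutely continuous functions satisfy the fundamental theorem of calculus,
    so [f' = 2 pi i (lam f + h)] is solved on an interval by a particular solution
    plus multiples of [cexp lam = exp (2 pi i lam x)].

    The matrix [B] makes [f] periodic on each bounded [J_k] and glues the two
    half-lines into one line.  An eigenfunction is therefore a multiple of
    [cexp lam] on each [J_k]; it vanishes on the half-lines, where [cexp lam]
    cannot be square integrable on both sides, and it survives on [J_k] only if
    [l_k lam] is an integer.  This gives the eigenvalues, their multiplicities
    and, by counting integers in intervals, their density.

    For non-real [lam], integrating
    [sg (Im lam) (|f|^2)' <= - 2 pi |Im lam| |f|^2 + 2 pi / |Im lam| |h|^2]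
    bounds the solutions [f] of [(P - lam) f = h], and the boundary terms cancel.
    The same inequality puts the solution on the whole line given by an integral
    from infinity in L^2; adding multiples of [cexp lam] on the [J_k] restores the
    boundary condition.  Pairing with eigenfunctions shows that the solution is
    orthogonal to them if [h] is, so completeness of the Fourier basis is not
    needed.  For real [lam], [P - lam] is not onto: a piece of [cexp lam]
    supported in [J_n] is not in its range. *)

Set Implicit Arguments.
Unset Strict Implicit.
Unset Printing Implicit Defensive.

Import Order.TTheory GRing.Theory Num.Theory.
Import numFieldNormedType.Exports.

Local Open Scope classical_set_scope.
Local Open Scope ring_scope.
Local Open Scope complex_scope.

(** * Absolutely continuous functions *)

Section real_ac.
Context {R : realType}.
Local Notation mu := (@lebesgue_measure R).
Implicit Types (J : set R) (F G : R -> R).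

(** Derivatives exist only almost everywhere and absolute continuity comes in epsilon-delta form, so
    everything rests on a comparison principle: a bound on the derivative integrates to a bound on
    increments. The energy estimate consumes it as an inequality; using both signs gives the
    fundamental theorem. Representatives are arbitrary outside [Omega], in particular at the
    endpoints. Each restriction to [J k] is therefore traded for a function [phi k] on the whole
    line, whose endpoint values are the one-sided limits of the boundary condition. The sign of
    [Im lam] decides which half-line carries [cexp lam] in L^2: [J 0] if negative, [J n] if
    positive, neither if zero. Off the real axis this leaves exactly one free constant for the
    gluing condition; on the real axis it leaves none. As [|c| = 1], [|f|] agrees at the two glued
    ends, which is why their boundary terms cancel. In place of Cauchy-Schwarz,
    [a b <= s a^2 + b^2 / s] is used with a suitable [s > 0]. *)

Definition ac J F : Prop :=
  forall e : R, 0 < e -> exists2 d : R, 0 < d &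
    forall (m : nat) (a b : 'I_m -> R),
      (forall i, a i < b i /\ `[a i, b i]%classic `<=` J) ->
      (forall i j, i != j -> b i <= a j \/ b j <= a i) ->
      \sum_(i < m) (b i - a i) < d ->
      \sum_(i < m) `|F (b i) - F (a i)| < e.

Lemma negligible_open (A : set R) (e : R) : mu.-negligible A -> 0 < e ->
  exists U, [/\ open U, A `<=` U & (mu U < e%:E)%E].
Proof.
move=> /negligible_outer_measure A0 e0.
have e20 : 0 < e / 2 by rewrite divr_gt0.
have [U [oU AU]] := outer_measure_open_le A e20.
rewrite A0 add0e => h; exists U; split => //.
by rewrite (le_lt_trans h)// lte_fin ltr_pdivrMr// mulr_natr mulr2n ltrDl.
Qed.

Lemma is_derive_local F (x d e : R) : is_derive x 1 F d -> 0 < e ->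
  exists2 r : R, 0 < r & forall h, `|h| < r -> `|F (x + h) - F x - d * h| <= e * `|h|.
Proof.
move=> dF e0.
have [Fx Fd] := dF.
have : (fun h => h^-1 *: ((F \o shift x) (h *: (1:R)) - F x)) @ 0^' --> d.
  by rewrite -Fd; exact: Fx.
move=> /cvgrPdist_le /(_ _ e0) [r /= r0 H].
exists r => // h hr.
have [->|h0] := eqVneq h 0; first by rewrite addr0 subrr mulr0 subr0 normr0 mulr0.
have := H h; rewrite /ball/= sub0r normrN => /(_ hr h0).
rewrite [h *: 1]mulr1 (addrC h x) => H1.
have -> : F (x + h) - F x - d * h = - ((d - h^-1 * (F (x + h) - F x)) * h).
  by field.
by rewrite normrN normrM ler_wpM2r.
Qed.

(* Continuous induction on [s]: a point of differentiability pushes the bound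
   to the right at the cost [e * (t - s)]; any other point lies in an open set
   of small measure, where one more interval is charged to the sum that
   absolute continuity controls. *)
Lemma ac_derive_le0 F (x y : R) : x <= y -> ac `[x, y] F ->
  {ae mu, forall t, `]x, y[%classic t -> exists2 d, is_derive t 1 F d & d <= 0} ->
  F y <= F x.
Proof.
move=> xy acF dF.
(* The slack [e * (y - x)] pays for the points of differentiability, the additional [e] for the
   exceptional intervals. *)
suff H e : 0 < e -> F y - F x <= e * (y - x + 1).
  rewrite -subr_le0; apply/ler_addgt0Pl => e e0; rewrite addr0.
  have yx1 : 0 < y - x + 1 by rewrite ltr_wpDl// subr_ge0.
  by have := H (e / (y - x + 1)) (divr_gt0 e0 yx1); rewrite divfK// gt_eqF.
move=> e0.
have [dl dl0 acFe] := acF e e0.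
(* The exceptional points, together with [x] and [y], where nothing is assumed about the
   derivative. *)
pose A := (~` [set t | `]x, y[%classic t -> exists2 d, is_derive t 1 F d & d <= 0])
  `|` [set x; y].
have nA : mu.-negligible A.
  apply: negligibleU; first exact: dF.
  apply: negligibleU; (apply/negligibleP; first exact: measurable_set1);
    exact: lebesgue_measure_set1.
have [U [oU AU mUd]] := negligible_open nA dl0.
have mU : measurable U by exact: open_measurable.
(* [a] and [b] list the intervals charged so far. Their total length stays below [mu U < dl], so at
   [s = y] absolute continuity bounds the last sum by [e]. *)
pose good s m (a b : 'I_m -> R) :=
  [/\ forall i, a i < b i /\ `[a i, b i]%classic `<=` `[x, s]%classic,
     forall i j, i != j -> b i <= a j \/ b j <= a i,
     ((\sum_(i < m) (b i - a i))%:E <= mu (U `&` `[x, s]))%E &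
     F s - F x <= e * (s - x) + \sum_(i < m) `|F (b i) - F (a i)|].
pose S := [set s | x <= s <= y /\ exists m a b, @good s m a b].
have Sx : S x.
  split; first by rewrite lexx.
  exists 0, (fun=> 0), (fun=> 0); split.
  - by case.
  - by case.
  - by rewrite big_ord0.
  - by rewrite big_ord0 !subrr mulr0 addr0.
have hS : has_sup S.
  by split; [exists x | exists y => s [/andP[]]].
(* The step starts slightly to the left of [s0] and ends to its right: applied at [s0 = sup S], it
   shows at once that the supremum is attained and that it cannot be less than [y]. *)
have step s0 : x <= s0 <= y -> exists2 r, 0 < r &
    forall s t, S s -> s0 - r < s <= s0 -> s0 <= t < s0 + r -> t <= y -> S t.
  move=> /andP[xs0 s0y].
  have [As0|nAs0] := pselect (A s0).
    have /AU Us0 := As0.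
    have [r /= r0 rU] : \forall r \near (0:R)^'+, ball s0 r `<=` U.
      by have := open_nbhs_nbhs (conj oU Us0); move/nbhs_ballP => [r r0 rU];
        near=> r'; apply: subset_trans rU; apply: le_ball; near: r';
        exact: nbhs_right_le.
    have r20 : 0 < r / 2 by rewrite divr_gt0.
    have {rU} rU : ball s0 (r/2) `<=` U.
      apply: rU => //=; rewrite sub0r normrN gtr0_norm//.
      by rewrite ltr_pdivrMr// mulr_natr mulr2n ltrDl.
    exists (r / 2) => // s t [/andP[xs sy] [m [a [b [ab1 ab2 ab3 ab4]]]]].
    move=> /andP[s0s ss0] /andP[s0t ts0] ty.
    have stle : s <= t by exact: le_trans s0t.
    have [<-|st] := eqVneq s t.
      by split; [rewrite xs|exists m, a, b].
    have {stle}st : s < t by rewrite lt_neqAle st.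
    split; first by rewrite ty (le_trans xs (ltW st)).
    exists m.+1, (fun i => oapp a s (unlift ord0 i)),
      (fun i => oapp b t (unlift ord0 i)); split.
    - move=> i; case: unliftP => [j|] _ /=.
        have [? H] := ab1 j; split => //; apply: (subset_trans H).
        by apply: subset_itvl; rewrite bnd_simp ltW.
      by split => //; apply: subset_itvr; rewrite bnd_simp.
    - move=> i j; case: unliftP => [i' ->|->] /=; case: unliftP => [j' ->|->] /=.
      + by rewrite (inj_eq lift_inj) => /ab2.
      + move=> _; left; have [aib /(_ (b i'))] := ab1 i'.
        by rewrite /= !in_itv/= lexx (ltW aib) => /(_ isT)/andP[].
      + move=> _; right; have [aib /(_ (b j'))] := ab1 j'.
        by rewrite /= !in_itv/= lexx (ltW aib) => /(_ isT)/andP[].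
      + by rewrite ?eqxx.
    - rewrite big_ord_recl unlift_none /=.
      under eq_bigr do rewrite liftK /=.
      rewrite EFinD addeC.
      have -> : (t - s)%:E = mu `]s, t] :> \bar R.
        by rewrite lebesgue_measure_itv/= lte_fin st EFinB.
      apply: (le_trans (leeD2r _ ab3)).
      rewrite -measureU//=; last 2 first.
        - exact: measurableI.
        - apply/seteqP; split=> // u [[_]] /=; rewrite !in_itv/=.
          by move=> /andP[_ us] /andP[su]; rewrite leNgt su in us.
      apply: le_measure; rewrite ?inE.
        - by apply: measurableU => //; exact: measurableI.
        - exact: measurableI.
        - move=> u [[Uu]|] /=; rewrite !in_itv/=.
            by move=> /andP[-> us]; split => //; rewrite (le_trans us (ltW st)).
          move=> /andP[su ut]; split; last by rewrite ut (le_trans xs (ltW su)).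
          apply: rU; rewrite /ball/= ltr_norml; apply/andP; split; lra.
    - rewrite big_ord_recl unlift_none /=.
      under eq_bigr do rewrite liftK /=.
      have := ler_norm (F t - F s).
      have : 0 <= e * (t - s) by rewrite mulr_ge0 ?subr_ge0// ltW.
      move: ab4; lra.
  have [d dFd d0] : exists2 d, is_derive s0 1 F d & d <= 0.
    have : ~ ~ [set t | `]x, y[%classic t -> exists2 d, is_derive t 1 F d & d <= 0] s0.
      by move=> ?; apply: nAs0; left.
    move/contrapT; apply; rewrite /= in_itv/= !lt_neqAle xs0 s0y !andbT.
    by apply/andP; split; apply/negP => /eqP E; apply: nAs0; right;
      [left; rewrite /= E|right; rewrite /= -E].
  have [r r0 H] := is_derive_local dFd e0.
  exists r => // s t [/andP[xs sy] [m [a [b [ab1 ab2 ab3 ab4]]]]].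
  move=> /andP[s0s ss0] /andP[s0t ts0] ty.
  split; first by rewrite ty (le_trans xs)// (le_trans ss0).
  exists m, a, b; split=> //.
  - move=> i; have [? K] := ab1 i; split => //; apply: (subset_trans K).
    by apply: subset_itvl; rewrite bnd_simp (le_trans ss0).
  - apply: (le_trans ab3); apply: le_measure; rewrite ?inE//=.
    + exact: measurableI.
    + exact: measurableI.
    + by apply: setIS; apply: subset_itvl; rewrite bnd_simp (le_trans ss0).
  - have H1 : F t - F s0 <= e * (t - s0).
      have := H (t - s0); rewrite addrCA subrr addr0 ger0_norm ?subr_ge0//.
      have tr : t - s0 < r by lra.
      move=> /(_ tr); rewrite ler_norml => /andP[_].
      have : d * (t - s0) <= 0 by rewrite mulr_le0_ge0// subr_ge0.
      lra.
    have H2 : F s0 - F s <= e * (s0 - s).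
      have := H (s - s0); rewrite addrCA subrr addr0 ler0_norm ?subr_le0//.
      have tr : - (s - s0) < r by lra.
      move=> /(_ tr); rewrite ler_norml => /andP[+ _].
      have : 0 <= d * (s - s0) by rewrite mulr_le0// subr_le0.
      lra.
    move: ab4; lra.
have [s0 [s0xy adh ubS]] : exists s0, [/\ x <= s0 <= y,
    forall r, 0 < r -> exists2 s, S s & s0 - r < s & forall s, S s -> s <= s0].
  exists (sup S); split.
  - apply/andP; split; first exact: ub_le_sup hS.2 _ Sx.
    by apply: sup_le_ub => [|s [/andP[]]]; first exists x.
  - by move=> r r0; have [s Ss ss0] := sup_adherent r0 hS; exists s.
  - by move=> s Ss; exact: ub_le_sup hS.2 _ Ss.
have [r r0 H] := step s0 s0xy.
have [s Ss ss0] := adh r r0.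
have sles0 := ubS s Ss.
have [s0x s0y] := andP s0xy.
have Sy : S y.
  have [rS|yr] := ltP (s0 + r / 2) y.
    have : S (s0 + r / 2).
      by apply: (H s _ Ss); rewrite ?ss0 ?(ltW rS)//; apply/andP; split; lra.
    by move/ubS; lra.
  apply: (H s _ Ss) => //; first by rewrite ss0.
  by rewrite s0y /=; lra.
have [_ [m [a [b [ab1 ab2 ab3 ab4]]]]] := Sy.
have : \sum_(i < m) `|F (b i) - F (a i)| < e.
  apply: acFe => //; rewrite -lte_fin; apply: (le_lt_trans ab3).
  apply: le_lt_trans mUd; apply: le_measure; rewrite ?inE//=.
  exact: measurableI.
move: ab4; lra.
Unshelve. all: by end_near. Qed.

Lemma acS J J' F : J' `<=` J -> ac J F -> ac J' F.
Proof.
move=> JJ' acF e e0; have [d d0 H] := acF e e0; exists d => // m a b ab.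
by apply: H => i; have [? ?] := ab i; split => //; exact: subset_trans JJ'.
Qed.

(** [ac] sees a function only through its increments, so domination of increments suffices. Closure
    under sums, opposites and products, and the Lipschitz criterion, are all instances. *)
Lemma ac_dom J F G H (C : R) : ac J F -> ac J G ->
  (forall s t, s < t -> `[s, t]%classic `<=` J ->
    `|H t - H s| <= C * (`|F t - F s| + `|G t - G s|)) ->
  ac J H.
Proof.
move=> acF acG HFG e e0.
pose K := `|C| + 1.
have K0 : 0 < K by rewrite /K ltr_wpDl.
have e'0 : 0 < e / (2 * K) by rewrite divr_gt0// mulr_gt0.
have [d1 d10 H1] := acF _ e'0.
have [d2 d20 H2] := acG _ e'0.
exists (Num.min d1 d2) => [|m a b ab1 ab2]; first by rewrite lt_min d10.
rewrite lt_min => /andP[l1 l2].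
have := H1 m a b ab1 ab2 l1; have := H2 m a b ab1 ab2 l2.
set S1 := \sum_(i < m) _; set S2 := \sum_(i < m) _ => h1 h2.
apply: (@le_lt_trans _ _ (K * (S2 + S1))).
  rewrite /S1 /S2 -big_split/= mulr_sumr; apply: ler_sum => i _.
  have [abi abiJ] := ab1 i.
  apply: (le_trans (HFG _ _ abi abiJ)); rewrite ler_wpM2r ?addr_ge0//.
  by rewrite (le_trans (ler_norm C))// lerDl.
have -> : e = K * (e / (2 * K) + e / (2 * K)) by field; rewrite gt_eqF.
by rewrite ltr_pM2l// ltrD.
Qed.

Lemma ac_id J : ac J id.
Proof.
move=> e e0; exists e => // m a b ab _; apply: le_lt_trans; apply: ler_sum => i _.
by rewrite gtr0_norm// subr_gt0; have [] := ab i.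
Qed.

Lemma ac_lipschitz J F (C : R) :
  (forall s t, s < t -> `[s, t]%classic `<=` J -> `|F t - F s| <= C * (t - s)) ->
  ac J F.
Proof.
move=> FC; apply: (@ac_dom J id id F `|C| (@ac_id J) (@ac_id J)) => s t st stJ.
apply: (le_trans (FC s t st stJ)).
have st0 : 0 <= t - s by rewrite subr_ge0 ltW.
apply: (@le_trans _ _ (`|C| * (t - s))); first by rewrite ler_wpM2r// ler_norm.
by rewrite ler_wpM2l//= (ger0_norm st0) lerDl.
Qed.

Lemma acD J F G : ac J F -> ac J G -> ac J (fun x => F x + G x).
Proof.
move=> acF acG; apply: (ac_dom (C := 1) acF acG) => s t st stJ.
by rewrite mul1r opprD addrACA ler_normD.
Qed.

Lemma acN J F : ac J F -> ac J (fun x => - F x).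
Proof.
move=> acF; apply: (ac_dom (C := 1) acF acF) => s t st stJ.
by rewrite mul1r -opprD normrN lerDl.
Qed.

Lemma acB J F G : ac J F -> ac J G -> ac J (fun x => F x - G x).
Proof. by move=> acF acG; exact: acD acF (acN acG). Qed.

Lemma ac_small J F (e : R) : ac J F -> 0 < e -> exists2 d : R, 0 < d &
  forall s t, s < t -> `[s, t]%classic `<=` J -> t - s < d -> `|F t - F s| < e.
Proof.
move=> acF e0; have [d d0 H] := acF e e0; exists d => // s t st stJ tsd.
have := H 1 (fun=> s) (fun=> t); rewrite !big_ord1; apply => //.
by move=> i j; rewrite !ord1 eqxx.
Qed.

(** Every point is reached from [x] by a fixed number of steps of length at most [d / 2], and [F]
    changes by at most 1 along each. Boundedness is what makes products absolutely continuous. *)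
Lemma ac_bounded F (x y : R) : ac `[x, y] F ->
  exists M : R, forall t, x <= t <= y -> `|F t| <= M.
Proof.
move=> acF; have [d d0 H] := ac_small acF (@ltr01 R).
have d20 : 0 < d / 2 by rewrite divr_gt0.
have step k t : x <= t <= y -> t - x <= k%:R * (d / 2) -> `|F t - F x| <= k%:R.
  elim: k t => [|k IH] t /andP[xt ty].
    rewrite mul0r subr_le0 => tx.
    have -> : t = x by apply/eqP; rewrite eq_le tx.
    by rewrite subrr normr0.
  move=> tk.
  pose s := Num.max x (t - d / 2).
  have [xs st] : x <= s /\ s <= t.
    by rewrite le_max lexx ge_max xt/=; split => //; lra.
  have sy : x <= s <= y by rewrite xs (le_trans st).
  have sk : s - x <= k%:R * (d / 2).
    have k0 : 0 <= k%:R * (d / 2) by rewrite mulr_ge0// ltW.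
    move: tk k0; rewrite /s -natr1 mulrDl mul1r.
    set K := k%:R * _; move: K => K tk k0.
    by case: (leP x (t - d / 2)) => _; lra.
  have := IH s sy sk => h.
  have h1 : `|F t - F s| <= 1.
    have [->|ne] := eqVneq s t; first by rewrite subrr normr0.
    have {}st : s < t by rewrite lt_neqAle ne.
    apply/ltW/H => //; last first.
      have : t - d / 2 <= s by rewrite /s le_max lexx orbT.
      lra.
    by apply: subset_itv; rewrite bnd_simp.
  rewrite -natr1 (_ : F t - F x = (F s - F x) + (F t - F s)); last by ring.
  by rewrite (le_trans (ler_normD _ _))// lerD.
have [k hk] : exists k : nat, (y - x) / (d / 2) <= k%:R.
  by exists (Num.truncn ((y - x) / (d/2))).+1; apply/ltW/truncnS_gt.
exists (k%:R + `|F x|) => t txy.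
have : t - x <= k%:R * (d / 2).
  move: hk; rewrite ler_pdivrMr// => hk; move/andP: txy => [_ ty].
  by apply: le_trans hk; rewrite lerD2r.
move/(step _ _ txy) => h; rewrite -[F t](subrK (F x)).
by rewrite (le_trans (ler_normD _ _))// lerD2r.
Qed.

Lemma acM F G (x y : R) : ac `[x, y] F -> ac `[x, y] G ->
  ac `[x, y] (fun t => F t * G t).
Proof.
move=> acF acG; have [M1 HF] := ac_bounded acF; have [M2 HG] := ac_bounded acG.
apply: (ac_dom (C := Num.max M1 M2) acF acG) => s t st stJ.
have xs : x <= s <= y.
  by have /= := stJ s; rewrite !in_itv/= lexx (ltW st) => /(_ isT).
have xt : x <= t <= y.
  by have /= := stJ t; rewrite !in_itv/= lexx (ltW st) => /(_ isT).
rewrite (_ : F t * G t - F s * G s = (F t - F s) * G t + F s * (G t - G s)); last by ring.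
rewrite (le_trans (ler_normD _ _))// !normrM mulrDr lerD//.
  by rewrite mulrC ler_wpM2r// le_max HG// orbT.
by rewrite ler_wpM2r// le_max HF.
Qed.

(** Half-open intervals are taken because admissible families may share endpoints. *)
Lemma trivIset_oc m (a b : 'I_m -> R) :
  (forall i j, i != j -> b i <= a j \/ b j <= a i) ->
  trivIset setT (fun i => `]a i, b i]%classic).
Proof.
move=> ab; apply/trivIsetP => i j _ _ ij; apply/seteqP; split => // t [] /=.
rewrite !in_itv/= => /andP[ai bi] /andP[aj bj].
have [h|h] := ab i j ij.
  by have := le_lt_trans (le_trans bi h) aj; rewrite ltxx.
by have := le_lt_trans (le_trans bj h) ai; rewrite ltxx.
Qed.

Lemma sum_integral_oc m (a b : 'I_m -> R) (J : set R) (w : R -> R) :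
  (forall i, a i < b i /\ `[a i, b i]%classic `<=` J) ->
  (forall i j, i != j -> b i <= a j \/ b j <= a i) ->
  measurable J -> mu.-integrable J (EFin \o w) -> 
  \sum_(i < m) \int[mu]_(t in `]a i, b i]) w t =
  \int[mu]_(t in \big[setU/set0]_(i < m) `]a i, b i]%classic) w t.
Proof.
move=> ab1 ab2 mJ iw.
have UJ : \big[setU/set0]_(i < m) `]a i, b i]%classic `<=` J.
  move=> t; rewrite -bigcup_seq => -[i _ /= ti]; have [_] := ab1 i; apply.
  by move: ti; rewrite /= !in_itv/= => /andP[/ltW -> ->].
have mU : measurable (\big[setU/set0]_(i < m) `]a i, b i]%classic).
  exact: bigsetU_measurable.
have iU : mu.-integrable (\big[setU/set0]_(i < m) `]a i, b i]%classic) (EFin \o w).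
  exact: integrableS iw.
rewrite {2}/Rintegral integral_bigsetU_EFin//=; last 3 first.
- by rewrite index_enum_uniq.
- exact: sub_trivIset (trivIset_oc ab2).
- exact: measurable_int iU.
transitivity (fine (\sum_(i < m) (\int[mu]_(t in `]a i, b i]) w t)%:E)%E).
  by rewrite sumEFin.
congr fine; apply: eq_bigr => i _; rewrite /Rintegral fineK//.
apply: integrable_fin_num => //; apply: integrableS iw => //.
move=> t ti; have [_] := ab1 i; apply.
by move: ti; rewrite /= !in_itv/= => /andP[/ltW -> ->].
Qed.

(** Absolute continuity of the Lebesgue integral, applied to the union of the intervals. *)
Lemma ac_dom_integral J F (w : R -> R) : mu.-integrable setT (EFin \o w) ->
  (forall s t, s < t -> `[s, t]%classic `<=` J ->
    `|F t - F s| <= \int[mu]_(u in `]s, t]) `|w u|) ->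
  ac J F.
Proof.
move=> iw Fw e e0; have [d [d0 H]] := integral_normr_continuous iw e0.
exists d => // m a b ab1 ab2 abd.
have ab1' i : a i < b i /\ `[a i, b i]%classic `<=` setT.
  by have [] := ab1 i.
apply: (@le_lt_trans _ _ (\sum_(i < m) \int[mu]_(t in `]a i, b i]) `|w t|)).
  by apply: ler_sum => i _; have [? ?] := ab1 i; exact: Fw.
rewrite (sum_integral_oc ab1' ab2)//; last exact: integrable_norm.
apply: H; first exact: bigsetU_measurable.
rewrite measure_semi_additive_ord//; last 2 first.
- exact: trivIset_oc.
- exact: bigsetU_measurable.
rewrite (eq_bigr (fun i => (b i - a i)%:E)) ?sumEFin//.
by move=> i _; rewrite /= lebesgue_measure_itv/= lte_fin; have [-> _] := ab1 i.
Qed.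

(** Meant for [w = |F'|^2] on a half-line, where [F'] is square integrable but perhaps not
    integrable: the hypothesis is what [|F'| <= 1 / k + k |F'|^2] yields for every [k > 0]. *)
Lemma ac_dom_L2 J F (w : R -> R) : measurable J ->
  mu.-integrable J (EFin \o w) -> (forall t, 0 <= w t) ->
  (forall s t, s < t -> `[s, t]%classic `<=` J -> forall k, 0 < k ->
    `|F t - F s| <= (t - s) / k + k * \int[mu]_(u in `]s, t]) w u) ->
  ac J F.
Proof.
move=> mJ iw w0 Fw e e0.
pose W := \int[mu]_(u in J) w u.
have W0 : 0 <= W by apply: Rintegral_ge0.
(* This [k] keeps the integral terms below [e / 2]; a total length less than [k * (e / 2)] then does
   the same for the other terms. [W + 1] avoids a division by zero. *)
pose k := e / (2 * (W + 1)).
have k0 : 0 < k by rewrite divr_gt0// mulr_gt0// ltr_wpDl.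
exists (k * (e / 2)) => [|m a b ab1 ab2 abd]; first by rewrite mulr_gt0// divr_gt0.
apply: (@le_lt_trans _ _ (\sum_(i < m) ((b i - a i) / k +
    k * \int[mu]_(t in `]a i, b i]) w t))).
  by apply: ler_sum => i _; have [? ?] := ab1 i; exact: Fw.
rewrite big_split/= -mulr_suml -mulr_sumr (sum_integral_oc ab1 ab2)//.
set W' := Rintegral _ _ _.
have W'W : W' <= W.
  rewrite /W' /W /Rintegral.
  have mU : measurable (\big[setU/set0]_(i < m) `]a i, b i]%classic).
    exact: bigsetU_measurable.
  have UJ : \big[setU/set0]_(i < m) `]a i, b i]%classic `<=` J.
    move=> t; rewrite -bigcup_seq => -[i _ /= ti]; have [_] := ab1 i; apply.
    by move: ti; rewrite /= !in_itv/= => /andP[/ltW -> ->].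
  apply: fine_le.
  - by apply: integrable_fin_num => //; apply: integrableS iw.
  - exact: integrable_fin_num.
  - apply: ge0_subset_integral => //; first exact: measurable_int iw.
    by move=> t _; rewrite lee_fin.
have h1 : (\sum_(i < m) (b i - a i)) / k < e / 2 by rewrite ltr_pdivrMr// mulrC.
have h2 : k * W' <= e / 2.
  apply: (@le_trans _ _ (k * (W + 1))).
    by rewrite ler_wpM2l ?(ltW k0)//; lra.
  by rewrite /k le_eqVlt; apply/orP; left; apply/eqP; field; rewrite gt_eqF// ltr_wpDl.
lra.
Qed.

End real_ac.

(** * The fundamental theorem of calculus for absolutely continuous functions *)

Section ac_ftc.
Context {R : realType}.
Local Notation mu := (@lebesgue_measure R).
Implicit Types (F g : R -> R).

Lemma ae_imp (P Q : R -> Prop) :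
  {ae mu, forall x, P x} -> (forall x, P x -> Q x) -> {ae mu, forall x, Q x}.
Proof.
by move=> aP PQ; apply: filterS PQ aP; exact: (ae_filter_ringOfSetsType mu).
Qed.

Lemma ae_imp2 (P1 P2 Q : R -> Prop) :
  {ae mu, forall x, P1 x} -> {ae mu, forall x, P2 x} ->
  (forall x, P1 x -> P2 x -> Q x) -> {ae mu, forall x, Q x}.
Proof.
by move=> aP1 aP2 PQ; apply: filterS2 PQ aP1 aP2; exact: (ae_filter_ringOfSetsType mu).
Qed.

Lemma ae_all (P : R -> Prop) : (forall x, P x) -> {ae mu, forall x, P x}.
Proof. by move=> aP; apply: aeW. Qed.

Lemma Rintegral_itv_split (w : R -> R) (x s t : R) : x <= s -> s <= t ->
  mu.-integrable `[x, t] (EFin \o w) ->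
  \int[mu]_(u in `[x, t]) w u =
  \int[mu]_(u in `[x, s]) w u + \int[mu]_(u in `]s, t]) w u.
Proof.
move=> xs st iw; apply/eqP; rewrite addrC -subr_eq; apply/eqP.
by apply: Rintegral_itvB => //; rewrite bnd_simp.
Qed.

Lemma ac_integral (w : R -> R) (x y : R) : mu.-integrable setT (EFin \o w) ->
  ac `[x, y] (fun t => \int[mu]_(u in `[x, t]) w u).
Proof.
move=> iw; apply: (ac_dom_integral iw) => s t st stxy.
have xs : x <= s.
  by have /= := stxy s; rewrite !in_itv/= lexx (ltW st) => /(_ isT)/andP[].
rewrite (Rintegral_itv_split xs (ltW st)); last exact: integrableS iw.
rewrite addrC addKr; apply: le_normr_Rintegral => //; exact: integrableS iw.
Qed.

Lemma ae_derive_integral (w : R -> R) (x : R) : mu.-integrable setT (EFin \o w) ->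
  {ae mu, forall t, x < t ->
    is_derive t 1 (fun t => \int[mu]_(u in `[x, t]) w u) (w t)}.
Proof.
move=> iw.
have lw : locally_integrable setT w by exact: open_integrable_locally openT iw.
have iwy y : mu.-integrable `[x, y] (EFin \o w) by exact: integrableS iw.
apply: (ae_imp (@FTC1 R w (BLeft x) iwy lw)) => t h xt.
have [dW eW] : derivable (fun t => \int[mu]_(u in `[x, t]) w u) t 1 /\
    derive1 (fun t => \int[mu]_(u in `[x, t]) w u) t = w t.
  by apply: h; rewrite /= lte_fin.
by apply: (DeriveDef dW); move: eW; rewrite derive1E.
Qed.

(** By Lebesgue differentiation, subtracting from [F] the primitive [W] of [g] leaves an absolutely
    continuous function whose derivative is nonpositive almost everywhere. *)
Lemma ac_derive_le F g (x y : R) : x <= y -> ac `[x, y] F ->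
  mu.-integrable `[x, y] (EFin \o g) ->
  {ae mu, forall t, `]x, y[%classic t -> exists2 d, is_derive t 1 F d & d <= g t} ->
  F y - F x <= \int[mu]_(t in `[x, y]) g t.
Proof.
move=> xy acF ig dF.
pose w := g \_ `[x, y].
have iw : mu.-integrable setT (EFin \o w).
  by rewrite /w -restrict_EFin; apply/integrable_restrict => //; rewrite setTI.
pose W t := \int[mu]_(u in `[x, t]) w u.
have -> : \int[mu]_(t in `[x, y]) g t = W y.
  by apply: eq_Rintegral => t txy; rewrite /w patchE txy.
have Wx : W x = 0 by rewrite /W set_itv1 Rintegral_set1.
suff : F y - W y <= F x - W x by rewrite Wx; lra.
apply: (@ac_derive_le0 _ (fun t => F t - W t)) => //.
  by apply: acB => //; exact: ac_integral.
apply: (ae_imp2 dF (ae_derive_integral x iw)) => {dF} t dF dW txy.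
have [d dFd dg] := dF txy.
have xt : x < t by move: txy; rewrite /= in_itv/= => /andP[].
have {}dW := dW xt.
exists (d - w t); first exact: is_deriveB.
rewrite subr_le0 /w patchE mem_set//.
by move: txy; rewrite /= !in_itv/= => /andP[/ltW -> /ltW ->].
Qed.

(** The one-sided comparison, applied to [F] and to [- F]. *)
Lemma ac_FTC F g (x y : R) : x <= y -> ac `[x, y] F ->
  mu.-integrable `[x, y] (EFin \o g) ->
  {ae mu, forall t, `]x, y[%classic t -> is_derive t 1 F (g t)} ->
  F y - F x = \int[mu]_(t in `[x, y]) g t.
Proof.
move=> xy acF ig dF; apply/eqP; rewrite eq_le; apply/andP; split.
  apply: ac_derive_le => //; apply: (ae_imp dF) => {dF} t dF txy.
  by exists (g t) => //; exact: dF.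
rewrite -lerN2 -[leRHS]mulN1r -RintegralZl//.
have := @ac_derive_le (fun t => - F t) (fun t => -1 * g t) x y xy (acN acF).
have -> : - F y - - F x = - (F y - F x) by rewrite opprB opprK addrC.
apply.
- by rewrite (_ : _ \o _ = (fun x => (-1)%:E * (EFin \o g) x)%E);
    [exact: integrableZl|apply/funext => t /=; rewrite EFinM].
- apply: (ae_imp dF) => {dF} t dF txy.
  by exists (-1 * g t) => //; rewrite mulN1r; apply: is_deriveN; exact: dF.
Qed.

End ac_ftc.

(** * Complex-valued functions *)

Section complex_calculus.
Context {R : realType}.
Local Notation mu := (@lebesgue_measure R).
Local Notation normc := ComplexField.Normc.normc.
Local Notation Re := complex.Re.
Local Notation Im := complex.Im.
Implicit Types (F G : R -> R) (f g : R -> R[i]) (lam z w : R[i]).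

Lemma cReM z w : Re (z * w) = Re z * Re w - Im z * Im w.
Proof. by case: z w => [a b] [c d]. Qed.

Lemma cImM z w : Im (z * w) = Re z * Im w + Im z * Re w.
Proof. by case: z w => [a b] [c d]. Qed.

Lemma cReD z w : Re (z + w) = Re z + Re w.
Proof. by case: z w => [a b] [c d]. Qed.

Lemma cImD z w : Im (z + w) = Im z + Im w.
Proof. by case: z w => [a b] [c d]. Qed.

Lemma cReN z : Re (- z) = - Re z. Proof. by case: z. Qed.

Lemma cImN z : Im (- z) = - Im z. Proof. by case: z. Qed.

Lemma Reconj z : Re z^* = Re z. Proof. by case: z. Qed.

Lemma Imconj z : Im z^* = - Im z. Proof. by case: z. Qed.

Lemma complex_ext z w : Re z = Re w -> Im z = Im w -> z = w.
Proof. by case: z w => [a b] [c d] /= -> ->. Qed.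

Lemma sqr_normcE z : normc z ^+ 2 = Re z ^+ 2 + Im z ^+ 2.
Proof. by case: z => a b /=; rewrite sqr_sqrtr// addr_ge0// sqr_ge0. Qed.

Lemma normc_ge0 z : 0 <= normc z.
Proof. by case: z => a b; exact: sqrtr_ge0. Qed.

Lemma normc_mul z w : normc (z * w) = normc z * normc w.
Proof. exact: ComplexField.Normc.normcM. Qed.

Lemma norm_Re_le z : `|Re z| <= normc z.
Proof.
rewrite -(@ler_pXn2r _ 2)// ?nnegrE ?normc_ge0// sqr_normcE real_normK ?num_real//.
by rewrite lerDl sqr_ge0.
Qed.

Lemma norm_Im_le z : `|Im z| <= normc z.
Proof.
rewrite -(@ler_pXn2r _ 2)// ?nnegrE ?normc_ge0// sqr_normcE real_normK ?num_real//.
by rewrite lerDr sqr_ge0.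
Qed.

Lemma normc_le_ReIm z : normc z <= `|Re z| + `|Im z|.
Proof.
rewrite -(@ler_pXn2r _ 2)// ?nnegrE ?normc_ge0 ?addr_ge0// sqr_normcE.
by rewrite -(real_normK (num_real (Re z))) -(real_normK (num_real (Im z))) sqrrD
  lerD2r lerDl mulrn_wge0// mulr_ge0.
Qed.

Lemma normc_eq0 z : normc z = 0 -> z = 0.
Proof. exact: ComplexField.Normc.eq0_normc. Qed.

Lemma is_derive_add F G (x a b : R) : is_derive x 1 F a -> is_derive x 1 G b ->
  is_derive x 1 (fun t => F t + G t) (a + b).
Proof. exact: is_deriveD. Qed.

Lemma is_derive_opp F (x a : R) : is_derive x 1 F a ->
  is_derive x 1 (fun t => - F t) (- a).
Proof. exact: is_deriveN. Qed.

Lemma is_derive_mul F G (x a b : R) : is_derive x 1 F a -> is_derive x 1 G b ->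
  is_derive x 1 (fun t => F t * G t) (a * G x + F x * b).
Proof.
move=> dF dG; have := is_deriveM dF dG; rewrite addrC.
by rewrite [G x *: a]mulrC.
Qed.

Lemma is_cderive_mul f g (x : R) z w : is_cderive f x z -> is_cderive g x w ->
  is_cderive (fun t => f t * g t) x (z * g x + f x * w).
Proof.
move=> [df1 df2] [dg1 dg2]; split.
- rewrite (_ : (fun y => Re (f y * g y)) =
      fun y => Re (f y) * Re (g y) + - (Im (f y) * Im (g y))); last first.
    by apply/funext => y; rewrite cReM.
  have := is_derive_add (is_derive_mul df1 dg1) (is_derive_opp (is_derive_mul df2 dg2)).
  by congr (is_derive _ _ _ _); rewrite cReD !cReM; ring.
- rewrite (_ : (fun y => Im (f y * g y)) =
      fun y => Re (f y) * Im (g y) + Im (f y) * Re (g y)); last first.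
    by apply/funext => y; rewrite cImM.
  have := is_derive_add (is_derive_mul df1 dg2) (is_derive_mul df2 dg1).
  by congr (is_derive _ _ _ _); rewrite cImD !cImM; ring.
Qed.

Lemma is_cderive_add f g (x : R) z w : is_cderive f x z -> is_cderive g x w ->
  is_cderive (fun t => f t + g t) x (z + w).
Proof.
move=> [df1 df2] [dg1 dg2]; split.
- rewrite (_ : (fun y => Re (f y + g y)) = fun y => Re (f y) + Re (g y)).
    by rewrite cReD; exact: is_derive_add.
  by apply/funext => y; rewrite cReD.
- rewrite (_ : (fun y => Im (f y + g y)) = fun y => Im (f y) + Im (g y)).
    by rewrite cImD; exact: is_derive_add.
  by apply/funext => y; rewrite cImD.
Qed.

Lemma is_cderive_cst z (x : R) : is_cderive (fun=> z) x 0.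
Proof. by split; exact: is_derive_cst. Qed.

Lemma is_cderive_id (x : R) : is_cderive (fun t => t%:C) x 1.
Proof. by split; [exact: is_derive_id|exact: is_derive_cst]. Qed.

Lemma is_cderive_near f g (x : R) z : (\near x, f x = g x) ->
  is_cderive f x z -> is_cderive g x z.
Proof.
move=> fg [d1 d2]; split; [move: d1|move: d2]; apply: near_eq_is_derive => //;
  by apply: filterS fg => t ->.
Qed.

Lemma abs_continuousP (J : set R) f : abs_continuous J f <->
  ac J (fun t => Re (f t)) /\ ac J (fun t => Im (f t)).
Proof.
split=> [acf|[acR acI]].
- split=> e e0; have [d d0 H] := acf e e0; exists d => // m a b ab1 ab2 abd.
  + apply: le_lt_trans (H m a b ab1 ab2 abd); apply: ler_sum => i _.
    by rewrite -cReN -cReD norm_Re_le.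
  + apply: le_lt_trans (H m a b ab1 ab2 abd); apply: ler_sum => i _.
    by rewrite -cImN -cImD norm_Im_le.
- move=> e e0; have e20 : 0 < e / 2 by rewrite divr_gt0.
  have [d1 d10 H1] := acR _ e20; have [d2 d20 H2] := acI _ e20.
  exists (Num.min d1 d2) => [|m a b ab1 ab2]; first by rewrite lt_min d10.
  rewrite lt_min => /andP[l1 l2].
  have h1 := H1 m a b ab1 ab2 l1; have h2 := H2 m a b ab1 ab2 l2.
  rewrite [e]splitr; apply: le_lt_trans (ltrD h1 h2).
  rewrite -big_split/=; apply: ler_sum => i _.
  by rewrite (le_trans (normc_le_ReIm _))// cReD cImD cReN cImN.
Qed.

Lemma abs_continuousS (J J' : set R) f : J' `<=` J ->
  abs_continuous J f -> abs_continuous J' f.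
Proof.
by move=> JJ' /abs_continuousP[h1 h2]; apply/abs_continuousP; split; exact: acS JJ' _.
Qed.

Lemma abs_continuousM (x y : R) f g : abs_continuous `[x, y] f ->
  abs_continuous `[x, y] g -> abs_continuous `[x, y] (fun t => f t * g t).
Proof.
move=> /abs_continuousP[f1 f2] /abs_continuousP[g1 g2]; apply/abs_continuousP; split.
- rewrite (_ : (fun y => Re (f y * g y)) =
      fun y => Re (f y) * Re (g y) - (Im (f y) * Im (g y))); last first.
    by apply/funext => t; rewrite cReM.
  by apply: acB; exact: acM.
- rewrite (_ : (fun y => Im (f y * g y)) =
      fun y => Re (f y) * Im (g y) + Im (f y) * Re (g y)); last first.
    by apply/funext => t; rewrite cImM.
  by apply: acD; exact: acM.
Qed.

Lemma abs_continuousD (J : set R) f g : abs_continuous J f ->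
  abs_continuous J g -> abs_continuous J (fun t => f t + g t).
Proof.
move=> /abs_continuousP[f1 f2] /abs_continuousP[g1 g2]; apply/abs_continuousP; split.
- rewrite (_ : (fun y => Re (f y + g y)) = fun y => Re (f y) + Re (g y)).
    exact: acD.
  by apply/funext => t; rewrite cReD.
- rewrite (_ : (fun y => Im (f y + g y)) = fun y => Im (f y) + Im (g y)).
    exact: acD.
  by apply/funext => t; rewrite cImD.
Qed.

Lemma abs_continuous_cst (J : set R) z : abs_continuous J (fun=> z).
Proof.
by apply/abs_continuousP; split; apply: (@ac_lipschitz _ _ _ 0) => s t st _;
  rewrite subrr normr0 mul0r.
Qed.

Lemma abs_continuous_id (J : set R) : abs_continuous J (fun t => t%:C).
Proof.
apply/abs_continuousP; split; first exact: ac_id.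
by apply: (@ac_lipschitz _ _ _ 0) => s t st _; rewrite subrr normr0 mul0r.
Qed.

(** [G] is bounded on the compact interval, so the mean value theorem makes [F] Lipschitz there. *)
Lemma ac_C1 F G (x y : R) : (forall t : R, is_derive t 1 F (G t)) -> continuous G ->
  ac `[x, y] F.
Proof.
move=> dF cG.
have [xy|yx] := leP x y; last first.
  apply: (@ac_lipschitz _ _ _ 0) => s t st stxy.
  have /= := stxy s; rewrite !in_itv/= lexx (ltW st) => /(_ isT)/andP[xs sy].
  by have := le_lt_trans (le_trans xs sy) yx; rewrite ltxx.
have cGN : continuous (fun t => `|G t|).
  by move=> t; apply: continuous_comp; [exact: cG|exact: norm_continuous].
have [c _ Gc] := EVT_max xy (continuous_subspaceT cGN).
apply: (@ac_lipschitz _ _ _ `|G c|) => s t st stxy.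
have cF : continuous F.
  move=> u; apply: differentiable_continuous; apply/derivable1_diffP.
  by have [] := dF u.
have [u ust ->] := MVT st (fun u _ => dF u) (continuous_subspaceT cF).
rewrite normrM [`|t - s|]gtr0_norm ?subr_gt0// ler_wpM2r ?subr_ge0 ?(ltW st)//.
apply: Gc; have := stxy u => /= ; apply.
by move: ust; rewrite !in_itv/= => /andP[/ltW -> /ltW ->].
Qed.

Lemma cFTC f g (x y : R) : x <= y -> abs_continuous `[x, y] f ->
  mu.-integrable `[x, y] (EFin \o (fun t => Re (g t))) ->
  mu.-integrable `[x, y] (EFin \o (fun t => Im (g t))) ->
  {ae mu, forall t, `]x, y[%classic t -> is_cderive f t (g t)} ->
  f y - f x = cintegral `[x, y] g.
Proof.
move=> xy /abs_continuousP[ac1 ac2] i1 i2 df; apply: complex_ext => /=.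
- rewrite cReD cReN; apply: (@ac_FTC _ (fun t => Re (f t))) => //.
  by apply: (ae_imp df) => t h /h[].
- rewrite cImD cImN; apply: (@ac_FTC _ (fun t => Im (f t))) => //.
  by apply: (ae_imp df) => t h /h[].
Qed.

Definition cexp lam (x : R) : R[i] :=
  (expR (- (2 * pi * Im lam * x)) * cos (2 * pi * Re lam * x)) +i*
  (expR (- (2 * pi * Im lam * x)) * sin (2 * pi * Re lam * x)).

(** The number 2 pi i, so that the operator is [tpi^-1] times differentiation. *)
Definition tpi : R[i] := 0 +i* (2 * pi).

Lemma cexpD lam (x y : R) : cexp lam (x + y) = cexp lam x * cexp lam y.
Proof.
apply: complex_ext; rewrite ?(cReM, cImM) /= !mulrDr opprD expRD ?cosD ?sinD; ring.
Qed.

Lemma cexpDl lam lam' (x : R) : cexp (lam + lam') x = cexp lam x * cexp lam' x.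
Proof.
have eI : - (2 * pi * Im (lam + lam') * x) =
  - (2 * pi * Im lam * x) + - (2 * pi * Im lam' * x) by rewrite cImD; ring.
have eR : 2 * pi * Re (lam + lam') * x = 2 * pi * Re lam * x + 2 * pi * Re lam' * x.
  by rewrite cReD; ring.
by rewrite /cexp eI eR expRD cosD sinD; apply: complex_ext; rewrite ?(cReM, cImM) /=; ring.
Qed.

Lemma cexp0l (x : R) : cexp 0 x = 1.
Proof.
by apply: complex_ext; rewrite /= !mulr0 mul0r oppr0 expR0 mul1r ?cos0 ?sin0.
Qed.

Lemma cexpNl lam (x : R) : cexp (- lam) x * cexp lam x = 1.
Proof. by rewrite -cexpDl addNr cexp0l. Qed.

Lemma cexp_neq0 lam (x : R) : cexp lam x != 0.
Proof.
by apply/eqP => h; have := cexpNl lam x; rewrite h mulr0 => /esym/eqP; rewrite oner_eq0.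
Qed.

Lemma normc_cexp lam (x : R) : normc (cexp lam x) = expR (- (2 * pi * Im lam * x)).
Proof.
apply/eqP; rewrite -(@eqrXn2 _ 2)// ?normc_ge0 ?expR_ge0// sqr_normcE /= !exprMn.
by rewrite -mulrDr cos2Dsin2 mulr1.
Qed.

Lemma is_derive_lin (k x : R) : is_derive x 1 (fun t => k * t) k.
Proof.
have := is_derive_mul (is_derive_cst k x 1) (is_derive_id x (1:R)).
by rewrite mul0r add0r mulr1.
Qed.

Lemma is_derive_expk (k x : R) :
  is_derive x 1 (fun t => expR (- (k * t))) (- k * expR (- (k * x))).
Proof.
have := @is_derive1_comp _ (@expR R) (fun t => - (k * t)) _ _ _ (is_derive_expR (- (k * x))) (is_derive_opp (is_derive_lin k x)).
by rewrite mulrC.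
Qed.

Lemma is_derive_cosk (k x : R) :
  is_derive x 1 (fun t => cos (k * t)) (- k * sin (k * x)).
Proof.
have := @is_derive1_comp _ (@cos R) (fun t => (k * t)) _ _ _ (is_derive_cos (k * x)) (is_derive_lin k x).
by rewrite mulNr mulrC mulNr.
Qed.

Lemma is_derive_sink (k x : R) :
  is_derive x 1 (fun t => sin (k * t)) (k * cos (k * x)).
Proof.
have := @is_derive1_comp _ (@sin R) (fun t => (k * t)) _ _ _ (is_derive_sin (k * x)) (is_derive_lin k x).
by rewrite mulrC.
Qed.

Lemma is_cderive_cexp lam (x : R) : is_cderive (cexp lam) x (tpi * lam * cexp lam x).
Proof.
have e := is_derive_expk (2 * pi * Im lam) x.
split.
- have := is_derive_mul e (is_derive_cosk (2 * pi * Re lam) x).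
  by congr (is_derive _ _ _ _); rewrite !cReM cImM/=; ring.
- have := is_derive_mul e (is_derive_sink (2 * pi * Re lam) x).
  by congr (is_derive _ _ _ _); rewrite !cImM cReM/=; ring.
Qed.

Lemma continuous_lin (k : R) : continuous (fun t : R => k * t).
Proof. by move=> x; apply: mulrl_continuous. Qed.

Lemma abs_continuous_cexp (x y : R) lam : abs_continuous `[x, y] (cexp lam).
Proof.
have ace (k : R) : ac `[x, y] (fun t => expR (- (k * t))).
  apply: (@ac_C1 _ (fun t => - k * expR (- (k * t)))) => t; first exact: is_derive_expk.
  apply: cvgM; first exact: cvg_cst.
  apply: (@continuous_comp _ _ _ (fun u => - (k * u)) expR); last exact: continuous_expR.
  by apply: cvgN; exact: continuous_lin.
have acc (k : R) : ac `[x, y] (fun t => cos (k * t)).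
  apply: (@ac_C1 _ (fun t => - k * sin (k * t))) => t; first exact: is_derive_cosk.
  apply: cvgM; first exact: cvg_cst.
  apply: (@continuous_comp _ _ _ (fun u => (k * u)) (@sin R)); last exact: continuous_sin.
  exact: continuous_lin.
have acs (k : R) : ac `[x, y] (fun t => sin (k * t)).
  apply: (@ac_C1 _ (fun t => k * cos (k * t))) => t; first exact: is_derive_sink.
  apply: cvgM; first exact: cvg_cst.
  apply: (@continuous_comp _ _ _ (fun u => (k * u)) (@cos R)); last exact: continuous_cos.
  exact: continuous_lin.
by apply/abs_continuousP; split; exact: acM.
Qed.

Lemma conj_cexp (r x : R) : (cexp r%:C x)^* = cexp (- r%:C) x.
Proof.
by apply: complex_ext; rewrite ?(Reconj, Imconj) /= !(mulrN, mulNr, mulr0, mul0r, oppr0)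
  expR0 !mul1r ?cosN ?sinN.
Qed.

Lemma tpi_neq0 : tpi != 0.
Proof.
apply/eqP => -[/eqP]; rewrite mulf_eq0 pnatr_eq0/= gt_eqF//; exact: pi_gt0.
Qed.

End complex_calculus.

(** * Square integrable functions *)

Section L2_toolkit.
Context {R : realType}.
Local Notation mu := (@lebesgue_measure R).
Local Notation normc := ComplexField.Normc.normc.
Local Notation Re := complex.Re.
Local Notation Im := complex.Im.
Implicit Types (f g : R -> R[i]) (lam z w : R[i]) (D E : set (measurableTypeR R)).

Lemma cmeasurableD D f g : cmeasurable D f -> cmeasurable D g ->
  cmeasurable D (fun x => f x + g x).
Proof.
move=> [f1 f2] [g1 g2]; split.
- rewrite (_ : (fun y => Re (f y + g y)) = fun y => Re (f y) + Re (g y)).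
    exact: measurable_funD.
  by apply/funext => t; rewrite cReD.
- rewrite (_ : (fun y => Im (f y + g y)) = fun y => Im (f y) + Im (g y)).
    exact: measurable_funD.
  by apply/funext => t; rewrite cImD.
Qed.

Lemma cmeasurableM D f g : cmeasurable D f -> cmeasurable D g ->
  cmeasurable D (fun x => f x * g x).
Proof.
move=> [f1 f2] [g1 g2]; split.
- rewrite (_ : (fun y => Re (f y * g y)) =
      fun y => Re (f y) * Re (g y) - (Im (f y) * Im (g y))); last first.
    by apply/funext => t; rewrite cReM.
  by apply: measurable_funB; exact: measurable_funM.
- rewrite (_ : (fun y => Im (f y * g y)) =
      fun y => Re (f y) * Im (g y) + Im (f y) * Re (g y)); last first.
    by apply/funext => t; rewrite cImM.
  by apply: measurable_funD; exact: measurable_funM.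
Qed.

Lemma cmeasurable_cst D z : cmeasurable D (fun=> z).
Proof. by split; exact: measurable_cst. Qed.

Lemma cmeasurable_conj D f : cmeasurable D f -> cmeasurable D (fun x => (f x)^*).
Proof.
move=> [f1 f2]; split.
- rewrite (_ : (fun y => Re ((f y)^*)) = fun y => Re (f y))//.
  by apply/funext => t; rewrite Reconj.
- rewrite (_ : (fun y => Im ((f y)^*)) = fun y => - Im (f y)).
    exact: measurable_funN.
  by apply/funext => t; rewrite Imconj.
Qed.

Lemma cmeasurableS D E f : measurable D -> E `<=` D -> cmeasurable D f -> cmeasurable E f.
Proof. by move=> mD ED [f1 f2]; split; apply: measurable_funS ED _. Qed.

Lemma cmeasurable_cexp D lam : cmeasurable D (cexp lam).
Proof.
have H (F : R -> R) : continuous F -> measurable_fun D F.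
  move=> cF; apply: (@measurable_funS _ _ _ _ setT) => //.
  exact: continuous_measurable_fun.
split; apply: measurable_funM; apply: H => x.
- apply: (@continuous_comp _ _ _ (fun u => - ((2 * pi * Im lam) * u)) expR); last exact: continuous_expR.
  by apply: cvgN; exact: continuous_lin.
- apply: (@continuous_comp _ _ _ (fun u => ((2 * pi * Re lam) * u)) (@cos R)); last exact: continuous_cos.
  exact: continuous_lin.
- apply: (@continuous_comp _ _ _ (fun u => - ((2 * pi * Im lam) * u)) expR); last exact: continuous_expR.
  by apply: cvgN; exact: continuous_lin.
- apply: (@continuous_comp _ _ _ (fun u => ((2 * pi * Re lam) * u)) (@sin R)); last exact: continuous_sin.
  exact: continuous_lin.
Qed.

Lemma measurable_normc2 D f : cmeasurable D f ->
  measurable_fun D (fun x => normc (f x) ^+ 2).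
Proof.
move=> [f1 f2].
rewrite (_ : (fun x => _) = fun x => Re (f x) ^+ 2 + Im (f x) ^+ 2); last first.
  by apply/funext => t; rewrite sqr_normcE.
by apply: measurable_funD; exact: measurable_funX.
Qed.

Lemma L2P D f : measurable D -> L2 D f <->
  cmeasurable D f /\ mu.-integrable D (EFin \o (fun x => normc (f x) ^+ 2)).
Proof.
move=> mD; split=> -[mf If]; split => //.
- apply/integrableP; split; first by apply/measurable_EFinP; exact: measurable_normc2.
  by under eq_integral do rewrite /= ger0_norm ?sqr_ge0//.
- move/integrableP : If => [_].
  by under eq_integral do rewrite /= ger0_norm ?sqr_ge0//.
Qed.

Lemma integrable_dom D (F G : R -> R) : measurable D -> measurable_fun D F ->
  (forall x, D x -> `|F x| <= G x) -> mu.-integrable D (EFin \o G) ->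
  mu.-integrable D (EFin \o F).
Proof.
move=> mD mF FG iG; apply: (le_integrable mD _ _ iG); first exact/measurable_EFinP.
move=> x Dx /=; rewrite lee_fin (le_trans (FG x Dx))//; exact: ler_norm.
Qed.

Lemma integrableDr D (F G : R -> R) : measurable D -> mu.-integrable D (EFin \o F) ->
  mu.-integrable D (EFin \o G) -> mu.-integrable D (EFin \o (fun x => F x + G x)).
Proof.
move=> mD iF iG; rewrite (_ : _ \o _ = (EFin \o F) \+ (EFin \o G)); last exact/funext.
exact: integrableD.
Qed.

Lemma integrableZr D k (F : R -> R) : measurable D -> mu.-integrable D (EFin \o F) ->
  mu.-integrable D (EFin \o (fun x => k * F x)).
Proof.
move=> mD iF; rewrite (_ : _ \o _ = (fun x => k%:E * (EFin \o F) x)%E).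
  exact: integrableZl.
by apply/funext => x /=; rewrite EFinM.
Qed.

Lemma L2D D f g : measurable D -> L2 D f -> L2 D g -> L2 D (fun x => f x + g x).
Proof.
move=> mD /(L2P f mD)[mf If] /(L2P g mD)[mg Ig]; apply/(L2P _ mD).
have mfg := cmeasurableD mf mg; split => //.
apply: (integrable_dom mD (measurable_normc2 mfg)) (integrableZr 2 mD (integrableDr mD If Ig)).
move=> x _; rewrite ger0_norm ?sqr_ge0//= !sqr_normcE cReD cImD.
(* The parallelogram identity: the two sides of [|f + g|^2 <= 2 (|f|^2 + |g|^2)] differ by
   [|f - g|^2]. *)
by rewrite -subr_ge0 (_ : _ - _ = (Re (f x) - Re (g x)) ^+ 2 + (Im (f x) - Im (g x)) ^+ 2);
  [rewrite addr_ge0 ?sqr_ge0|ring].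
Qed.

Lemma L2_bound D f g (C : R) : measurable D -> cmeasurable D f -> L2 D g ->
  (forall x, D x -> normc (f x) <= C * normc (g x)) -> L2 D f.
Proof.
move=> mD mf /(L2P g mD)[mg Ig] fg; apply/(L2P _ mD); split => //.
apply: (integrable_dom mD (measurable_normc2 mf)) (integrableZr (C ^+ 2) mD Ig) => x Dx.
rewrite ger0_norm ?sqr_ge0//= -exprMn ler_pXn2r// ?nnegrE ?normc_ge0//; first exact: fg.
by rewrite (le_trans (normc_ge0 (f x)))//; exact: fg.
Qed.

Lemma L2Z D z f : measurable D -> L2 D f -> L2 D (fun x => z * f x).
Proof.
move=> mD Lf; apply: (L2_bound (C := normc z) mD _ Lf).
  by apply: cmeasurableM; [exact: cmeasurable_cst|case: Lf].
by move=> x _; rewrite normc_mul.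
Qed.

Lemma L2_conj D f : measurable D -> L2 D f -> L2 D (fun x => (f x)^*).
Proof.
move=> mD Lf; apply: (L2_bound (C := 1) mD _ Lf).
  by apply: cmeasurable_conj; case: Lf.
by move=> x _; rewrite mul1r; case: (f x) => a b /=; rewrite sqrrN.
Qed.

Lemma L2B D f g : measurable D -> L2 D f -> L2 D g -> L2 D (fun x => f x - g x).
Proof.
move=> mD Lf Lg; rewrite (_ : (fun x => _) = fun x => f x + (-1) * g x).
  by apply: L2D => //; exact: L2Z.
by apply/funext => x; rewrite mulN1r.
Qed.

Lemma L2_0 D : L2 D (fun=> 0).
Proof.
split; first exact: cmeasurable_cst.
by rewrite (eq_integral (cst 0%E)) ?integral0// => x _; rewrite ComplexField.Normc.normc0 expr0n.
Qed.

Lemma L2S D E f : measurable D -> measurable E -> E `<=` D -> L2 D f -> L2 E f.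
Proof.
move=> mD mE ED /(L2P f mD)[mf If]; apply/(L2P _ mE); split.
  exact: cmeasurableS mf.
exact: integrableS If.
Qed.

(** [|f g| <= |f|^2 + |g|^2] dominates both components. *)
Lemma integrable_ReIm_mul D f g : measurable D -> L2 D f -> L2 D g ->
  mu.-integrable D (EFin \o (fun x => Re (f x * g x))) /\
  mu.-integrable D (EFin \o (fun x => Im (f x * g x))).
Proof.
move=> mD /(L2P f mD)[mf If] /(L2P g mD)[mg Ig].
have [m1 m2] := cmeasurableM mf mg.
have H x : normc (f x * g x) <= normc (f x) ^+ 2 + normc (g x) ^+ 2.
  rewrite normc_mul; set a := normc _; set b := normc _.
  have : 0 <= a by exact: normc_ge0.
  have : 0 <= b by exact: normc_ge0.
  nra.
by split; apply: (integrable_dom mD _ _ (integrableDr mD If Ig)) => // x _;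
  apply: le_trans (H x); [exact: norm_Re_le|exact: norm_Im_le].
Qed.

Lemma L2_fin (a b : R) f : cmeasurable `[a, b]%classic f ->
  (exists C : R, forall x, a <= x <= b -> normc (f x) <= C) -> L2 `[a, b]%classic f.
Proof.
move=> mf [C fC]; apply/(L2P f (measurable_itv _)); split => //.
apply: measurable_bounded_integrable => //.
- rewrite (_ : (_ < _)%E = ((mu `[a, b]%classic : \bar R) < +oo)%E)// lebesgue_measure_itv/=.
  by case: ifP => _; rewrite ?ltry// -EFinB ltry.
- exact: measurable_normc2.
- exists (C ^+ 2); split; first exact: num_real.
  move=> M CM x /=; rewrite in_itv/= => xab; rewrite ger0_norm ?sqr_ge0//.
  apply: le_trans (ltW CM); rewrite ler_pXn2r// ?nnegrE ?normc_ge0//; first exact: fC.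
  by rewrite (le_trans (normc_ge0 (f x)))//; exact: fC.
Qed.

Lemma integrable_ReIm_fin (a b : R) f : L2 `[a, b]%classic f ->
  mu.-integrable `[a, b] (EFin \o (fun x => Re (f x))) /\
  mu.-integrable `[a, b] (EFin \o (fun x => Im (f x))).
Proof.
move=> Lf; have L1 : L2 `[a, b]%classic (fun=> 1 : R[i]).
  by apply: L2_fin; [exact: cmeasurable_cst|exists 1 => x _; rewrite ComplexField.Normc.normc1].
have [] := integrable_ReIm_mul (measurable_itv _) Lf L1.
rewrite (_ : (fun x => Re (f x * 1)) = fun x => Re (f x)); last first.
  by apply/funext => x; rewrite mulr1.
by rewrite (_ : (fun x => Im (f x * 1)) = fun x => Im (f x))//; apply/funext => x; rewrite mulr1.
Qed.

Lemma L2normE D f : L2norm D f ^+ 2 = \int[mu]_(x in D) (normc (f x) ^+ 2).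
Proof. by rewrite /L2norm sqr_sqrtr// Rintegral_ge0// => x _; rewrite sqr_ge0. Qed.

Lemma L2norm_ge0 D f : 0 <= L2norm D f.
Proof. exact: sqrtr_ge0. Qed.

Lemma cintegralD D f g : measurable D ->
  mu.-integrable D (EFin \o (fun x => Re (f x))) ->
  mu.-integrable D (EFin \o (fun x => Im (f x))) ->
  mu.-integrable D (EFin \o (fun x => Re (g x))) ->
  mu.-integrable D (EFin \o (fun x => Im (g x))) ->
  cintegral D (fun x => f x + g x) = cintegral D f + cintegral D g.
Proof.
move=> mD f1 f2 g1 g2; apply: complex_ext; rewrite ?cReD ?cImD /= -RintegralD//.
- by apply: eq_Rintegral => x _; rewrite cReD.
- by apply: eq_Rintegral => x _; rewrite cImD.
Qed.

Lemma cintegralZ D f z : measurable D ->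
  mu.-integrable D (EFin \o (fun x => Re (f x))) ->
  mu.-integrable D (EFin \o (fun x => Im (f x))) ->
  cintegral D (fun x => z * f x) = z * cintegral D f.
Proof.
move=> mD f1 f2; apply: complex_ext; rewrite ?cReM ?cImM /=.
- rewrite -!RintegralZl// -RintegralB//; [|exact: integrableZr|exact: integrableZr].
  by apply: eq_Rintegral => x _; rewrite cReM.
- rewrite -!RintegralZl// -RintegralD//; [|exact: integrableZr|exact: integrableZr].
  by apply: eq_Rintegral => x _; rewrite cImM.
Qed.

End L2_toolkit.

(** * The equation f' = 2 pi i (lam f + h) *)

Section first_order_equation.
Context {R : realType}.
Local Notation mu := (@lebesgue_measure R).
Local Notation normc := ComplexField.Normc.normc.
Local Notation Re := complex.Re.
Local Notation Im := complex.Im.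
Implicit Types (f g h : R -> R[i]) (lam z w : R[i]) (J : set R).

Lemma cos_sin_2pi_int (z : int) :
  cos (2 * pi * z%:~R : R) = 1 /\ sin (2 * pi * z%:~R : R) = 0.
Proof.
have H (n : nat) : cos (2 * pi * n%:R : R) = 1 /\ sin (2 * pi * n%:R : R) = 0.
  have -> : 2 * pi * n%:R = 0 + (pi *+ 2) *+ n :> R.
    by rewrite add0r -!(mulr_natr pi) -[RHS]mulr_natr (mulrC pi).
  rewrite (periodicn (@cosD2pi R) n 0) (periodicn (@sinD2pi R) n 0).
  by rewrite cos0 sin0.
case: z => n; first exact: H.
rewrite NegzE mulrNz mulrN cosN sinN.
by have [-> ->] := H n.+1; rewrite oppr0.
Qed.

(** Reduce [t] modulo 2 pi to [s] in [0, 2 pi). The half-angle formula gives [sin (s / 2) = 0], and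
    the sine is positive on (0, pi). *)
Lemma cos_eq1 (t : R) : cos t = 1 -> exists z : int, t = 2 * pi * z%:~R.
Proof.
move=> ct; have pi0 := @pi_gt0 R.
have p0 : 0 < 2 * pi :> R by rewrite mulr_gt0.
pose z := Num.floor (t / (2 * pi)); exists z.
have : z%:~R <= t / (2 * pi) < (z + 1)%:~R by rewrite Num.Theory.floor_le Num.Theory.floorD1_gt.
rewrite ler_pdivlMr// ltr_pdivrMr// => /andP[zt tz].
pose s := t - 2 * pi * z%:~R.
have cs : cos s = 1.
  by rewrite /s cosB; have [-> ->] := cos_sin_2pi_int z; rewrite mulr1 mulr0 addr0.
have s0 : 0 <= s by rewrite /s subr_ge0 mulrC.
have s2 : s < 2 * pi.
  by move: tz; rewrite /s intrD mulrDl mul1r mulrC => tz; lra.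
suff : s = 0 by rewrite /s => /eqP; rewrite subr_eq0 => /eqP.
have sh : sin (s / 2) = 0.
  have := cos_mulr2n (s / 2); rewrite -(mulr_natr (s / 2)) divfK ?pnatr_eq0// cs.
  rewrite -mulr_natr => e; apply/eqP; rewrite -sqrf_eq0 sin2cos2; apply/eqP; lra.
apply/eqP; rewrite eq_le s0 andbT leNgt; apply/negP => sp.
have : 0 < sin (s / 2) by apply: sin_gt0_pi; apply/andP; split; lra.
by rewrite sh ltxx.
Qed.

(** The modulus forces [lam] to be real, and the cosine then forces an integer. For [x = l_k] this
    is the condition that [cexp lam] take equal values at the two ends of [J k]. *)
Lemma cexp_eq1 lam (x : R) : x != 0 ->
  cexp lam x = 1 <-> exists z : int, x%:C * lam = z%:~R.
Proof.
move=> x0; split=> [h|[z hz]].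
- have : normc (cexp lam x) = 1 by rewrite h ComplexField.Normc.normc1.
  rewrite normc_cexp -[RHS](@expR0 R) => /expR_inj/eqP.
  have pi2 : 0 < 2 * pi :> R by rewrite mulr_gt0// pi_gt0.
  rewrite oppr_eq0 mulf_eq0 (negPf x0) orbF mulf_eq0 (gt_eqF pi2)/= => /eqP I0.
  have := congr1 (@Re R) h; rewrite /= I0 mulr0 mul0r oppr0 expR0 mul1r.
  move=> /cos_eq1[z]; rewrite -[LHS]mulrA => /(mulfI (lt0r_neq0 pi2)) xz.
  exists z; rewrite -(rmorph_int (real_complex R)).
  by apply: complex_ext; rewrite ?(cReM, cImM) /= I0 !(mul0r, mulr0, subr0, addr0)// mulrC.
- have [zR zI] : x * Re lam = z%:~R /\ x * Im lam = 0.
    move: hz; rewrite -(rmorph_int (real_complex R)) => hz.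
    have := congr1 (@Re R) hz; have := congr1 (@Im R) hz.
    by rewrite cReM cImM /= !mul0r subr0 addr0.
  have [c1 s0] := cos_sin_2pi_int z.
  apply: complex_ext; rewrite /= -!mulrA (mulrC (Im lam)) (mulrC (Re lam)) zR zI
    !mulr0 oppr0 expR0 mul1r mulrA ?c1 ?s0//.
Qed.

(** On a half-line [abs_continuous] is a uniform condition, which a growing [cexp lam] violates and
    products need not preserve. Its restriction to compact subintervals has neither defect. *)
Definition locally_ac J f :=
  forall x y, `[x, y]%classic `<=` J -> abs_continuous `[x, y] f.

Lemma abs_continuous_local J f : abs_continuous J f -> locally_ac J f.
Proof. by move=> acf x y xyJ; exact: abs_continuousS acf. Qed.

Lemma locally_acS J J' f : J' `<=` J -> locally_ac J f -> locally_ac J' f.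
Proof. by move=> JJ' acf x y xy; apply: acf; exact: subset_trans JJ'. Qed.

Lemma locally_acM J f g : locally_ac J f -> locally_ac J g ->
  locally_ac J (fun t => f t * g t).
Proof. by move=> acf acg x y xyJ; apply: abs_continuousM; [exact: acf|exact: acg]. Qed.

Lemma locally_acD J f g : locally_ac J f -> locally_ac J g ->
  locally_ac J (fun t => f t + g t).
Proof. by move=> acf acg x y xyJ; apply: abs_continuousD; [exact: acf|exact: acg]. Qed.

Lemma locally_ac_cexp J lam : locally_ac J (cexp lam).
Proof. by move=> x y _; exact: abs_continuous_cexp. Qed.

Lemma itv_sub J (x y : R) : is_interval J -> J x -> J y -> `[x, y]%classic `<=` J.
Proof. by move=> iJ Jx Jy z; rewrite /= in_itv/=; exact: iJ. Qed.

(** Variation of constants: multiplied by [cexp (- lam)] and corrected by the linear term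
    [tpi * z * t], [f] has derivative zero almost everywhere, hence is constant. *)
Lemma sol_form J f lam z : is_interval J -> locally_ac J f ->
  ae_derivative J f (fun t => tpi * (lam * f t + z * cexp lam t)) ->
  exists C, forall t, J t -> f t = (C + tpi * z * t%:C) * cexp lam t.
Proof.
move=> iJ acf df.
have [[x0 Jx0]|nJ] := pselect (exists x0, J x0); last first.
  by exists 0 => t Jt; exfalso; apply: nJ; exists t.
pose p t := f t * cexp (- lam) t + (- (tpi * z)) * t%:C.
have acp : locally_ac J p.
  apply: locally_acD.
    by apply: locally_acM => //; exact: locally_ac_cexp.
  by apply: locally_acM => x y _; [exact: abs_continuous_cst|exact: abs_continuous_id].
have dp : ae_derivative J p (fun=> 0).
  apply: (ae_imp df) => t h /h{}h.
  have h2 := is_cderive_mul (is_cderive_cst (- (tpi * z)) t) (is_cderive_id t).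
  have := is_cderive_add (is_cderive_mul h (is_cderive_cexp (- lam) t)) h2.
  have e : cexp (- lam) t * cexp lam t = 1 by exact: cexpNl.
  congr (is_cderive _ _ _).
  rewrite mul0r add0r mulr1.
  rewrite [LHS](_ : _ = tpi * z * (cexp (- lam) t * cexp lam t - 1)); last by ring.
  by rewrite e subrr mulr0.
have pc x y : x <= y -> J x -> J y -> p y = p x.
  move=> xy Jx Jy; apply/eqP; rewrite -subr_eq0; apply/eqP.
  have xyJ := itv_sub iJ Jx Jy.
  have L0 := L2_0 (`[x, y]%classic : set (measurableTypeR R)).
  have [i1 i2] := integrable_ReIm_fin L0.
  rewrite (cFTC xy (acp _ _ xyJ) i1 i2).
    by rewrite /cintegral /= -[RHS]/(0 +i* 0); congr (_ +i* _);
      rewrite Rintegral_cst// mul0r.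
  apply: (ae_imp dp) => t h txy; apply: h; apply: xyJ.
  by move: txy; rewrite /= !in_itv/= => /andP[/ltW -> /ltW ->].
exists (p x0) => t Jt.
have -> : p x0 = p t by have [xt|/ltW tx] := leP x0 t; [rewrite (pc x0 t)|rewrite (pc t x0)].
rewrite /p mulNr subrK -mulrA cexpNl mulr1//.
Qed.


(** Regains the uniform condition required by the domain of the operator from the local one, also on
    the half-lines, where the derivative is only known to be square integrable. *)
Lemma abs_continuous_L2 (J : set (measurableTypeR R)) f df :
  measurable J -> locally_ac J f -> L2 J df -> ae_derivative J f df ->
  abs_continuous J f.
Proof.
move=> mJ acf Ldf adf; have [mdf Idf] := (L2P df mJ).1 Ldf.
(* The pointwise bound behind this is [a <= 1 / k + k * a ^ 2], from the square of [k * a - 1]. *)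
have key (s t k : R) : s < t -> `[s, t]%classic `<=` J -> 0 < k ->
    (forall F : R -> R, measurable_fun `[s, t] F -> (forall u, `|F u| <= normc (df u)) ->
     `|\int[mu]_(u in `[s, t]) F u| <=
      (t - s) / k + k * \int[mu]_(u in `]s, t]) (normc (df u) ^+ 2)).
  move=> st stJ k0 F mF FB.
  have iw : mu.-integrable `[s, t] (EFin \o (fun u => normc (df u) ^+ 2)).
    exact: integrableS Idf.
  have ic : mu.-integrable `[s, t] (EFin \o (fun u => k^-1)).
    apply: measurable_bounded_integrable => //.
    - rewrite (_ : (_ < _)%E = ((mu `[s, t]%classic : \bar R) < +oo)%E)// lebesgue_measure_itv/=.
      by case: ifP => _; rewrite ?ltry// -EFinB ltry.
    - by exists (k^-1); split; [exact: num_real|move=> M kM x _; rewrite ger0_norm ?invr_ge0 ltW].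
  have isum := integrableDr (measurable_itv _) ic (integrableZr k (measurable_itv _) iw).
  have iF : mu.-integrable `[s, t] (EFin \o F).
    apply: (integrable_dom (measurable_itv _) mF _ isum) => u _.
    apply: (le_trans (FB u)); set a := normc _.
    have : 0 <= (k * a - 1) ^+ 2 by exact: sqr_ge0.
    have a0 : 0 <= a by exact: normc_ge0.
    move=> h; rewrite -(ler_pM2l k0) mulrDr mulfV ?gt_eqF//.
    have : 0 <= (k * a) by rewrite mulr_ge0// ltW.
    nra.
  apply: (@le_trans _ _ (\int[mu]_(u in `[s, t]) `|F u|)).
    exact: le_normr_Rintegral.
  rewrite (Rintegral_itv_obnd_cbnd (r := s)); last by apply: integrableS iw => //; apply: subset_itvr; rewrite bnd_simp.
  apply: (@le_trans _ _ (\int[mu]_(u in `[s, t]) (k^-1 + k * normc (df u) ^+ 2))).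
    apply: le_Rintegral => //; first exact: integrable_norm.
    move=> u _; apply: (le_trans (FB u)); set a := normc _.
    have : 0 <= (k * a - 1) ^+ 2 by exact: sqr_ge0.
    have a0 : 0 <= a by exact: normc_ge0.
    move=> h; rewrite -(ler_pM2l k0) mulrDr mulfV ?gt_eqF//.
    have : 0 <= (k * a) by rewrite mulr_ge0// ltW.
    nra.
  rewrite RintegralD// ?RintegralZl//; last exact: integrableZr.
  by rewrite lerD2r Rintegral_cst//= lebesgue_measure_itv/= lte_fin st/= mulrC.
have fE s t : s < t -> `[s, t]%classic `<=` J ->
    f t - f s = cintegral `[s, t] df.
  move=> st stJ; have Lst : L2 (`[s, t]%classic : set (measurableTypeR R)) df by exact: L2S Ldf.
  have [i1 i2] := integrable_ReIm_fin Lst.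
  apply: cFTC => //; [exact: ltW|exact: acf|].
  apply: (ae_imp adf) => u h ust; apply: h; apply: stJ.
  by move: ust; rewrite /= !in_itv/= => /andP[/ltW -> /ltW ->].
have [m1 m2] := mdf.
apply/abs_continuousP; split; (apply: (ac_dom_L2 mJ Idf) => [t|s t st stJ k k0]; first by rewrite sqr_ge0).
- rewrite -cReN -cReD fE//=; apply: key => //; first exact: measurable_funS m1.
  by move=> u; exact: norm_Re_le.
- rewrite -cImN -cImD fE//=; apply: key => //; first exact: measurable_funS m2.
  by move=> u; exact: norm_Im_le.
Qed.

End first_order_equation.

(** * Integrals from minus infinity and the energy inequality *)

Section existence.
Context {R : realType}.
Local Notation mu := (@lebesgue_measure R).
Local Notation normc := ComplexField.Normc.normc.
Local Notation Re := complex.Re.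
Local Notation Im := complex.Im.
Implicit Types (f g h : R -> R[i]) (lam z w : R[i]) (J : set R).

(** Monotone convergence: this is how a bound uniform over bounded intervals becomes square
    integrability. *)
Lemma integral_exhaust (F : (set R)^nat) (g : R -> R) (C : R) :
  nondecreasing_seq F -> (forall i, measurable (F i)) ->
  (forall i, measurable_fun (F i : set (measurableTypeR R)) g) -> (forall x, 0 <= g x) ->
  (forall i, (\int[mu]_(x in F i) (g x)%:E <= C%:E)%E) ->
  (\int[mu]_(x in \bigcup_i F i) (g x)%:E <= C%:E)%E.
Proof.
move=> ndF mF mg g0 gC.
have h : (\int[mu]_(x in F i) (g x)%:E @[i --> \oo] -->
    \int[mu]_(x in \bigcup_i F i) (g x)%:E)%E.
  apply: ge0_nondecreasing_set_cvg_integral => //.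
  - by move=> i; apply/measurable_EFinP.
  - by move=> i x _; rewrite lee_fin.
by apply: (cvge_le _ h); near=> i; exact: gC.
Unshelve. all: by end_near. Qed.

Lemma nd_itvN : nondecreasing_seq (fun n : nat => `[- (n%:R : R), n%:R]%classic).
Proof.
move=> m n mn; apply/subsetPset; apply: subset_itv; rewrite bnd_simp.
  by rewrite lerN2 ler_nat.
by rewrite ler_nat.
Qed.

Lemma bigcup_itvN : \bigcup_n `[- (n%:R : R), n%:R]%classic = setT.
Proof.
apply/seteqP; split => // x _; exists (Num.truncn `|x|).+1 => //=.
by rewrite in_itv/= -ler_norml ltW// truncnS_gt.
Qed.

Lemma integral_expNy (k x : R) : k < 0 ->
  (\int[mu]_(y in `]-oo, x]) (expR (- (k * y)))%:E <= (expR (- (k * x)) / - k)%:E)%E.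
Proof.
move=> k0.
have -> : `]-oo, x]%classic = \bigcup_n `[x - (n%:R : R), x]%classic.
  apply/seteqP; split => y /=.
  - rewrite in_itv/= => yx; exists (Num.truncn (x - y)).+1 => //=.
    by rewrite in_itv/= yx andbT lerBlDr -lerBlDl ltW// truncnS_gt.
  - by move=> [n _] /=; rewrite !in_itv/= => /andP[].
have ce : continuous (fun y : R => expR (- (k * y))).
  move=> t; apply: (@continuous_comp _ _ _ (fun u => - (k * u)) expR); last exact: continuous_expR.
  by apply: cvgN; exact: continuous_lin.
have me : measurable_fun setT (fun y : R => expR (- (k * y))) by exact: continuous_measurable_fun.
apply: integral_exhaust => //.
- move=> m n mn; apply/subsetPset; apply: subset_itv; rewrite bnd_simp//.
  by rewrite lerD2l lerN2 ler_nat.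
- by move=> i; apply: measurable_funS me.
- move=> n; have xn : x - n%:R <= x by rewrite gerBl.
  have ie : mu.-integrable `[x - n%:R, x] (EFin \o (fun y : R => expR (- (k * y)))).
    by apply: continuous_compact_integrable; [exact: segment_compact|exact: continuous_subspaceT].
  have de (y : R) : is_derive y 1 (fun y => - k^-1 * expR (- (k * y))) (expR (- (k * y))).
    have := is_derive_mul (is_derive_cst (- k^-1) y 1) (is_derive_expk k y).
    congr (is_derive _ _ _ _); rewrite mul0r add0r mulrA mulrNN mulVf ?mul1r//.
    by rewrite lt_eqF.
  have := ac_FTC xn (ac_C1 _ _ de ce) ie (ae_all (fun t _ => de t)).
  rewrite /Rintegral => h; rewrite -[X in (X <= _)%E]fineK ?integrable_fin_num// -h lee_fin.
  rewrite invrN mulrC lerBlDr lerDl mulr_ge0 ?expR_ge0// oppr_ge0 invr_le0; exact: ltW.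
Qed.

Lemma ac_continuous (F : R -> R) : (forall x y, ac `[x, y] F) -> continuous F.
Proof.
move=> acF x; apply/cvgrPdist_lt => e e0.
have [d d0 H] := ac_small (acF (x - 1) (x + 1)) e0.
have d10 : 0 < Num.min d 1 by rewrite lt_min d0 ltr01.
near=> t.
have : `|x - t| < Num.min d 1.
  by near: t; apply: (@nbhs_ball_norm _ _ x (PosNum d10)) || (by exact: nbhsx_ballx).
rewrite lt_min => /andP[xtd xt1].
have [->|ne] := eqVneq x t; first by rewrite subrr normr0.
move: xtd xt1; have [xt|tx] := ltP x t.
- rewrite ltr0_norm ?subr_lt0// => h1 h2; rewrite distrC; apply: H => //; last by lra.
  by apply: subset_itv; rewrite bnd_simp; lra.
- rewrite ger0_norm ?subr_ge0// => h1 h2; apply: H => //.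
  + by rewrite lt_neqAle eq_sym ne.
  + by apply: subset_itv; rewrite bnd_simp; lra.
Unshelve. all: by end_near. Qed.

Lemma cmeasurable_ac f : locally_ac setT f -> cmeasurable setT f.
Proof.
move=> acf; split; apply: continuous_measurable_fun; apply: ac_continuous => x y;
  by have /abs_continuousP[] := acf x y (@subsetT _ _).
Qed.

Lemma ae_derive_integralNy (w : R -> R) : measurable_fun setT w ->
  (forall x, mu.-integrable `]-oo, x] (EFin \o w)) ->
  {ae mu, forall t : R, is_derive t 1 (fun t => \int[mu]_(u in `]-oo, t]) w u) (w t)}.
Proof.
move=> mw iw.
have lw : locally_integrable setT w.
  split => //; first exact: openT.
  move=> K _ cK.
  have [M [Mr HM]] := compact_bounded cK.
  have KM : K `<=` `]-oo, (`|M| + 1)].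
    move=> x Kx /=; rewrite in_itv/=; apply: (le_trans (ler_norm x)).
    by apply: HM => //; rewrite ltr_pwDr// ler_norm.
  have mK : measurable K by exact: compact_measurable.
  have iK : mu.-integrable K (EFin \o w) by exact: integrableS (iw (`|M| + 1)).
  by move/integrableP : iK => [].
apply: (ae_imp (FTC1Ny iw lw)) => t [dW eW].
by apply: (DeriveDef dW); move: eW; rewrite derive1E.
Qed.

Lemma ac_integralNy (w : R -> R) (x y : R) :
  (forall x, mu.-integrable `]-oo, x] (EFin \o w)) ->
  ac `[x, y] (fun t => \int[mu]_(u in `]-oo, t]) w u).
Proof.
(* Only integrability on left rays is available; cutting [w] off beyond [y] makes it integrable on
   the line without changing the increments in question. *)
move=> iw; pose v := w \_ `]-oo, y].
have iv : mu.-integrable setT (EFin \o v).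
  by rewrite /v -restrict_EFin; apply/integrable_restrict => //; rewrite setTI.
apply: (ac_dom_integral iv) => s t st stxy.
have ty : t <= y.
  by have /= := stxy t; rewrite !in_itv/= lexx (ltW st) => /(_ isT)/andP[].
rewrite Rintegral_itvB//; [|by rewrite bnd_simp ltW].
have -> : \int[mu]_(u in `]s, t]) `|v u| = \int[mu]_(u in `]s, t]) `|w u|.
  apply: eq_Rintegral => u; rewrite inE /v patchE => /= ust; rewrite mem_set//.
  by move: ust; rewrite /= !in_itv/= => /andP[_ ut]; exact: le_trans ty.
apply: le_normr_Rintegral => //; apply: integrableS (iw t) => //.
by apply: subset_itvr; rewrite bnd_simp.
Qed.

(** With [s] the sign of [Im lam] and [T] its modulus, [s (|f|^2)'] consists of the damping
    [- 4 pi T |f|^2] and a cross term of size at most [4 pi |h| |f|]. Half of the damping absorbs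
    the cross term and the other half stays in the conclusion. *)
Lemma energy lam f h (x y : R) : x <= y -> Im lam != 0 ->
  abs_continuous `[x, y] f -> L2 `[x, y]%classic f -> L2 `[x, y]%classic h ->
  {ae mu, forall t, `]x, y[%classic t ->
     is_cderive f t (tpi * (lam * f t + h t))} ->
  Num.sg (Im lam) * (normc (f y) ^+ 2 - normc (f x) ^+ 2)
  + 2 * pi * `|Im lam| * \int[mu]_(t in `[x, y]) (normc (f t) ^+ 2)
  <= 2 * pi / `|Im lam| * \int[mu]_(t in `[x, y]) (normc (h t) ^+ 2).
Proof.
move=> xy; set tau := Im lam => tau0 /abs_continuousP[acR acI] Lf Lh df.
set s := Num.sg tau; set T := `|tau|.
have T0 : 0 < T by rewrite normr_gt0.
have sT : s * tau = T by rewrite /s /T normrEsg.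
have ss : s * s = 1 by rewrite -expr2 sqr_sg tau0.
have mxy : measurable (`[x, y]%classic : set (measurableTypeR R)) by [].
have [mf If] := (L2P f mxy).1 Lf; have [mh Ih] := (L2P h mxy).1 Lh.
pose G t := s * (Re (f t) * Re (f t) + Im (f t) * Im (f t)).
have GE t : G t = s * normc (f t) ^+ 2 by rewrite sqr_normcE /G; ring.
have acG : ac `[x, y] G.
  rewrite /G; apply: acM.
    by apply: (@ac_lipschitz _ _ _ 0) => u v _ _; rewrite subrr normr0 mul0r.
  by apply: acD; exact: acM.
have i1 := integrableZr (- (2 * pi * T)) mxy If.
have i2 := integrableZr (2 * pi / T) mxy Ih.
have := @ac_derive_le _ G _ x y xy acG (integrableDr mxy i1 i2).
rewrite RintegralD//= !RintegralZl// !GE mulNr => H.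
rewrite -lerBrDr [leRHS]addrC mulrBr; apply: H.
apply: (ae_imp df) => t d txy; have [dR dI] := d txy.
have d1 := is_derive_add (is_derive_mul dR dR) (is_derive_mul dI dI).
have := is_derive_mul (is_derive_cst s t 1) d1.
set dd := (X in is_derive _ _ _ X) => dG; exists dd; first exact: dG.
rewrite /dd mul0r add0r !sqr_normcE !(cReM, cImM, cReD, cImD) /= -/tau.
set a := Re (f t); set b := Im (f t); set c := Re (h t); set d' := Im (h t).
set q := Re lam.
have pi0 := @pi_gt0 R.
rewrite -subr_ge0.
set lhs := (X in 0 <= X).
(* The defect in the differential inequality is a complete square, [(2 pi / T) |T f - i s h|^2]. *)
have -> : lhs = 2 * pi / T * ((T * b - s * c) ^+ 2 + (T * a + s * d') ^+ 2).
  rewrite /lhs -sT.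
  have tau1 : tau != 0 by [].
  have s1 : s != 0 by rewrite sgr_eq0.
  have -> : (2 * pi / (s * tau)) * ((s * tau * b - s * c) ^+ 2 + (s * tau * a + s * d') ^+ 2)
    = (s * s) * (2 * pi / (s * tau) * ((tau * b - c) ^+ 2 + (tau * a + d') ^+ 2)) by ring.
  have -> : 2 * pi / (s * tau) = s * (2 * pi / tau).
    have sV : s^-1 = s by apply: (mulfI s1); rewrite mulfV// ss.
    by rewrite invfM sV; ring.
  rewrite ss.
  by field.
apply: mulr_ge0; last by rewrite addr_ge0 ?sqr_ge0.
by apply: divr_ge0; [rewrite mulr_ge0// ltW|exact: ltW].
Qed.

End existence.

(** * Square integrable solutions on the whole line *)

Section existence_line.
Context {R : realType}.
Local Notation mu := (@lebesgue_measure R).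
Local Notation normc := ComplexField.Normc.normc.
Local Notation Re := complex.Re.
Local Notation Im := complex.Im.
Implicit Types (f g h : R -> R[i]) (lam z w : R[i]) (J : set R).

Lemma L2_locally_ac f (x y : R) : locally_ac setT f -> L2 `[x, y]%classic f.
Proof.
move=> acf; have acxy := acf x y (@subsetT _ _).
apply: L2_fin.
  by apply: (cmeasurableS (D := setT)) => //; exact: cmeasurable_ac.
have /abs_continuousP[a1 a2] := acxy.
have [M1 H1] := ac_bounded a1; have [M2 H2] := ac_bounded a2.
exists (M1 + M2) => t txy; apply: (le_trans (normc_le_ReIm _)).
by rewrite lerD// ?H1 ?H2.
Qed.

(** The equation [(P - lam) f = h] on [J], with neither growth nor boundary conditions. *)
Definition solves J lam h f :=
  locally_ac J f /\ ae_derivative J f (fun t => tpi * (lam * f t + h t)).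

(** The solution is 2 pi i times the integral of [cexp lam (t - u) * h u] over [u <= t]; it
    converges because [cexp (- lam) u] decays as [u] tends to minus infinity. A weighted estimate
    first shows that [f] is bounded; the energy inequality on [-N, N], with the boundary values
    under control, then bounds its L^2 norm uniformly in N. *)
Lemma exists_solution_pos lam h : 0 < Im lam -> L2 setT h ->
  exists f, L2 setT f /\ solves setT lam h f.
Proof.
move=> tau0 Lh.
have pi0 := @pi_gt0 R.
have mT : measurable (setT : set (measurableTypeR R)) by [].
have [mh Ih] := (L2P h mT).1 Lh.
(* The rate for which [|cexp (- lam) y|^2 = exp (- k y)]. *)
pose k := 2 * (2 * pi * Im (- lam)).
have k0 : k < 0.
  by rewrite /k cImN !mulrN oppr_lt0 !mulr_gt0.
have e2 y : normc (cexp (- lam) y) ^+ 2 = expR (- (k * y)).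
  by rewrite normc_cexp expr2 -expRD /k; congr expR; ring.
have mNy (x : R) : measurable (`]-oo, x]%classic : set (measurableTypeR R)) by [].
have LeN (x : R) : L2 `]-oo, x]%classic (cexp (- lam)).
  split; first exact: cmeasurable_cexp.
  under eq_integral do rewrite e2.
  by apply: le_lt_trans (integral_expNy x k0) _; rewrite ltry.
have LhN (x : R) : L2 `]-oo, x]%classic h by exact: L2S Lh.
pose v t := cexp (- lam) t * h t.
have iv (x : R) := integrable_ReIm_mul (mNy x) (LeN x) (LhN x).
have [mv1 mv2] : cmeasurable setT v.
  by apply: cmeasurableM => //; exact: cmeasurable_cexp.
pose Phi t := cintegral `]-oo, t] v.
pose f t := tpi * (cexp lam t * Phi t).
have acPhi : locally_ac setT Phi.
  move=> x y _; apply/abs_continuousP; split; apply: ac_integralNy => t;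
    by have [] := iv t.
have dPhi : ae_derivative setT Phi v.
  apply: (ae_imp2 (ae_derive_integralNy mv1 (fun x => (iv x).1))
    (ae_derive_integralNy mv2 (fun x => (iv x).2))) => t d1 d2 _.
  by split.
have acf : locally_ac setT f.
  apply: locally_acM; first by move=> x y _; exact: abs_continuous_cst.
  by apply: locally_acM => //; exact: locally_ac_cexp.
have df : ae_derivative setT f (fun t => tpi * (lam * f t + h t)).
  apply: (ae_imp dPhi) => t /(_ I) d _.
  have := is_cderive_mul (is_cderive_cst tpi t)
    (is_cderive_mul (is_cderive_cexp lam t) d).
  congr (is_cderive _ _ _); rewrite mul0r add0r /f /v.
  have e : cexp (- lam) t * cexp lam t = 1 by exact: cexpNl.
  rewrite [LHS](_ : _ = tpi * (lam * (tpi * (cexp lam t * Phi t)) +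
    (cexp (- lam) t * cexp lam t) * h t)); last by ring.
  by rewrite e mul1r.
exists f; split => //.
pose H2 := \int[mu]_(x in setT) (normc (h x) ^+ 2).
have H20 : 0 <= H2 by apply: Rintegral_ge0 => x _; rewrite sqr_ge0.
have subH (A : set (measurableTypeR R)) : measurable A ->
    \int[mu]_(x in A) (normc (h x) ^+ 2) <= H2.
  move=> mA; rewrite /H2 /Rintegral; apply: fine_le.
  - by apply: integrable_fin_num => //; exact: integrableS Ih.
  - exact: integrable_fin_num.
  - apply: ge0_subset_integral => //; first exact: measurable_int Ih.
    by move=> x _; rewrite lee_fin sqr_ge0.
pose C := (- k)^-1 + H2.
have C0 : 0 <= C by rewrite addr_ge0// invr_ge0 oppr_ge0 ltW.
have PhiC t : normc (Phi t) <= 2 * (expR (2 * pi * Im lam * t) * C).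
  (* [q] is the modulus of [cexp (- lam) t]. Weighting [|cexp (- lam)|^2] by [1 / q] and [|h|^2] by
     [q] makes both integrals at most a constant times [q], the factor that [cexp lam t] cancels in
     [f t]. *)
  set q := expR _; have q0 : 0 < q by exact: expR_gt0.
  have bnd (F : R -> R) : (forall u, `|F u| <= normc (v u)) ->
      mu.-integrable `]-oo, t] (EFin \o F) -> `|\int[mu]_(u in `]-oo, t]) F u| <= q * C.
    move=> Fv iF.
    have [_ Ie] := (L2P _ (mNy t)).1 (LeN t).
    have [_ Iht] := (L2P _ (mNy t)).1 (LhN t).
    have Is := integrableDr (mNy t) (integrableZr q^-1 (mNy t) Ie) (integrableZr q (mNy t) Iht).
    apply: (@le_trans _ _ (\int[mu]_(u in `]-oo, t]) `|F u|)).
      exact: le_normr_Rintegral.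
    apply: (@le_trans _ _ (\int[mu]_(u in `]-oo, t])
        (q^-1 * normc (cexp (- lam) u) ^+ 2 + q * normc (h u) ^+ 2))).
      apply: le_Rintegral => //; first exact: integrable_norm.
      move=> u _; apply: (le_trans (Fv u)); rewrite /v normc_mul.
      set a := normc (cexp _ _); set b := normc (h u).
      have : 0 <= (a - q * b) ^+ 2 by exact: sqr_ge0.
      have a0 : 0 <= a by exact: normc_ge0.
      have b0 : 0 <= b by exact: normc_ge0.
      have qab : 0 <= q * (a * b) by rewrite mulr_ge0 ?mulr_ge0// ltW.
      move=> hh; rewrite -(ler_pM2l q0) mulrDr (mulrA q q^-1) mulfV ?gt_eqF// mul1r.
      move: hh qab; nra.
    rewrite RintegralD//; [|exact: integrableZr|exact: integrableZr].
    rewrite !RintegralZl// mulrDr lerD//; last first.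
      by rewrite ler_wpM2l// ?(ltW q0)//; exact: subH.
    have h1 : \int[mu]_(x in `]-oo, t]) (normc (cexp (- lam) x) ^+ 2) <= q * q / - k.
      rewrite -lee_fin /Rintegral fineK ?integrable_fin_num//.
      apply: (@le_trans _ _ (expR (- (k * t)) / - k)%:E).
        by under eq_integral do rewrite e2; exact: integral_expNy.
      rewrite lee_fin ler_wpM2r ?invr_ge0 ?oppr_ge0 ?(ltW k0)//.
      by rewrite /q -expRD ler_expR /k cImN le_eqVlt; apply/orP; left; apply/eqP; ring.
    rewrite -(ler_pM2l q0) mulrA mulfV ?gt_eqF// mul1r.
    by apply: (le_trans h1); rewrite !mulrA.
  apply: (le_trans (normc_le_ReIm _)); rewrite mulr_natl mulr2n; apply: lerD.
  - by apply: bnd => [u|]; [exact: norm_Re_le|exact: (iv t).1].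
  - by apply: bnd => [u|]; [exact: norm_Im_le|exact: (iv t).2].
have ntpi : normc (tpi : R[i]) = 2 * pi.
  by rewrite /tpi /= expr0n/= add0r sqrtr_sqr ger0_norm// mulr_ge0// ltW.
have fC t : normc (f t) <= 4 * pi * C.
  rewrite /f !normc_mul ntpi normc_cexp.
  have := PhiC t.
  have e0 := expR_gt0 (- (2 * pi * Im lam * t)).
  move=> /(ler_wpM2l (ltW e0)) h1.
  apply: (@le_trans _ _ (2 * pi * (expR (- (2 * pi * Im lam * t)) *
      (2 * (expR (2 * pi * Im lam * t) * C))))).
    by rewrite ler_wpM2l// mulr_ge0// ltW.
  have -> : expR (- (2 * pi * Im lam * t)) * (2 * (expR (2 * pi * Im lam * t) * C)) = 
     2 * (expR (- (2 * pi * Im lam * t)) * expR (2 * pi * Im lam * t)) * C by ring.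
  rewrite -expRD addNr expR0 le_eqVlt; apply/orP; left; apply/eqP; ring.
have T0 : 0 < `|Im lam| by rewrite normr_gt0 gt_eqF.
(* The energy inequality solved for the integral of [|f|^2]: the boundary term at [N] has the
   favourable sign, the one at [- N] is bounded by [fC]. *)
pose K := ((4 * pi * C) ^+ 2 + 2 * pi / `|Im lam| * H2) / (2 * pi * `|Im lam|).
have mf := cmeasurable_ac acf.
split => //.
apply: (@le_lt_trans _ _ K%:E); last by rewrite ltry.
rewrite -bigcup_itvN; apply: integral_exhaust.
- exact: nd_itvN.
- by [].
- by move=> i; apply: measurable_funS (measurable_normc2 mf).
- by move=> x; rewrite sqr_ge0.
- move=> n; have nn : - n%:R <= n%:R :> R by apply: (@le_trans _ _ 0); rewrite ?oppr_le0 ?ler0n.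
  have Lf := L2_locally_ac (- n%:R) n%:R acf.
  have Lh' : L2 `[- n%:R, n%:R]%classic h by exact: L2S Lh.
  have := energy nn (lt0r_neq0 tau0) (acf _ _ (@subsetT _ _)) Lf Lh'.
  move=> /(_ _)/wrap[]; first by apply: (ae_imp df) => t d _; exact: d.
  rewrite gtr0_sg// mul1r.
  have [_ If] := (L2P _ (measurable_itv _)).1 Lf.
  rewrite -[X in (X <= _)%E]fineK ?integrable_fin_num// lee_fin.
  rewrite -[fine _]/(\int[mu]_(x in `[- n%:R, n%:R]) (normc (f x) ^+ 2)).
  set I1 := \int[mu]_(t in _) _; set I2 := \int[mu]_(t in _) _ => h1.
  rewrite ler_pdivlMr ?mulr_gt0// mulrC.
  have h2 : normc (f (- n%:R)) ^+ 2 <= (4 * pi * C) ^+ 2.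
    by rewrite ler_pXn2r// ?nnegrE ?normc_ge0 ?mulr_ge0// ?mulr_ge0// ltW.
  have h3 : 2 * pi / `|Im lam| * I2 <= 2 * pi / `|Im lam| * H2.
    by rewrite ler_wpM2l ?subH// divr_ge0 ?mulr_ge0// ltW.
  have h4 : 0 <= normc (f n%:R) ^+ 2 by exact: sqr_ge0.
  lra.
Qed.

Lemma ac_opp (F : R -> R) (x y : R) : ac `[- y, - x] F -> ac `[x, y] (fun t => F (- t)).
Proof.
move=> acF e e0; have [d d0 H] := acF e e0; exists d => // m a b ab1 ab2 abd.
have := H m (fun i => - b i) (fun i => - a i).
have -> : \sum_(i < m) `|F (- b i) - F (- a i)| = \sum_(i < m) `|F (- a i) - F (- b i)|.
  by apply: eq_bigr => i _; rewrite distrC.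
apply.
- move=> i; have [abi abxy] := ab1 i; split; first by rewrite ltrN2.
  move=> t; rewrite /= !in_itv/= => /andP[bt ta].
  have := abxy (- t); rewrite /= !in_itv/= lerNr lerNl ta bt => /(_ isT)/andP[h1 h2].
  by rewrite lerNl lerNr h2 h1.
- by move=> i j /ab2[h|h]; [right|left]; rewrite lerN2.
- by rewrite (eq_bigr (fun i => b i - a i))// => i _; rewrite opprK addrC.
Qed.

Lemma ae_opp (P : R -> Prop) : {ae mu, forall x, P x} -> {ae mu, forall x, P (- x)}.
Proof.
move=> [A [mA A0 PA]]; exists (-%R @^-1` A); split.
- rewrite -(setTI (_ @^-1` _)).
  by apply: (@oppr_measurable R setT).
- by have := lebesgue_measureN mA; rewrite /pushforward => ->.
- by move=> x /= nPx; exact: PA.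
Qed.

Lemma L2_opp f : L2 setT f -> L2 setT (fun x => f (- x)).
Proof.
have mT : measurable (setT : set (measurableTypeR R)) by [].
have mo : measurable_fun setT (-%R : measurableTypeR R -> measurableTypeR R).
  exact: (@oppr_measurable R setT).
move=> [[m1 m2] If]; split.
  by split; [exact: (measurableT_comp m1 mo)|exact: (measurableT_comp m2 mo)].
have mg : measurable_fun setT (fun x : measurableTypeR R => ((normc (f x)) ^+ 2)%:E).
  by apply/measurable_EFinP; apply: measurable_normc2.
rewrite (_ : (\int[mu]_(x in setT) _)%E = (\int[mu]_(x in setT) ((normc (f x)) ^+ 2)%:E)%E)//.
have := @ge0_integral_pushforward _ _ _ _ R _ mo mu setT _ mT mg.
move=> /(_ _)/wrap[]; first by move=> x _; rewrite lee_fin sqr_ge0.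
rewrite preimage_setT => <-.
by apply: eq_measure_integral => A mA _; exact: lebesgue_measureN.
Qed.

(** For [Im lam < 0] the problem is reflected: if [g] solves the equation for [- lam] with
    right-hand side [- h (- t)], then [g (- t)] solves the original one. *)
Lemma exists_solution lam h : Im lam != 0 -> L2 setT h ->
  exists f, L2 setT f /\ solves setT lam h f.
Proof.
move=> tau0 Lh; have mT : measurable (setT : set (measurableTypeR R)) by [].
have [taup|taun|/eqP] := ltgtP 0 (Im lam); first exact: exists_solution_pos.
- have [|g [Lg [acg dg]]] := @exists_solution_pos (- lam) (fun x => (-1) * h (- x)) _ (L2Z (-1) mT (L2_opp Lh)).
    by rewrite cImN oppr_gt0.
  exists (fun x => g (- x)); split; first exact: L2_opp.
  split.
    move=> x y _; have /abs_continuousP[a1 a2] := acg (- y) (- x) (@subsetT _ _).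
    by apply/abs_continuousP; split; [exact: ac_opp a1|exact: ac_opp a2].
  apply: (ae_imp (ae_opp dg)) => t /(_ I)[d1 d2] _.
  have dN := is_derive_opp (is_derive_id t (1:R)).
  have e1 := @is_derive1_comp _ _ (fun u => - u) t _ _ d1 dN.
  have e2 := @is_derive1_comp _ _ (fun u => - u) t _ _ d2 dN.
  have E : tpi * (lam * g (- t) + h t) = - (tpi * (- lam * g (- t) + -1 * h (- - t))).
    by rewrite opprK; ring.
  by split; rewrite E; [move: e1; rewrite cReN mulrN1|move: e2; rewrite cImN mulrN1].
- by rewrite eq_sym (negPf tau0).
Qed.

End existence_line.

(** * The operator on the union of intervals *)

Section general_facts.
Context {R : realType}.
Local Notation mu := (@lebesgue_measure R).
Local Notation normc := ComplexField.Normc.normc.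
Local Notation Re := complex.Re.
Local Notation Im := complex.Im.
Implicit Types (f g h : R -> R[i]) (lam z w : R[i]) (J : set R).

Lemma not_L2 (A : set (measurableTypeR R)) f (d : R) : measurable A ->
  mu A = +oo%E -> 0 < d -> (forall x, A x -> d <= normc (f x) ^+ 2) -> ~ L2 A f.
Proof.
move=> mA Aoo d0 df [mf]; apply/negP; rewrite -leNgt.
apply: (@le_trans _ _ (\int[mu]_(x in A) d%:E)%E).
  by rewrite integral_cst// [X in (_ * X)%E](_ : _ = +oo%E)// gt0_muley// lte_fin.
apply: ge0_le_integral => //.
- by move=> x _; rewrite lee_fin ltW.
- by apply/measurable_EFinP; exact: measurable_normc2.
Qed.

(** Turns a one-sided limit of [f] into the value at [b] of a function on the whole line that agrees
    with [f] near [b] on that side. *)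
Lemma ccvg_left f g (a b : R) : a < b -> locally_ac setT g ->
  (forall t, a < t < b -> f t = g t) -> ccvg f b^'- (g b).
Proof.
move=> ab acg fg.
have cRe : continuous (fun t => Re (g t)).
  by apply: ac_continuous => x y; have /abs_continuousP[] := acg x y (@subsetT _ _).
have cIm : continuous (fun t => Im (g t)).
  by apply: ac_continuous => x y; have /abs_continuousP[] := acg x y (@subsetT _ _).
split.
- apply: (@cvg_trans _ ((fun x => Re (g x)) @ b^'-)); last exact/cvg_at_left_filter/cRe.
  apply: near_eq_cvg; near=> t; rewrite fg//; apply/andP; split; near: t.
    exact: nbhs_left_gt.
  exact: nbhs_left_lt.
- apply: (@cvg_trans _ ((fun x => Im (g x)) @ b^'-)); last exact/cvg_at_left_filter/cIm.
  apply: near_eq_cvg; near=> t; rewrite fg//; apply/andP; split; near: t.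
    exact: nbhs_left_gt.
  exact: nbhs_left_lt.
Unshelve. all: by end_near. Qed.

Lemma ccvg_right f g (a b : R) : a < b -> locally_ac setT g ->
  (forall t, a < t < b -> f t = g t) -> ccvg f a^'+ (g a).
Proof.
move=> ab acg fg.
have cRe : continuous (fun t => Re (g t)).
  by apply: ac_continuous => x y; have /abs_continuousP[] := acg x y (@subsetT _ _).
have cIm : continuous (fun t => Im (g t)).
  by apply: ac_continuous => x y; have /abs_continuousP[] := acg x y (@subsetT _ _).
split.
- apply: (@cvg_trans _ ((fun x => Re (g x)) @ a^'+)); last exact/cvg_at_right_filter/cRe.
  apply: near_eq_cvg; near=> t; rewrite fg//; apply/andP; split; near: t.
    exact: nbhs_right_gt.
  exact: nbhs_right_lt.
- apply: (@cvg_trans _ ((fun x => Im (g x)) @ a^'+)); last exact/cvg_at_right_filter/cIm.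
  apply: near_eq_cvg; near=> t; rewrite fg//; apply/andP; split; near: t.
    exact: nbhs_right_gt.
  exact: nbhs_right_lt.
Unshelve. all: by end_near. Qed.

Lemma ccvg_uniq f (F : set_system R) (FF : ProperFilter F) z w :
  ccvg f F z -> ccvg f F w -> z = w.
Proof.
move=> [a1 a2] [b1 b2]; apply: complex_ext.
- exact: (cvg_unique _ a1 b1).
- exact: (cvg_unique _ a2 b2).
Qed.

Lemma L2_patch (D J : set (measurableTypeR R)) f : measurable D -> measurable J ->
  J `<=` D -> L2 J f -> L2 D (fun t => f t *+ (t \in J)).
Proof.
move=> mD mJ JD [[m1 m2] If].
have E1 (G : R -> R) : measurable_fun J G -> measurable_fun D (fun t => G t *+ (t \in J)).
  move=> mG; apply: (eq_measurable_fun (G \_ J)).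
    by move=> t _; rewrite patchE; case: (t \in J); rewrite ?mulr1n ?mulr0n.
  by apply/(measurable_restrict _ mJ mD); rewrite setIidr.
split.
  split.
  - rewrite (_ : (fun t => _) = fun t => Re (f t) *+ (t \in J)); first exact: E1.
    by apply/funext => t; case: (t \in J); rewrite ?mulr1n ?mulr0n.
  - rewrite (_ : (fun t => _) = fun t => Im (f t) *+ (t \in J)); first exact: E1.
    by apply/funext => t; case: (t \in J); rewrite ?mulr1n ?mulr0n.
rewrite (_ : (\int[mu]_(x in D) _)%E = (\int[mu]_(x in J) (normc (f x) ^+ 2)%:E)%E)//.
rewrite [RHS]integral_mkcond [LHS]integral_mkcond; apply: eq_integral => t _.
rewrite !patchE; case: (boolP (t \in J)) => tJ.
  by rewrite mem_set ?mulr1n//; apply: JD; move: tJ; rewrite inE.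
by rewrite mulr0n ComplexField.Normc.normc0 expr0n; case: ifP.
Qed.

Lemma L2_sum (D : set (measurableTypeR R)) m (F : 'I_m -> R -> R[i]) : measurable D ->
  (forall i, L2 D (F i)) -> L2 D (fun t => \sum_(i < m) F i t).
Proof.
move=> mD; elim: m F => [|m IH] F LF.
  by rewrite (_ : (fun t => _) = fun=> 0); [exact: L2_0|apply/funext => t; rewrite big_ord0].
rewrite (_ : (fun t => _) = fun t => \sum_(i < m) F (widen_ord (leqnSn m) i) t + F ord_max t).
  by apply: L2D => //; exact: IH.
by apply/funext => t; rewrite big_ord_recr.
Qed.

End general_facts.

(** * The intervals, piecewise functions and the boundary condition in coordinates *)

Section intervals.
Context {R : realType}.
Local Notation mu := (@lebesgue_measure R).
Local Notation normc := ComplexField.Normc.normc.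
Local Notation Re := complex.Re.
Local Notation Im := complex.Im.
Variables (n : nat) (alpha beta : nat -> R) (c : R[i]).
Hypotheses (hn : (2 < n)%N) (hab : ordered_endpoints n alpha beta) (hc : `|c| = 1).
Implicit Types (f g h : R -> R[i]) (lam z w : R[i]).
Local Notation J := (Jint n alpha beta).
Local Notation D := (Omega n alpha beta).
Local Notation P := (PB alpha beta (block_B n c)).

Lemma n_gt0 : (0 < n)%N. Proof. by case: n hn. Qed.

Lemma J0E : J 0 = `]-oo, beta 1%N[%classic.
Proof. by []. Qed.

Lemma JnE : J n = `]alpha n, +oo[%classic.
Proof. by rewrite /Jint eqxx; case: n hn. Qed.

Lemma JkE k : (0 < k < n)%N -> J k = `]alpha k, beta k.+1[%classic.
Proof. by move=> /andP[k0 kn]; rewrite /Jint gtn_eqF// ltn_eqF. Qed.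

Lemma J_itv k : exists i : interval R, J k = [set` i].
Proof. by rewrite /Jint; case: ifP => _; [|case: ifP => _]; eexists; reflexivity. Qed.

Lemma measurable_J k : measurable (J k : set (measurableTypeR R)).
Proof. by have [i ->] := J_itv k; exact: measurable_itv. Qed.

Lemma is_interval_J k : is_interval (J k).
Proof. by have [i ->] := J_itv k; exact: interval_is_interval. Qed.

Lemma open_J k : open (J k).
Proof. by rewrite /Jint; case: ifP => _; [|case: ifP => _]; exact: interval_open. Qed.

Lemma J_sub k : (k <= n)%N -> J k `<=` D.
Proof. by move=> kn t Jt; exists k. Qed.

Lemma OmegaE : D = \big[setU/set0]_(k < n.+1) J k.
Proof.
rewrite /Omega; apply/seteqP; split => t.
- by move=> [k /= kn Jt]; rewrite -bigcup_seq; exists (Ordinal (kn : (k < n.+1)%N)) => //=; rewrite mem_index_enum.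
- by rewrite -bigcup_seq => -[k _ Jt]; exists k => //=; rewrite -ltnS.
Qed.

Lemma measurable_Omega : measurable (D : set (measurableTypeR R)).
Proof. by rewrite OmegaE; apply: bigsetU_measurable => k _; exact: measurable_J. Qed.

Lemma beta_le i j : (0 < i)%N -> (i <= j)%N -> (j <= n)%N -> beta i <= beta j.
Proof.
move=> i0; elim: j => [|j IH]; first by rewrite leqn0 => /eqP->.
rewrite leq_eqVlt => /predU1P[->//|]; rewrite ltnS => ij jn.
apply: (le_trans (IH ij (ltnW jn))).
have j0 : (0 < j)%N by exact: leq_trans ij.
apply: (@le_trans _ _ (alpha j)); apply/ltW.
  by apply: hab.1; rewrite j0 ltnW.
by apply: hab.2; rewrite j0.
Qed.

Lemma J_lt i j (s t : R) : (i < j)%N -> (j <= n)%N -> J i s -> J j t -> s < t.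
Proof.
move=> ij jn Jis Jjt.
have h1 : s < beta i.+1.
  move: Jis; rewrite /Jint; case: eqP => [->|_]; first by rewrite /= in_itv.
  by rewrite ltn_eqF ?(leq_trans ij)//= in_itv/= => /andP[].
have h2 : alpha j < t.
  move: Jjt; rewrite /Jint gtn_eqF ?(leq_trans _ ij)//.
  by case: eqP => [->|_]; rewrite /= in_itv/= ?andbT// => /andP[].
apply: (lt_trans h1); apply: le_lt_trans h2.
apply: (le_trans (beta_le _ ij jn)) => //; apply/ltW/hab.1.
by rewrite jn andbT (leq_trans _ ij).
Qed.

Lemma J_inj i j t : (i <= n)%N -> (j <= n)%N -> J i t -> J j t -> i = j.
Proof.
move=> iN jN Ji Jj; have [ij|ji|//] := ltngtP i j.
  by have := J_lt ij jN Ji Jj; rewrite ltxx.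
by have := J_lt ji iN Jj Ji; rewrite ltxx.
Qed.

Lemma integral_Omega (g : R -> R) : measurable_fun (D : set (measurableTypeR R)) g ->
  (forall x, 0 <= g x) ->
  (\int[mu]_(x in D) (g x)%:E = \sum_(k < n.+1) \int[mu]_(x in J k) (g x)%:E)%E.
Proof.
move=> mg g0; rewrite OmegaE ge0_integral_bigsetU//.
- by move=> k; exact: measurable_J.
- exact: index_enum_uniq.
- apply/trivIsetP => i j _ _ ij; apply/seteqP; split => // t [Ji Jj].
  by move/eqP: ij; apply; apply/val_inj; apply: J_inj Ji Jj; rewrite -ltnS.
- by rewrite -OmegaE; exact/measurable_EFinP.
- by move=> x _; rewrite lee_fin.
Qed.

Lemma ae_derivative_Omega f df :
  (forall k, (k <= n)%N -> ae_derivative (J k) f df) -> ae_derivative D f df.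
Proof.
move=> H.
have := @ae_foralln _ _ _ mu (fun k t => (k <= n)%N -> J k t -> is_cderive f t (df t)) => /(_ _)/wrap[].
  move=> k; have [kn|nk] := leqP k n; last exact: ae_all.
  by apply: (ae_imp (H k kn)) => t h _; exact: h.
by move=> K; apply: (ae_imp K) => t h [k kn Jt]; exact: h Jt.
Qed.

(** The function equal to [phi k] on [J k] and to 0 off [Omega]. Written as a sum of cut-offs, it
    inherits square integrability from finite sums. *)
Definition pw (phi : nat -> R -> R[i]) (t : R) : R[i] :=
  \sum_(k < n.+1) phi k t *+ (t \in J k).

Lemma pwE phi k t : (k <= n)%N -> J k t -> pw phi t = phi k t.
Proof.
move=> kn Jt; rewrite /pw (bigD1 (Ordinal (kn : (k < n.+1)%N)))//= mem_set// mulr1n.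
rewrite big1 ?addr0// => j jk; rewrite memNset ?mulr0n// => Jjt.
by move/eqP: jk; apply; apply/val_inj => /=; apply: J_inj Jjt Jt => //; rewrite -ltnS.
Qed.

Lemma L2_pw phi : (forall k, (k <= n)%N -> L2 (J k) (phi k)) -> L2 D (pw phi).
Proof.
move=> Lphi; apply: (L2_sum (F := fun k t => phi k t *+ (t \in J k)) measurable_Omega) => k.
have kn : (k <= n)%N by rewrite -ltnS.
by apply: L2_patch; [exact: measurable_Omega|exact: measurable_J|exact: J_sub|exact: Lphi].
Qed.

Lemma near_J k t : J k t -> \forall x \near t, J k x.
Proof. by move=> Jt; apply: open_nbhs_nbhs; split => //; exact: open_J. Qed.

Lemma boundary_conditionP f : boundary_condition alpha beta (block_B n c) f <->
  exists u v : nat -> R[i],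
    [/\ forall k, (0 < k <= n)%N -> ccvg f ((beta k)^'-) (u k),
        forall k, (0 < k <= n)%N -> ccvg f ((alpha k)^'+) (v k),
        forall k, (0 < k < n)%N -> v k = u k.+1 &
        v n = c * u 1%N].
Proof.
(* [i'] is the column of the only nonzero entry in row [i]: column 0 for the last row, the next
   column for every other row. *)
have BE (u : 'cV[R[i]]_n) (i : 'I_n) (i' : 'I_n) :
    (if (i.+1 == n) then (i' == 0 :> nat) else (i' == i.+1 :> nat)) ->
    (block_B n c *m u) i 0 = (if i.+1 == n then c else 1) * u i' 0.
  move=> ii'; rewrite mxE (bigD1 i')//= big1 ?addr0; last first.
    move=> j ji'; rewrite mxE; move: ii' ji'; case: (i.+1 =P n) => [iN|_] ii'.
      rewrite ltn_eqF ?iN ?ltn_ord//= => ji; case: eqP => [j0|_]; last by rewrite mul0r.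
      by exfalso; move/eqP: ji; apply; apply/val_inj; rewrite /= j0 (eqP ii').
    move=> ji; case: eqP => [ji1|_]; last by rewrite mul0r.
    by exfalso; move/eqP: ji; apply; apply/val_inj; rewrite /= ji1 (eqP ii').
  rewrite mxE; move: ii'; case: (i.+1 =P n) => [iN|_] /eqP ii'; rewrite ii'.
    by [].
  by rewrite eqxx.
split.
- move=> [u [v [hu hv huv]]].
  (* Endpoints are numbered from 1 and ordinals from 0, hence [k.-1]; outside of 1, ..., n the
     ordinal is a default value. *)
  pose o k : 'I_n := insubd (Ordinal n_gt0) k.-1.
  have oE k : (0 < k <= n)%N -> (o k).+1 = k.
    case: k => // k; rewrite ltnS /= => kn; rewrite /o val_insubd /= kn.
    by [].
  exists (fun k => u (o k) 0), (fun k => v (o k) 0); split.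
  + by move=> k kn; have := hu (o k); rewrite oE.
  + by move=> k kn; have := hv (o k); rewrite oE.
  + move=> k /andP[k0 kn]; rewrite -huv (BE _ _ (o k.+1)).
      by rewrite oE ?k0 ?(ltnW kn)// ltn_eqF// mul1r.
    have e1 : (o k).+1 = k by rewrite oE// k0 ltnW.
    have e2 : (o k.+1).+1 = k.+1 by rewrite oE.
    by rewrite e1 ltn_eqF//; case: e2 => ->.
  + rewrite -huv (BE _ _ (o 1%N)).
      by rewrite oE ?n_gt0 ?leqnn// eqxx.
    have e1 : (o n).+1 = n by rewrite oE// n_gt0 leqnn.
    have e2 : (o 1%N).+1 = 1%N by rewrite oE// n_gt0.
    by rewrite e1 eqxx; case: e2 => ->.
- move=> [u [v [hu hv huv hvn]]].
  exists (\col_i u i.+1), (\col_i v i.+1); split.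
  + by move=> i; rewrite mxE; apply: hu; rewrite ltn_ord.
  + by move=> i; rewrite mxE; apply: hv; rewrite ltn_ord.
  + apply/matrixP => i j; rewrite !ord1 [RHS]mxE {j}.
    have [iN|iN] := eqVneq i.+1 n.
      by rewrite (BE _ _ (Ordinal n_gt0)) ?iN ?eqxx// mxE hvn.
    have iN' : (i.+1 < n)%N by rewrite ltn_neqAle iN ltn_ord.
    rewrite (BE _ _ (Ordinal iN')) (negPf iN)// mul1r mxE huv//=.
Qed.

End intervals.

(** * Construction of domain elements and the shape of eigenfunctions *)

Section eigenfunctions.
Context {R : realType}.
Local Notation mu := (@lebesgue_measure R).
Local Notation normc := ComplexField.Normc.normc.
Local Notation Re := complex.Re.
Local Notation Im := complex.Im.
Variables (n : nat) (alpha beta : nat -> R) (c : R[i]).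
Hypotheses (hn : (2 < n)%N) (hab : ordered_endpoints n alpha beta) (hc : `|c| = 1).
Implicit Types (f g h : R -> R[i]) (lam z w : R[i]).
Local Notation J := (Jint n alpha beta).
Local Notation D := (Omega n alpha beta).
Local Notation P := (PB alpha beta (block_B n c)).
Local Notation pw := (pw n alpha beta).

Lemma left_J k : (0 < k <= n)%N ->
  exists2 a, a < beta k & forall t, a < t < beta k -> J k.-1 t.
Proof.
case: k => // k; rewrite ltnS /= => kn; have [->|k0] := eqVneq k 0%N.
  exists (beta 1%N - 1); first by rewrite ltrBlDr ltrDl.
  by move=> t /andP[_ tb]; rewrite J0E /= in_itv.
have k0n : (0 < k < n)%N by rewrite lt0n k0.
exists (alpha k); first by apply: hab.2; rewrite k0n.
by move=> t; rewrite JkE//= in_itv.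
Qed.

Lemma right_J k : (0 < k <= n)%N ->
  exists2 b, alpha k < b & forall t, alpha k < t < b -> J k t.
Proof.
move=> /andP[k0]; rewrite leq_eqVlt => /predU1P[->|kn].
  exists (alpha n + 1); first by rewrite ltrDl.
  by move=> t /andP[ta _]; rewrite (JnE _ _ hn) /= in_itv/= ta.
have k0n : (0 < k < n)%N by rewrite k0.
exists (beta k.+1); first by apply: hab.2.
by move=> t; rewrite JkE//= in_itv.
Qed.

Lemma c_neq0 : c != 0.
Proof. by rewrite -normr_eq0 hc oner_eq0. Qed.

(** Every element of the domain that is constructed, eigenfunction or resolvent solution, is
    obtained here. As [phi k] is continuous on the whole line, the boundary condition concerns its
    values at the ends of [J k], and absolute continuity on [J k] follows from the square integrable
    derivative. *)
Lemma PB_pw phi dphi :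
  (forall k, (k <= n)%N -> [/\ locally_ac setT (phi k), L2 (J k) (phi k),
     L2 (J k) (dphi k) & ae_derivative (J k) (phi k) (dphi k)]) ->
  (forall k, (0 < k < n)%N -> phi k (alpha k) = phi k (beta k.+1)) ->
  phi n (alpha n) = c * phi 0%N (beta 1%N) ->
  P (pw phi) (fun x => tpi^-1 * pw dphi x).
Proof.
move=> H Hper Hc.
have Ldphi : L2 D (pw dphi) by apply: L2_pw => // k kn; case: (H k kn).
have adphi : ae_derivative D (pw phi) (pw dphi).
  apply: ae_derivative_Omega => k kn; have [_ _ _ dk] := H k kn.
  apply: (ae_imp dk) => t d Jt; rewrite (pwE hab _ kn Jt).
  apply: is_cderive_near (d Jt).
  by apply: filterS (near_J Jt) => x Jx; rewrite (pwE hab _ kn Jx).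
split; last by exists (pw dphi); split.
split.
- by apply: L2_pw => // k kn; case: (H k kn).
- move=> k kn; have [ack _ Lk dk] := H k kn.
  have := abs_continuous_L2 (@measurable_J _ _ _ _ _) (locally_acS (@subsetT _ _) ack) Lk dk.
  move=> acJ e e0; have [d d0 K] := acJ e e0; exists d => // m a b ab1 ab2 abd.
  apply: le_lt_trans (K m a b ab1 ab2 abd); apply: ler_sum => i _.
  have [aib sub] := ab1 i.
  by rewrite !(pwE hab _ kn)//; apply: sub; rewrite /= in_itv/= lexx ltW.
- by exists (pw dphi).
- apply/(boundary_conditionP _ _ _ hn).
  exists (fun k => phi k.-1 (beta k)), (fun k => phi k (alpha k)); split.
  + move=> k k0n; have [a ab HJ] := left_J k0n.
    have kn : (k.-1 <= n)%N by case/andP: k0n => _; apply: leq_trans; exact: leq_pred.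
    have [ack _ _ _] := H _ kn.
    by apply: (ccvg_left ab ack) => t /HJ Jt; rewrite (pwE hab _ kn).
  + move=> k k0n; have [b ab HJ] := right_J k0n.
    have kn : (k <= n)%N by case/andP: k0n.
    have [ack _ _ _] := H _ kn.
    by apply: (ccvg_right ab ack) => t /HJ Jt; rewrite (pwE hab _ kn).
  + by move=> k kn /=; exact: Hper.
  + exact: Hc.
Qed.

Lemma PB_solves f g h lam : P f g -> ae_eq mu D (fun x => g x - lam * f x) h ->
  forall k, (k <= n)%N -> solves (J k) lam h f.
Proof.
move=> [[_ acf _ _] [df [_ adf gE]]] gh k kn; split.
  exact/abs_continuous_local/acf.
apply: (ae_imp2 adf gh) => t d e Jt; have Dt := J_sub kn Jt.
have := d Dt; congr (is_cderive _ _ _).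
have := e Dt; rewrite gE => <-.
by rewrite addrC subrK mulrA mulfV ?tpi_neq0// mul1r.
Qed.

(** The converse reading of the boundary condition: by uniqueness of limits, it becomes equations
    between endpoint values of any continuations [phi k] of the pieces of [f]. *)
Lemma PB_boundary f g (phi : nat -> R -> R[i]) : P f g ->
  (forall k, (k <= n)%N -> locally_ac setT (phi k) /\ forall t, J k t -> f t = phi k t) ->
  (forall k, (0 < k < n)%N -> phi k (alpha k) = phi k (beta k.+1)) /\
  phi n (alpha n) = c * phi 0%N (beta 1%N).
Proof.
move=> [[_ _ _ bc] _] Hphi.
have [u [v [hu hv huv hvn]]] := (boundary_conditionP _ _ _ hn f).1 bc.
have uE k : (0 < k <= n)%N -> u k = phi k.-1 (beta k).
  move=> k0n; have [a ab HJ] := left_J k0n.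
  have kn : (k.-1 <= n)%N by case/andP: k0n => _; apply: leq_trans; exact: leq_pred.
  have [ack fE] := Hphi _ kn.
  apply: (ccvg_uniq _ (hu k k0n)).
  by apply: (ccvg_left ab ack) => t /HJ Jt; exact: fE.
have vE k : (0 < k <= n)%N -> v k = phi k (alpha k).
  move=> k0n; have [b ab HJ] := right_J k0n.
  have kn : (k <= n)%N by case/andP: k0n.
  have [ack fE] := Hphi _ kn.
  apply: (ccvg_uniq _ (hv k k0n)).
  by apply: (ccvg_right ab ack) => t /HJ Jt; exact: fE.
have n0 := n_gt0 hn.
split=> [k /andP[k0 kn]|].
  by rewrite -vE ?k0 ?(ltnW kn)// huv ?k0// uE.
by rewrite -vE ?n0 ?leqnn// hvn uE// n0.
Qed.

(** When [Im lam >= 0], [|cexp lam|] on the left half-line is at least its value at [beta 1], and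
    the half-line has infinite measure. *)
Lemma L2_cst_cexp_J0 z lam : L2 (J 0%N) (fun t => z * cexp lam t) -> 0 <= Im lam -> z = 0.
Proof.
move=> Lz l0; apply/eqP/negPn/negP => z0; move: Lz.
apply: (@not_L2 _ _ _ ((normc z * expR (- (2 * pi * Im lam * beta 1%N))) ^+ 2)).
- exact: measurable_J.
- by rewrite J0E lebesgue_measure_itv/= ltNyr.
- rewrite exprn_gt0// mulr_gt0 ?expR_gt0// lt_neqAle normc_ge0 andbT eq_sym.
  by apply: contra z0 => /eqP/normc_eq0 ->.
- move=> t; rewrite J0E /= in_itv/= => tb.
  rewrite normc_mul normc_cexp ler_pXn2r// ?nnegrE ?mulr_ge0 ?normc_ge0 ?expR_ge0//.
  rewrite ler_wpM2l ?normc_ge0// ler_expR lerN2 ler_wpM2l ?(ltW tb)//.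
  by rewrite mulr_ge0// mulr_ge0// pi_ge0.
Qed.

Lemma L2_cst_cexp_Jn z lam : L2 (J n) (fun t => z * cexp lam t) -> Im lam <= 0 -> z = 0.
Proof.
move=> Lz l0; apply/eqP/negPn/negP => z0; move: Lz.
apply: (@not_L2 _ _ _ ((normc z * expR (- (2 * pi * Im lam * alpha n))) ^+ 2)).
- exact: measurable_J.
- by rewrite (JnE _ _ hn) lebesgue_measure_itv/= ltry.
- rewrite exprn_gt0// mulr_gt0 ?expR_gt0// lt_neqAle normc_ge0 andbT eq_sym.
  by apply: contra z0 => /eqP/normc_eq0 ->.
- move=> t; rewrite (JnE _ _ hn) /= in_itv/= andbT => tb.
  rewrite normc_mul normc_cexp ler_pXn2r// ?nnegrE ?mulr_ge0 ?normc_ge0 ?expR_ge0//.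
  rewrite ler_wpM2l ?normc_ge0// ler_expR lerN2 ler_wnM2l ?(ltW tb)//.
  by rewrite mulr_ge0_le0// mulr_ge0// pi_ge0.
Qed.

(** Whatever the sign of [Im lam], non-integrability removes the coefficient on at least one
    half-line, and the gluing condition carries the zero to the other. On a bounded [J k], equality
    of the end values forces [C k = 0] or [cexp lam l_k = 1]. *)
Lemma eigenspace_form f lam : eigenspace D P lam f ->
  exists C : nat -> R[i],
    [/\ forall k t, (k <= n)%N -> J k t -> f t = C k * cexp lam t,
        C 0%N = 0, C n = 0 &
        forall k, (0 < k < n)%N ->
          C k = 0 \/ exists z : int, (len alpha beta k)%:C * lam = z%:~R].
Proof.
move=> [g Pfg gE].
have solvesf := @PB_solves f g (fun=> 0) lam Pfg.
have {}solvesf k : (k <= n)%N -> solves (J k) lam (fun=> 0) f.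
  by apply: solvesf; apply: (ae_imp gE) => t e Dt; rewrite e// subrr.
have Ck k : exists C, (k <= n)%N -> forall t, J k t -> f t = C * cexp lam t.
  have [kn|nk] := leqP k n; last by exists 0.
  have [acf df] := solvesf k kn.
  have df0 : ae_derivative (J k) f (fun t => tpi * (lam * f t + 0 * cexp lam t)).
    by apply: (ae_imp df) => t d /d; rewrite mul0r.
  have [C fC] := sol_form (@is_interval_J _ _ _ _ _) acf df0.
  by exists C => _ t Jt; rewrite fC// mulr0 mul0r addr0.
have [C HC] := choice Ck; exists C.
have acC k : locally_ac setT (fun t => C k * cexp lam t).
  by apply: locally_acM; [move=> x y _; exact: abs_continuous_cst|exact: locally_ac_cexp].
have [bper bn] := @PB_boundary f g (fun k t => C k * cexp lam t) Pfg
  (fun k kn => conj (acC k) (HC k kn)).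
have n0 := n_gt0 hn.
have LfJ k : (k <= n)%N -> L2 (J k) (fun t => C k * cexp lam t).
  move=> kn; have [[Lf _ _ _] _] := Pfg.
  have LJ : L2 (J k) f.
    by apply: (L2S (measurable_Omega n alpha beta) (measurable_J n alpha beta k) (J_sub kn) Lf).
  apply: (L2_bound (C := 1) (measurable_J n alpha beta k) _ LJ).
    by apply: cmeasurableM; [exact: cmeasurable_cst|exact: cmeasurable_cexp].
  by move=> t Jt; rewrite -(HC k)// mul1r.
(* The gluing condition equates nonzero multiples of [C n] and [C 0], since [c] and [cexp lam] do
   not vanish. *)
have C0n : C 0%N = 0 <-> C n = 0.
  split=> E.
    move: bn; rewrite E mul0r mulr0 => /eqP; rewrite mulf_eq0 (negPf (cexp_neq0 _ _)) orbF.
    by move/eqP.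
  move: bn; rewrite E mul0r => /esym/eqP.
  by rewrite mulf_eq0 (negPf c_neq0)/= mulf_eq0 (negPf (cexp_neq0 _ _)) orbF => /eqP.
have C00 : C 0%N = 0.
  have [l0|l0] := leP 0 (Im lam).
    exact: (L2_cst_cexp_J0 (LfJ 0%N (leq0n _))).
  by apply/C0n/(L2_cst_cexp_Jn (LfJ n (leqnn n)))/ltW.
split => //.
- by move=> k t kn; exact: HC.
- exact/C0n.
- move=> k k0n; have [->|Ck0] := eqVneq (C k) 0; first by left.
  right; have lk : alpha k < beta k.+1 by apply: hab.2.
  have l0 : len alpha beta k != 0 by rewrite /len subr_eq0 gt_eqF.
  apply/(cexp_eq1 _ l0).
  have /(mulfI Ck0) := bper k k0n.
  have -> : beta k.+1 = alpha k + len alpha beta k by rewrite /len addrC subrK.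
  rewrite cexpD -[X in X = _ -> _]mulr1 => /(mulfI (cexp_neq0 _ _)) <-//.
Qed.

Definition efun k lam := pw (fun j t => if j == k then cexp lam t else 0).

Lemma efunE k lam t : (k <= n)%N -> J k t -> efun k lam t = cexp lam t.
Proof. by move=> kn Jt; rewrite /efun (pwE hab _ kn Jt) eqxx. Qed.

Lemma efun0 k j lam t : (j <= n)%N -> j != k -> J j t -> efun k lam t = 0.
Proof. by move=> jn jk Jt; rewrite /efun (pwE hab _ jn Jt) (negPf jk). Qed.

Lemma L2_cexp_Jk k lam : (0 < k < n)%N -> L2 (J k) (cexp lam).
Proof.
move=> k0n; rewrite JkE//; apply: (L2S (D := `[alpha k, beta k.+1]%classic)) => //.
  by apply: subset_itvW; rewrite ?lexx.
exact: (L2_locally_ac _ _ (@locally_ac_cexp _ _ _)).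
Qed.

Lemma L2_efun k lam : (0 < k < n)%N -> L2 D (efun k lam).
Proof.
move=> k0n; apply: L2_pw => // j jn; case: eqP => [->|_]; first exact: L2_cexp_Jk.
exact: L2_0.
Qed.

Lemma efun_eigenspace k lam : (0 < k < n)%N ->
  (exists z : int, (len alpha beta k)%:C * lam = z%:~R) ->
  eigenspace D P lam (efun k lam).
Proof.
move=> k0n hz; have lk : alpha k < beta k.+1 by apply: hab.2.
have l0 : len alpha beta k != 0 by rewrite /len subr_eq0 gt_eqF.
have e1 := (cexp_eq1 lam l0).2 hz.
exists (fun x => tpi^-1 * pw (fun j t => if j == k then tpi * lam * cexp lam t else 0) x).
  apply: PB_pw.
  - move=> j jn; case: eqP => [->|_]; last first.
      split; [by move=> x y _; exact: abs_continuous_cst|exact: L2_0|exact: L2_0|].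
      by apply: ae_all => t _; exact: is_cderive_cst.
    split; [exact: locally_ac_cexp|exact: L2_cexp_Jk| |].
      by apply: L2Z; [exact: measurable_J|exact: L2_cexp_Jk].
    by apply: ae_all => t _; exact: is_cderive_cexp.
  - move=> j j0n; case: eqP => // ->.
    have -> : beta k.+1 = alpha k + len alpha beta k by rewrite /len addrC subrK.
    by rewrite cexpD e1 mulr1.
  - case/andP: k0n => k0 kn.
    by rewrite (gtn_eqF kn) (ltn_eqF k0) mulr0.
apply: ae_all => t [j jn Jt]; rewrite /efun !(pwE hab _ jn Jt); case: eqP => _.
  by rewrite -mulrA mulKf ?tpi_neq0.
by rewrite !mulr0.
Qed.

Lemma mu_J_gt0 k : (0 < k < n)%N -> (0 < mu (J k))%E.
Proof.
move=> k0n; have lk : alpha k < beta k.+1 by apply: hab.2.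
by rewrite JkE// lebesgue_measure_itv/= lte_fin lk -EFinB lte_fin subr_gt0.
Qed.

(** Evaluates an almost everywhere identity at a point of a chosen bounded interval, which has
    positive measure. *)
Lemma ae_exists k (Q : R -> Prop) : (0 < k < n)%N ->
  {ae mu, forall x, Q x} -> exists2 t, J k t & Q t.
Proof.
move=> k0n [A [mA A0 QA]]; apply: contrapT => H.
have : (mu (J k) <= mu A)%E.
  apply: le_measure; rewrite ?inE//; first exact: measurable_J.
  by move=> t Jt; apply: QA => /= Qt; apply: H; exists t.
by rewrite A0 leNgt mu_J_gt0.
Qed.

Lemma efun_eigenvector k lam : (0 < k < n)%N ->
  (exists z : int, (len alpha beta k)%:C * lam = z%:~R) ->
  eigenvectors D P lam (efun k lam).
Proof.
move=> k0n hz; split; first exact: efun_eigenspace.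
move=> /(ae_exists k0n)[t Jt].
have kn : (k <= n)%N by case/andP: k0n => _ /ltnW.
move=> /(_ (J_sub kn Jt)); rewrite efunE// => /eqP.
by rewrite (negPf (cexp_neq0 _ _)).
Qed.

End eigenfunctions.

(** * Eigenvalues *)

Section point_spectrum.
Context {R : realType}.
Local Notation mu := (@lebesgue_measure R).
Local Notation normc := ComplexField.Normc.normc.
Local Notation Re := complex.Re.
Local Notation Im := complex.Im.
Variables (n : nat) (alpha beta : nat -> R) (c : R[i]).
Hypotheses (hn : (2 < n)%N) (hab : ordered_endpoints n alpha beta) (hc : `|c| = 1).
Implicit Types (f g h : R -> R[i]) (lam z w : R[i]).
Local Notation J := (Jint n alpha beta).
Local Notation D := (Omega n alpha beta).
Local Notation P := (PB alpha beta (block_B n c)).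
Local Notation l := (len alpha beta).

Definition resonant lam k : Prop := exists z : int, (l k)%:C * lam = z%:~R.

Lemma len_gt0 k : (0 < k < n)%N -> 0 < l k.
Proof. by move=> kn; rewrite /len subr_gt0; exact: hab.2. Qed.

Lemma resonantP lam k : (0 < k < n)%N ->
  resonant lam k <-> exists z : int, lam = ((l k)^-1 * z%:~R)%:C.
Proof.
move=> kn; have lk := len_gt0 kn.
have lC : (l k)%:C != 0 :> R[i] by apply/eqP => /complexI/eqP; rewrite gt_eqF.
split=> -[z hz]; exists z.
- apply: (mulfI lC); rewrite hz -rmorphM mulrA mulfV ?gt_eqF// mul1r.
  by rewrite -(rmorph_int (real_complex R)).
- by rewrite hz -rmorphM mulrA mulfV ?gt_eqF// mul1r -(rmorph_int (real_complex R)).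
Qed.

Lemma eigenvaluesE : eigenvalues D P =
  \bigcup_(k in [set k | (1 <= k < n)%N]) range (fun z : int => ((l k)^-1 * z%:~R)%:C).
Proof.
apply/seteqP; split => lam.
- move=> [f [ef nf]]; have [C [fC C0 Cn Ck]] := eigenspace_form hn hab hc ef.
  apply: contrapT => H; apply: nf; apply: ae_all => t [k kn Jt].
  rewrite (fC k t kn Jt).
  suff -> : C k = 0 by rewrite mul0r.
  have [->//|k0] := eqVneq k 0%N.
  have [->//|kn'] := eqVneq k n.
  have k0n : (0 < k < n)%N by rewrite lt0n k0 ltn_neqAle kn'.
  have [//|/(resonantP _ k0n)[z hz]] := Ck k k0n.
  by exfalso; apply: H; exists k => //; exists z.
- move=> [k k0n [z _ <-]]; exists (efun n alpha beta k ((l k)^-1 * z%:~R)%:C).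
  apply: efun_eigenvector => //; apply/(resonantP _ k0n); by exists z.
Qed.

(** An eigenfunction is determined on [Omega] by its coefficients on the resonant intervals, listed
    in [S], which bounds the dimension from above. Conversely, the [efun k lam] with [k] in [S] have
    disjoint supports and are independent. *)
Lemma multiplicityE lam : multiplicity D P lam =
  (\sum_(1 <= k < n) `[< resonant lam k >])%N%:R%:E.
Proof.
pose S := [seq k <- index_iota 1 n | `[< resonant lam k >]].
have -> : (\sum_(1 <= k < n) `[< resonant lam k >])%N = size S.
  by rewrite size_filter -sum1_count [RHS]big_mkcond; apply: eq_bigr => k _; case: asboolP.
have SP k : k \in S = (0 < k < n)%N && `[< resonant lam k >].
  by rewrite mem_filter mem_index_iota andbC.
have uS : uniq S by rewrite filter_uniq// iota_uniq.
apply/eqP; rewrite eq_le; apply/andP; split.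
- apply: ge_ereal_sup => _ [m [v [ev iv]] <-]; rewrite lee_fin ler_nat leqNgt.
  apply/negP => mS.
  have [C HC] := choice (fun i => eigenspace_form hn hab hc (ev i)).
  (* Row [i] holds the coefficients of [v i] on the resonant intervals. With more rows than columns
     there is a nonzero row [a] such that [a *m M = 0], a linear dependence between the [v i]. *)
  pose M : 'M[R[i]]_(m, size S) := \matrix_(i, j) C i (nth 0%N S j).
  have : kermx M != 0.
    rewrite kermx_eq0 /row_free; apply: contraTN mS => /eqP rM.
    by rewrite -leqNgt -[X in (X <= _)%N]rM rank_leq_col.
  move=> /rowV0Pn[a]; rewrite sub_kermx => /eqP aM /negP; apply.
  have CS k : (k <= n)%N -> \sum_i a 0 i * C i k = 0.
    move=> kn; have [kS|kS] := boolP (k \in S).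
      have := congr1 (fun A : 'rV_(size S) => A 0 (Ordinal (etrans (index_mem k S) kS))) aM.
      rewrite !mxE => E; apply: etrans E; apply: eq_bigr => i _.
      by rewrite mxE /= nth_index.
    rewrite big1// => i _; have [_ C0 Cn Ck] := HC i.
    suff -> : C i k = 0 by rewrite mulr0.
    have [->//|k0] := eqVneq k 0%N.
    have [->//|kn'] := eqVneq k n.
    have k0n : (0 < k < n)%N by rewrite lt0n k0 ltn_neqAle kn'.
    have [//|rk] := Ck k k0n.
    by move: kS; rewrite SP k0n /=; move/asboolP.
  have a0 := iv (fun i => a 0 i) _.
  apply/eqP/rowP => i; rewrite mxE; apply: a0.
  apply: ae_all => t [k kn Jt].
  transitivity ((\sum_i a 0 i * C i k) * cexp lam t); last by rewrite CS// mul0r.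
  rewrite mulr_suml; apply: eq_bigr => j _; have [fC _ _ _] := HC j.
  by rewrite (fC k t kn Jt) mulrA.
- apply: ereal_sup_ubound; exists (size S) => //.
  exists (fun i => efun n alpha beta (nth 0%N S i) lam); split.
    move=> i; have := mem_nth 0%N (ltn_ord i); rewrite SP => /andP[k0n /asboolP r].
    exact: efun_eigenspace.
  move=> a ha i; have := mem_nth 0%N (ltn_ord i); rewrite SP => /andP[k0n _].
  have [t Jt] := ae_exists hab k0n ha.
  have kn : (nth 0%N S i <= n)%N by case/andP: k0n => _ /ltnW.
  move=> /(_ (J_sub kn Jt)); rewrite (bigD1 i)//= big1 ?addr0.
    rewrite (efunE hab _ kn Jt) => /eqP; rewrite mulf_eq0 (negPf (cexp_neq0 _ _)) orbF.
    by move/eqP.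
  move=> j ji; rewrite (efun0 hab _ kn _ Jt) ?mulr0//.
  by rewrite nth_uniq//; apply: contra ji => /eqP ij; apply/eqP/val_inj.
Qed.

Lemma eigenvalue0 : eigenvalues D P 0 /\ multiplicity D P 0 = (n.-1)%:R%:E.
Proof.
split.
  rewrite eigenvaluesE; exists 1%N => /=; first by rewrite (leq_trans _ hn).
  by exists 0 => //; rewrite mulr0z mulr0.
rewrite multiplicityE (eq_big_nat _ _ (F2 := fun=> 1%N)) ?sum_nat_const_nat ?muln1 ?subn1//.
by move=> k _; case: asboolP => // H; exfalso; apply: H; exists 0; rewrite mulr0.
Qed.

End point_spectrum.

(** * The resolvent and the continuous spectrum *)

Section resolvent_bound.
Context {R : realType}.
Local Notation mu := (@lebesgue_measure R).
Local Notation normc := ComplexField.Normc.normc.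
Local Notation Re := complex.Re.
Local Notation Im := complex.Im.
Variables (n : nat) (alpha beta : nat -> R) (c : R[i]).
Hypotheses (hn : (2 < n)%N) (hab : ordered_endpoints n alpha beta) (hc : `|c| = 1).
Implicit Types (f g h : R -> R[i]) (lam z w : R[i]).
Local Notation J := (Jint n alpha beta).
Local Notation D := (Omega n alpha beta).
Local Notation P := (PB alpha beta (block_B n c)).

(** The difference of two solutions solves the homogeneous equation. *)
Lemma solves_sub (A : set R) lam h1 h2 f F : is_interval A ->
  solves A lam h1 f -> solves A lam h2 F -> (forall t, A t -> h1 t = h2 t) ->
  exists K, forall t, A t -> f t = F t + K * cexp lam t.
Proof.
move=> iA [acf df] [acF dF] h12.
have acg : locally_ac A (fun t => f t + (-1) * F t).
  apply: locally_acD => //; apply: locally_acM => //.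
  by move=> x y _; exact: abs_continuous_cst.
have dg : ae_derivative A (fun t => f t + (-1) * F t)
    (fun t => tpi * (lam * (f t + (-1) * F t) + 0 * cexp lam t)).
  apply: (ae_imp2 df dF) => t d1 d2 At.
  have := is_cderive_add (d1 At) (is_cderive_mul (is_cderive_cst (-1) t) (d2 At)).
  by congr (is_cderive _ _ _); rewrite h12//; ring.
have [K HK] := sol_form iA acg dg.
exists K => t At; have := HK t At; rewrite mulr0 mul0r addr0 => <-; ring.
Qed.

Lemma L2_restr (A : set (measurableTypeR R)) h : measurable A -> L2 A h ->
  L2 setT (fun t => h t *+ (t \in A)).
Proof. by move=> mA Lh; apply: L2_patch. Qed.

(** On each [J k], [f] differs from one fixed solution on the line, with [h] extended by zero, by a
    multiple of [cexp lam]. This continues the pieces of [f] up to and beyond their endpoints, where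
    the energy inequality needs values. *)
Lemma global_form lam h f : Im lam != 0 -> L2 D h ->
  (forall k, (k <= n)%N -> solves (J k) lam h f) ->
  exists phi : nat -> R -> R[i], forall k, (k <= n)%N ->
    [/\ locally_ac setT (phi k), forall t, J k t -> f t = phi k t &
      ae_derivative setT (phi k) (fun t => tpi * (lam * phi k t + h t *+ (t \in D)))].
Proof.
move=> tau0 Lh sf.
have [F [LF sF]] := exists_solution tau0 (L2_restr (measurable_Omega n alpha beta) Lh).
have Kex k : exists K, (k <= n)%N -> forall t, J k t -> f t = F t + K * cexp lam t.
  have [kn|nk] := leqP k n; last by exists 0.
  have sFk : solves (J k) lam (fun t => h t *+ (t \in D)) F.
    case: sF => acF dF; split; first exact: locally_acS acF.
    by apply: (ae_imp dF) => t /(_ I).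
  have [|K HK] := solves_sub (@is_interval_J _ _ _ _ _) (sf k kn) sFk; last by exists K => _.
  by move=> t Jt; rewrite mem_set ?mulr1n//; exact: J_sub Jt.
have [K HK] := choice Kex.
exists (fun k t => F t + K k * cexp lam t) => k kn; case: sF => acF dF; split.
- apply: locally_acD => //; apply: locally_acM; last exact: locally_ac_cexp.
  by move=> x y _; exact: abs_continuous_cst.
- exact: HK.
- apply: (ae_imp dF) => t /(_ I) d _.
  have := is_cderive_add d (is_cderive_mul (is_cderive_cst (K k) t) (is_cderive_cexp lam t)).
  by congr (is_cderive _ _ _); ring.
Qed.

Lemma normc_c : normc c = 1.
Proof. by move: hc; rewrite normc_def => /complexI; case: c. Qed.

Lemma Rintegral_Omega f : L2 D f ->
  \int[mu]_(x in D) (normc (f x) ^+ 2) =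
  \sum_(k < n.+1) \int[mu]_(x in J k) (normc (f x) ^+ 2).
Proof.
move=> Lf; have mD := measurable_Omega n alpha beta.
have [mf If] := (L2P f mD).1 Lf.
transitivity (fine (\sum_(k < n.+1) (\int[mu]_(x in J k) (normc (f x) ^+ 2))%:E)%E); last by rewrite sumEFin.
rewrite {1}/Rintegral (integral_Omega hab)//; last 2 first.
- exact: measurable_normc2.
- by move=> x; exact: sqr_ge0.
congr fine; apply: eq_bigr => k _; rewrite /Rintegral fineK//.
apply: integrable_fin_num; first exact: measurable_J.
apply: integrableS If => //; first exact: measurable_J.
by apply: J_sub; rewrite -ltnS.
Qed.

Lemma Rintegral_subset (A B : set (measurableTypeR R)) f : measurable A -> measurable B ->
  A `<=` B -> L2 B f ->
  \int[mu]_(x in A) (normc (f x) ^+ 2) <= \int[mu]_(x in B) (normc (f x) ^+ 2).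
Proof.
move=> mA mB AB Lf; have [mf If] := (L2P f mB).1 Lf; rewrite /Rintegral; apply: fine_le.
- by apply: integrable_fin_num => //; exact: integrableS If.
- exact: integrable_fin_num.
- apply: ge0_subset_integral => //; first exact: measurable_int If.
  by move=> x _; rewrite lee_fin sqr_ge0.
Qed.

Lemma Rintegral_exhaust (F : (set R)^nat) (A : set (measurableTypeR R)) f (C : R) :
  nondecreasing_seq F -> (forall i, measurable (F i)) -> A = \bigcup_i F i ->
  measurable A -> L2 A f ->
  (forall i, \int[mu]_(x in F i) (normc (f x) ^+ 2) <= C) ->
  \int[mu]_(x in A) (normc (f x) ^+ 2) <= C.
Proof.
move=> ndF mF AF mA Lf FC; have [mf If] := (L2P f mA).1 Lf.
have FA i : F i `<=` A by rewrite AF; exact: bigcup_sup.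
rewrite -lee_fin /Rintegral fineK ?integrable_fin_num// AF; apply: integral_exhaust => //.
- by move=> i; apply: measurable_funS (measurable_normc2 mf).
- by move=> x; exact: sqr_ge0.
- move=> i.
  have IFi : mu.-integrable (F i) (EFin \o (fun x => normc (f x) ^+ 2)).
    exact: (integrableS mA (mF i) (FA i) If).
  have fi := integrable_fin_num (mF i : measurable (F i : set (measurableTypeR R))) IFi.
  by have := FC i; rewrite -lee_fin /Rintegral fineK.
Qed.

Lemma Rintegral_open_closed (a b : R) f : locally_ac setT f ->
  \int[mu]_(x in `]a, b[) (normc (f x) ^+ 2) = \int[mu]_(x in `[a, b]) (normc (f x) ^+ 2).
Proof.
move=> acf.
have mo : measurable (`[a, b]%classic : set (measurableTypeR R)) by [].
have [_ If] := (L2P f mo).1 (L2_locally_ac a b acf).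
rewrite Rintegral_itv_bndo_bndc; last first.
  by apply: integrableS If => //; apply: subset_itvW; rewrite ?lexx.
rewrite Rintegral_itv_obnd_cbnd//.
by apply: integrableS If => //; apply: subset_itvr; rewrite bnd_simp.
Qed.

(** Otherwise [|f|^2 >= e] on a set of infinite measure. One such point far out is enough to drop
    the boundary term at infinity, without proving that [f] tends to zero. *)
Lemma small_left_ray f (b e : R) : L2 `]-oo, b[%classic f -> 0 < e ->
  exists2 x, x < b & normc (f x) ^+ 2 < e.
Proof.
move=> Lf e0; apply: contrapT => H.
apply: (@not_L2 _ `]-oo, b[%classic f e _ _ e0 _ Lf) => //.
  by rewrite lebesgue_measure_itv/= ltNyr.
move=> x; rewrite /= in_itv/= => xb; rewrite leNgt; apply/negP => fx.
by apply: H; exists x.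
Qed.

Lemma small_right_ray f (b e : R) : L2 `]b, +oo[%classic f -> 0 < e ->
  exists2 x, b < x & normc (f x) ^+ 2 < e.
Proof.
move=> Lf e0; apply: contrapT => H.
apply: (@not_L2 _ `]b, +oo[%classic f e _ _ e0 _ Lf) => //.
  by rewrite lebesgue_measure_itv/= ltry.
move=> x; rewrite /= in_itv/= andbT => xb; rewrite leNgt; apply/negP => fx.
by apply: H; exists x.
Qed.

(** The energy inequality is summed over the intervals. Periodicity removes the boundary terms of
    the bounded ones, and those of the half-lines cancel each other, leaving [A] times the integral
    of [|f|^2] at most [B] times that of [|h|^2], with [B / A = |Im lam|^-2]. *)
Lemma resolvent_bound lam f g : Im lam != 0 -> P f g ->
  L2norm D f <= `|Im lam|^-1 * L2norm D (fun x => g x - lam * f x).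
Proof.
move=> tau0 Pfg; set h := fun x => g x - lam * f x.
have mD := measurable_Omega n alpha beta.
have [[Lf _ _ _] [df [Ldf _ gE]]] := Pfg.
have Lh : L2 D h.
  apply: L2B => //; last exact: L2Z.
  by rewrite (_ : g = fun x => tpi^-1 * df x); [exact: L2Z|apply/funext].
have sf := PB_solves (h := h) Pfg (ae_all (fun t _ => erefl (h t))).
have [phi Hphi] := global_form tau0 Lh sf.
have [bper bn] := @PB_boundary _ _ _ _ _ hn hab f g phi Pfg
  (fun k kn => let: And3 a b _ := Hphi k kn in conj a b).
set T := `|Im lam|; have T0 : 0 < T by rewrite normr_gt0.
set s := Num.sg (Im lam).
have s1 : `|s| <= 1 by rewrite normr_sg tau0.
have pi0 := @pi_gt0 R.
pose A := 2 * pi * T; pose B := 2 * pi / T.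
have A0 : 0 < A by rewrite !mulr_gt0.
have B0 : 0 < B by rewrite divr_gt0// mulr_gt0.
pose If k := \int[mu]_(x in J k) (normc (f x) ^+ 2).
pose Ih k := \int[mu]_(x in J k) (normc (h x) ^+ 2).
have mJ k := measurable_J n alpha beta k.
have LfJ k : (k <= n)%N -> L2 (J k) f by move=> kn; exact: (L2S mD (mJ k) (J_sub kn) Lf).
have LhJ k : (k <= n)%N -> L2 (J k) h by move=> kn; exact: (L2S mD (mJ k) (J_sub kn) Lh).
have Lh0 := L2_restr mD Lh.
(* The energy inequality holds for [phi k] on the closed interval; passing to the open one, which
   does not change the integrals, allows [f] and [h] themselves to appear. *)
have en k (x y : R) : (k <= n)%N -> x <= y -> `]x, y[%classic `<=` J k ->
    s * (normc (phi k y) ^+ 2 - normc (phi k x) ^+ 2) +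
    A * \int[mu]_(t in `]x, y[) (normc (f t) ^+ 2) <= B * Ih k.
  move=> kn xy xyJ; have [ack fE dk] := Hphi k kn.
  have L1 := L2_locally_ac x y ack.
  have mxy : measurable (`[x, y]%classic : set (measurableTypeR R)) by [].
  have L2' : L2 `[x, y]%classic (fun t => h t *+ (t \in D)) by exact: L2S Lh0.
  have := energy xy tau0 (ack x y (@subsetT _ _)) L1 L2'.
  move=> /(_ _)/wrap[]; first by apply: (ae_imp dk) => t d _; exact: d.
  rewrite -Rintegral_open_closed// -/s -/T -/A -/B.
  have -> : \int[mu]_(t in `]x, y[) (normc (f t) ^+ 2) = \int[mu]_(t in `]x, y[) (normc (phi k t) ^+ 2).
    by apply: eq_Rintegral => t; rewrite inE => txy; rewrite fE//; exact: xyJ.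
  move=> H; apply: (le_trans H); rewrite ler_wpM2l ?(ltW B0)//.
  have -> : \int[mu]_(t in `[x, y]) (normc (h t *+ (t \in D)) ^+ 2) =
      \int[mu]_(t in `]x, y[) (normc (h t *+ (t \in D)) ^+ 2).
    have mo : measurable (`[x, y]%classic : set (measurableTypeR R)) by [].
    have [_ I0] := (L2P _ mo).1 L2'.
    rewrite Rintegral_itv_bndo_bndc; last first.
      by apply: integrableS I0 => //; apply: subset_itvW; rewrite ?lexx.
    rewrite Rintegral_itv_obnd_cbnd//.
    by apply: integrableS I0 => //; apply: subset_itvr; rewrite bnd_simp.
  have -> : \int[mu]_(t in `]x, y[) (normc (h t *+ (t \in D)) ^+ 2) =
      \int[mu]_(t in `]x, y[) (normc (h t) ^+ 2).
    apply: eq_Rintegral => t; rewrite inE => txy; rewrite mem_set ?mulr1n//.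
    by apply: (J_sub kn); exact: xyJ.
  by apply: Rintegral_subset => //; exact: LhJ.
have small (u e : R) : 0 <= u -> u < e -> - e <= s * u <= e.
  move=> u0 ue; rewrite -ler_norml normrM (ger0_norm u0).
  by apply: le_trans (ltW ue); rewrite -[leRHS]mul1r ler_wpM2r.
have en0 : s * normc (phi 0%N (beta 1%N)) ^+ 2 + A * If 0%N <= B * Ih 0%N.
  set U := normc _ ^+ 2; set b := beta 1%N.
  have L0 := LfJ 0%N (leq0n _).
  suff : If 0%N <= (B * Ih 0%N - s * U) / A.
    by rewrite ler_pdivlMr// mulrC lerBrDl.
  apply: (@Rintegral_exhaust (fun i => `]b - i%:R, b[%classic)) => //.
  - move=> i j ij; apply/subsetPset; apply: subset_itvr; rewrite bnd_simp.
    by rewrite lerD2l lerN2 ler_nat.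
  - apply/seteqP; split => t; rewrite J0E /= in_itv/=.
      move=> tb; exists (Num.truncn (b - t)).+1 => //=.
      by rewrite in_itv/= tb andbT ltrBlDr -ltrBlDl truncnS_gt.
    by move=> [i _] /=; rewrite in_itv/= => /andP[].
  (* For a fixed truncation, the energy interval starts at a point [x] left of [b - i] with
     [|f x|^2 < e]: it covers the truncated interval, and the boundary term at [x] costs at most
     [e]. *)
  move=> i; rewrite ler_pdivlMr// mulrC; apply/ler_addgt0Pr => e e0.
  have ib : b - i%:R <= b by rewrite gerBl.
  have sub : `]-oo, b - i%:R[%classic `<=` J 0%N.
    by rewrite J0E; apply: subset_itvl; rewrite bnd_simp.
  have Lray : L2 `]-oo, b - i%:R[%classic f by exact: (L2S (mJ 0%N) _ sub L0).
  have [x xb fx] := small_left_ray Lray e0.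
  have xb' : x < b by exact: lt_le_trans ib.
  have xJ : J 0%N x by rewrite J0E /= in_itv.
  have xbJ : `]x, b[%classic `<=` J 0%N by rewrite J0E; exact: subset_itvr.
  have := en 0%N x b (leq0n _) (ltW xb') xbJ.
  have [_ fE _] := Hphi 0%N (leq0n _); rewrite -(fE x xJ) -/U.
  have := small _ _ (sqr_ge0 (normc (f x))) fx.
  have : A * \int[mu]_(t in `](b - i%:R), b[) (normc (f t) ^+ 2) <=
         A * \int[mu]_(t in `]x, b[) (normc (f t) ^+ 2).
    rewrite ler_wpM2l ?(ltW A0)//; apply: Rintegral_subset => //.
      by apply: subset_itvr; rewrite bnd_simp ltW.
    exact: (L2S (mJ 0%N) _ xbJ L0).
  set I1 := A * _; set I2 := A * _; set q := normc (f x) ^+ 2.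
  by rewrite mulrBr => ? /andP[]; lra.
have enn : - (s * normc (phi n (alpha n)) ^+ 2) + A * If n <= B * Ih n.
  set U := normc _ ^+ 2; set b := alpha n.
  have L0 := LfJ n (leqnn _).
  suff : If n <= (B * Ih n + s * U) / A.
    by rewrite ler_pdivlMr// mulrC -lerBlDr => h1; rewrite addrC.
  apply: (@Rintegral_exhaust (fun i => `]b, b + i%:R[%classic)) => //.
  - move=> i j ij; apply/subsetPset; apply: subset_itvl; rewrite bnd_simp.
    by rewrite lerD2l ler_nat.
  - apply/seteqP; split => t; rewrite (JnE _ _ hn) /= in_itv/= andbT.
      move=> tb; exists (Num.truncn (t - b)).+1 => //=.
      by rewrite in_itv/= tb/= -ltrBlDl truncnS_gt.
    by move=> [i _] /=; rewrite in_itv/= => /andP[].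
  move=> i; rewrite ler_pdivlMr// mulrC; apply/ler_addgt0Pr => e e0.
  have ib : b <= b + i%:R by rewrite lerDl.
  have sub : `]b + i%:R, +oo[%classic `<=` J n.
    by rewrite (JnE _ _ hn); apply: subset_itvr; rewrite bnd_simp.
  have Lray : L2 `]b + i%:R, +oo[%classic f by exact: (L2S (mJ n) _ sub L0).
  have [x xb fx] := small_right_ray Lray e0.
  have xb' : b < x by exact: le_lt_trans xb.
  have xJ : J n x by rewrite (JnE _ _ hn) /= in_itv/= xb'.
  have xbJ : `]b, x[%classic `<=` J n by rewrite (JnE _ _ hn); exact: subset_itvl.
  have := en n b x (leqnn _) (ltW xb') xbJ.
  have [_ fE _] := Hphi n (leqnn _); rewrite -(fE x xJ) -/U.
  have := small _ _ (sqr_ge0 (normc (f x))) fx.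
  have : A * \int[mu]_(t in `]b, (b + i%:R)[) (normc (f t) ^+ 2) <=
         A * \int[mu]_(t in `]b, x[) (normc (f t) ^+ 2).
    rewrite ler_wpM2l ?(ltW A0)//; apply: Rintegral_subset => //.
      by apply: subset_itvl; rewrite bnd_simp ltW.
    exact: (L2S (mJ n) _ xbJ L0).
  set I1 := A * _; set I2 := A * _; set q := normc (f x) ^+ 2.
  by rewrite mulrBr => ? /andP[]; lra.
have enk k : (0 < k < n)%N -> A * If k <= B * Ih k.
  move=> k0n; have [k0 kn] := andP k0n.
  have ab : alpha k < beta k.+1 by exact: hab.2.
  have := en k (alpha k) (beta k.+1) (ltnW kn) (ltW ab).
  by rewrite /If JkE// => /(_ (@subset_refl _ _)); rewrite -bper// subrr mulr0 add0r.
have tot : A * (\sum_(k < n.+1) If k) <= B * (\sum_(k < n.+1) Ih k).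
  set U := s * normc (phi 0%N (beta 1%N)) ^+ 2 in en0.
  have UV : s * normc (phi n (alpha n)) ^+ 2 = U.
    by rewrite bn normc_mul normc_c mul1r.
  rewrite UV in enn.
  (* Boundary contributions interval by interval: [- U] and [U] on the half-lines, 0 elsewhere, with
     sum 0. *)
  pose bd k := if k == 0%N then - U else if k == n then U else 0.
  have key k : (k <= n)%N -> A * If k <= B * Ih k + bd k.
    move=> kn; rewrite /bd; have [->|k0] := eqVneq k 0%N; first by move: en0; lra.
    have [->|kn'] := eqVneq k n; first by move: enn; lra.
    by rewrite addr0 enk// lt0n k0 ltn_neqAle kn'.
  rewrite !mulr_sumr.
  apply: (@le_trans _ _ (\sum_(k < n.+1) (B * Ih k + bd k))).
    by apply: ler_sum => k _; apply: key; rewrite -ltnS.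
  rewrite big_split/= gerDl.
  rewrite (bigD1 ord0)//= (bigD1 ord_max)//=; last first.
    by apply/eqP => /(congr1 val)/= n0; move: hn; rewrite n0.
  rewrite big1 ?addr0.
    rewrite /bd eqxx; case: eqP => [n0|_]; first by move: hn; rewrite n0.
    by rewrite ?eqxx addNr.
  move=> k /andP[k0 kn]; rewrite /bd.
  by rewrite !ifN.
rewrite -(@ler_pXn2r _ 2)// ?nnegrE ?mulr_ge0 ?invr_ge0 ?(ltW T0) ?L2norm_ge0//.
rewrite exprMn !L2normE !Rintegral_Omega//.
move: tot; rewrite -/(If _) => tot.
rewrite -(ler_pM2l A0); apply: (le_trans tot).
rewrite mulrA /A /B le_eqVlt; apply/orP; left; apply/eqP; congr (_ * _).
by field; rewrite gt_eqF.
Qed.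

End resolvent_bound.

(** * The scalar product of L^2 *)

Section L2_products.
Context {R : realType}.
Local Notation mu := (@lebesgue_measure R).
Local Notation normc := ComplexField.Normc.normc.
Local Notation Re := complex.Re.
Local Notation Im := complex.Im.
Implicit Types (f g h : R -> R[i]) (lam z w : R[i]) (D : set (measurableTypeR R)).

Lemma cintegral_ext D f g : (forall t, D t -> f t = g t) -> cintegral D f = cintegral D g.
Proof.
by move=> fg; congr (_ +i* _); apply: eq_Rintegral => t; rewrite inE => Dt; rewrite fg.
Qed.

Lemma L2dotD D h f g : measurable D -> L2 D h -> L2 D f -> L2 D g ->
  L2dot D h (fun x => f x + g x) = L2dot D h f + L2dot D h g.
Proof.
move=> mD Lh Lf Lg.
have [a1 a2] := integrable_ReIm_mul mD Lh (L2_conj mD Lf).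
have [b1 b2] := integrable_ReIm_mul mD Lh (L2_conj mD Lg).
rewrite -(cintegralD mD a1 a2 b1 b2); apply: cintegral_ext => t _.
by rewrite rmorphD mulrDr.
Qed.

Lemma L2dotZ D h f z : measurable D -> L2 D h -> L2 D f ->
  L2dot D h (fun x => z * f x) = z^* * L2dot D h f.
Proof.
move=> mD Lh Lf.
have [a1 a2] := integrable_ReIm_mul mD Lh (L2_conj mD Lf).
rewrite -(cintegralZ _ mD a1 a2); apply: cintegral_ext => t _.
by rewrite rmorphM mulrCA.
Qed.

Lemma L2dot0 D h : L2dot D h (fun=> 0) = 0.
Proof.
rewrite /L2dot (cintegral_ext (g := fun=> 0)); last by move=> t _; rewrite rmorph0 mulr0.
by rewrite /cintegral /= /Rintegral integral0.
Qed.

Lemma L2dot_sum D h m (a : 'I_m -> R[i]) (v : 'I_m -> R -> R[i]) : measurable D ->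
  L2 D h -> (forall i, L2 D (v i)) ->
  L2dot D h (fun x => \sum_(i < m) a i * v i x) = \sum_(i < m) (a i)^* * L2dot D h (v i).
Proof.
move=> mD Lh; elim: m a v => [|m IH] a v Lv.
  rewrite big_ord0; apply: etrans (L2dot0 D h); apply: cintegral_ext => t _.
  by rewrite big_ord0.
rewrite big_ord_recr -IH// -L2dotZ//= -L2dotD//; last exact: L2Z.
  by apply: cintegral_ext => t _; rewrite big_ord_recr.
by apply: L2_sum => // i; exact: L2Z.
Qed.

(** Stands in for Cauchy-Schwarz: the weighted inequality is integrated for the real and for the
    imaginary part, whence the factor 2. *)
Lemma L2dot_bound D h (w : R -> R[i]) (s : R) : measurable D -> L2 D h -> L2 D w -> 0 < s ->
  normc (L2dot D h w) <= 2 * (s * L2norm D h ^+ 2 + L2norm D w ^+ 2 / s).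
Proof.
move=> mD Lh Lw s0; have Lw' := L2_conj mD Lw.
have [a1 a2] := integrable_ReIm_mul mD Lh Lw'.
have [_ Ih] := (L2P h mD).1 Lh; have [_ Iw] := (L2P w mD).1 Lw.
have i1 := integrableZr s mD Ih; have i2 := integrableZr s^-1 mD Iw.
have bnd (F : R -> R) : (forall u, `|F u| <= normc (h u * (w u)^*)) ->
    mu.-integrable D (EFin \o F) ->
    `|\int[mu]_(u in D) F u| <= s * L2norm D h ^+ 2 + L2norm D w ^+ 2 / s.
  move=> FB iF; apply: (@le_trans _ _ (\int[mu]_(u in D) `|F u|)).
    exact: le_normr_Rintegral.
  rewrite !L2normE [X in _ + X]mulrC -!RintegralZl// -RintegralD//.
  apply: le_Rintegral => //; [exact: integrable_norm|exact: integrableDr|].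
  move=> u _; apply: (le_trans (FB u)); rewrite normc_mul.
  have -> : normc ((w u)^*) = normc (w u) by case: (w u) => a b /=; rewrite sqrrN.
  set a := normc _; set b := normc _.
  have a0 : 0 <= a by exact: normc_ge0.
  have b0 : 0 <= b by exact: normc_ge0.
  have hh : 0 <= (s * a - b) ^+ 2 by exact: sqr_ge0.
  have sab : 0 <= s * (a * b) by rewrite !mulr_ge0// ltW.
  rewrite -(ler_pM2l s0) mulrDr (mulrA s s^-1) mulfV ?gt_eqF// mul1r.
  move: hh sab; nra.
rewrite mulr_natl mulr2n; apply: (le_trans (normc_le_ReIm _)); apply: lerD.
- by apply: bnd => // u; exact: norm_Re_le.
- by apply: bnd => // u; exact: norm_Im_le.
Qed.

End L2_products.

(** * The orthogonal complement of the eigenvectors *)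

Section absolutely_continuous_part.
Context {R : realType}.
Local Notation mu := (@lebesgue_measure R).
Local Notation normc := ComplexField.Normc.normc.
Local Notation Re := complex.Re.
Local Notation Im := complex.Im.
Variables (n : nat) (alpha beta : nat -> R) (c : R[i]).
Hypotheses (hn : (2 < n)%N) (hab : ordered_endpoints n alpha beta) (hc : `|c| = 1).
Implicit Types (f g h : R -> R[i]) (lam z w : R[i]).
Local Notation J := (Jint n alpha beta).
Local Notation D := (Omega n alpha beta).
Local Notation P := (PB alpha beta (block_B n c)).
Local Notation efun := (efun n alpha beta).
Local Notation resonant := (resonant alpha beta).
Local Notation H := (orthocomp D
  (closed_span D (\bigcup_(lam in [set: R[i]]) eigenvectors D P lam))).

Lemma L2_eigenvector f lam : eigenvectors D P lam f -> L2 D f.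
Proof. by move=> [[g [[]]]]. Qed.

(** On [Omega] an eigenfunction is a finite combination of the [efun k lam] with [k] resonant, so it
    suffices to test against these. *)
Lemma eigenvector_orthogonal h f lam : L2 D h ->
  (forall k lam, (0 < k < n)%N -> resonant lam k -> L2dot D h (efun k lam) = 0) ->
  eigenvectors D P lam f -> L2dot D h f = 0.
Proof.
move=> Lh he [ef _]; have mD := measurable_Omega n alpha beta.
have [C [fC C0 Cn Ck]] := eigenspace_form hn hab hc ef.
have Le k : (k <= n)%N -> C k != 0 -> (0 < k < n)%N /\ resonant lam k.
  move=> kn Ck0.
  have k0n : (0 < k < n)%N.
    rewrite lt0n ltn_neqAle kn andbT; apply/andP; split; apply: contra Ck0 => /eqP ->.
      by rewrite C0.
    by rewrite Cn.
  split => //; have [e|//] := Ck k k0n.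
  by rewrite e eqxx in Ck0.
(* Indices with [C k = 0], among them both half-lines, get the zero function, so that every [v k] is
   square integrable. *)
pose v (k : 'I_n.+1) := if C k == 0 then (fun=> 0) else efun k lam.
have Lv k : L2 D (v k).
  rewrite /v; case: eqP => [_|/eqP Ck0]; first exact: L2_0.
  have kn : (k <= n)%N by rewrite -ltnS.
  by apply: L2_efun; have [] := Le k kn Ck0.
transitivity (L2dot D h (fun x => \sum_(k < n.+1) C k * v k x)).
  apply: cintegral_ext => t [k kn Jt]; congr (_ * (_)^*).
  rewrite (bigD1 (Ordinal (kn : (k < n.+1)%N)))//= big1 ?addr0; last first.
    move=> j jk; rewrite /v; case: eqP => [->|_]; first by rewrite mul0r.
    rewrite (efun0 hab _ kn _ Jt) ?mulr0//; apply: contra jk => /eqP e.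
    by apply/eqP/val_inj => /=; rewrite e.
  rewrite (fC k t kn Jt) /v /=; case: eqP => [->|_]; first by rewrite !mul0r.
  by rewrite (efunE hab _ kn Jt).
rewrite L2dot_sum// big1// => k _; rewrite /v; case: eqP => [->|/eqP Ck0].
  by rewrite rmorph0 mul0r.
have kn : (k <= n)%N by rewrite -ltnS.
by have [k0n r] := Le k kn Ck0; rewrite he// mulr0.
Qed.

(** Replaces the closed span by explicit test functions: orthogonality to them passes to
    eigenvectors, to finite combinations and, by [L2dot_bound], to limits. *)
Lemma orthocompP h : H h <-> L2 D h /\
  (forall k lam, (0 < k < n)%N -> resonant lam k -> L2dot D h (efun k lam) = 0).
Proof.
have mD := measurable_Omega n alpha beta; split=> -[Lh hh]; split => //.
- move=> k lam k0n r; apply: hh; split; first exact: L2_efun.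
  move=> e e0; exists (efun k lam).
    exists 1%N, (fun=> 1), (fun=> efun k lam); split.
      by move=> _; exists lam => //; exact: efun_eigenvector.
    by move=> x; rewrite big_ord1 mul1r.
  rewrite /L2norm (eq_Rintegral _ _ (g := fun=> 0)).
    by rewrite /Rintegral integral0 sqrtr0.
  by move=> x _; rewrite subrr ComplexField.Normc.normc0 expr0n.
- move=> g [Lg gS]; apply: normc_eq0.
  apply/eqP; rewrite eq_le normc_ge0 andbT; apply/ler_addgt0Pr => e e0; rewrite add0r.
  set A := L2norm D h ^+ 2.
  have A0 : 0 <= A by exact: sqr_ge0.
  (* With weight [d] and an approximation within [d], the bound on the product is
     [2 * (d * A + d) = e]. *)
  pose d := e / (2 * (A + 1)).
  have A1 : 0 < A + 1 by rewrite ltr_wpDl.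
  have d0 : 0 < d by rewrite divr_gt0// mulr_gt0.
  have [g' [m [a [v [Sv g'E]]]] gg'] := gS d d0.
  have Lv i : L2 D (v i) by have [lam _ /L2_eigenvector] := Sv i.
  have g'E' : g' = fun x => \sum_(i < m) a i * v i x by exact/funext.
  have Lg' : L2 D g' by rewrite g'E'; apply: L2_sum => // i; exact: L2Z.
  have hg' : L2dot D h g' = 0.
    rewrite g'E' L2dot_sum// big1// => i _; have [lam _ ev] := Sv i.
    by rewrite (eigenvector_orthogonal Lh hh ev) mulr0.
  have Lgg' : L2 D (fun x => g x - g' x) by exact: L2B.
  have -> : L2dot D h g = L2dot D h (fun x => g x - g' x).
    rewrite -[RHS]addr0 -hg' -L2dotD//; apply: cintegral_ext => x _.
    by rewrite subrK.
  apply: (le_trans (L2dot_bound mD Lh Lgg' d0)); rewrite -/A.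
  have : L2norm D (fun x => g x - g' x) ^+ 2 / d <= d.
    rewrite ler_pdivrMr// -expr2 ler_pXn2r// ?nnegrE ?L2norm_ge0 ?(ltW d0)//.
    exact: ltW.
  have -> : e = 2 * (d * (A + 1)) by rewrite /d; field; rewrite gt_eqF.
  move=> h1; rewrite ler_pM2l// mulrDr mulr1 lerD2l//.
Qed.

Lemma cintegral_patch k f : (k <= n)%N ->
  cintegral D (fun t => f t *+ (t \in J k)) = cintegral (J k) f.
Proof.
move=> kn; have JD := J_sub (alpha := alpha) (beta := beta) kn.
have E : D `&` J k = J k by rewrite setIidr.
congr (_ +i* _).
- rewrite -[in RHS]E Rintegral_mkcondr; apply: eq_Rintegral => t _.
  by rewrite patchE; case: (t \in J k); rewrite ?mulr1n ?mulr0n.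
- rewrite -[in RHS]E Rintegral_mkcondr; apply: eq_Rintegral => t _.
  by rewrite patchE; case: (t \in J k); rewrite ?mulr1n ?mulr0n.
Qed.

(** Rewrites the test as an integral over the closed interval, the form to which the fundamental
    theorem applies. *)
Lemma L2dot_efun k f (r : R) phi : (0 < k < n)%N ->
  (forall t, J k t -> f t = phi t) -> L2 `[alpha k, beta k.+1]%classic phi ->
  L2dot D f (efun k r%:C) =
  cintegral `[alpha k, beta k.+1] (fun t => phi t * cexp (- r%:C) t).
Proof.
move=> k0n fphi Lphi; have [k0 kn] := andP k0n; have {}kn := ltnW kn.
rewrite /L2dot (cintegral_ext (g := fun t => (phi t * cexp (- r%:C) t) *+ (t \in J k))).
  rewrite cintegral_patch// JkE//.
  have m1 : measurable (`[alpha k, beta k.+1]%classic : set (measurableTypeR R)) by [].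
  have [a1 a2] := integrable_ReIm_mul m1 Lphi (L2_locally_ac (alpha k) (beta k.+1) (@locally_ac_cexp _ setT (- r%:C))).
  have HH (F : R -> R) : mu.-integrable `[alpha k, beta k.+1] (EFin \o F) ->
      \int[mu]_(t in `]alpha k, beta k.+1[) F t = \int[mu]_(t in `[alpha k, beta k.+1]) F t.
    move=> iF; rewrite Rintegral_itv_bndo_bndc; last first.
      by apply: integrableS iF => //; apply: subset_itvW; rewrite ?lexx.
    rewrite Rintegral_itv_obnd_cbnd//.
    by apply: integrableS iF => //; apply: subset_itvr; rewrite bnd_simp.
  by congr (_ +i* _); exact: HH.
move=> t [j jn Jt]; have [jk|jk] := eqVneq j k.
  rewrite -jk in fphi *; rewrite (efunE hab _ jn Jt) fphi// mem_set ?mulr1n//.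
  by congr (_ * _); exact: conj_cexp.
rewrite (efun0 hab _ jn jk Jt) rmorph0 mulr0 memNset ?mulr0n// => Jkt.
by move/eqP: jk; apply; exact: (J_inj hab jn kn Jt Jkt).
Qed.

Lemma resonant_real lam k : (0 < k < n)%N -> resonant lam k -> exists r : R, lam = r%:C.
Proof. by move=> k0n /(resonantP hab _ k0n)[z ->]; eexists. Qed.

End absolutely_continuous_part.

(** * Solving the resolvent equation in the orthogonal complement *)

Section continuous_part.
Context {R : realType}.
Local Notation mu := (@lebesgue_measure R).
Local Notation normc := ComplexField.Normc.normc.
Local Notation Re := complex.Re.
Local Notation Im := complex.Im.
Variables (n : nat) (alpha beta : nat -> R) (c : R[i]).
Hypotheses (hn : (2 < n)%N) (hab : ordered_endpoints n alpha beta) (hc : `|c| = 1).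
Implicit Types (f g h : R -> R[i]) (lam z w : R[i]).
Local Notation J := (Jint n alpha beta).
Local Notation D := (Omega n alpha beta).
Local Notation P := (PB alpha beta (block_B n c)).
Local Notation efun := (efun n alpha beta).
Local Notation resonant := (resonant alpha beta).
Local Notation H := (orthocomp D
  (closed_span D (\bigcup_(lam in [set: R[i]]) eigenvectors D P lam))).

Lemma L2_cexp_Nyc lam (b : R) : Im lam < 0 -> L2 `]-oo, b]%classic (cexp lam).
Proof.
move=> l0; split; first exact: cmeasurable_cexp.
pose k := 2 * (2 * pi * Im lam).
have k0 : k < 0 by rewrite /k !pmulr_rlt0// ?mulr_gt0// pi_gt0.
have e2 y : normc (cexp lam y) ^+ 2 = expR (- (k * y)).
  by rewrite normc_cexp expr2 -expRD /k; congr expR; ring.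
under eq_integral do rewrite e2.
by apply: le_lt_trans (integral_expNy b k0) _; rewrite ltry.
Qed.

Lemma L2_cexp_J0 lam : Im lam < 0 -> L2 (J 0%N) (cexp lam).
Proof.
move=> l0; apply: (L2S _ (measurable_J n alpha beta 0) _ (L2_cexp_Nyc (beta 1%N) l0)) => //.
by rewrite J0E; apply: subset_itvl; rewrite bnd_simp.
Qed.

Lemma cexpNN lam (x : R) : cexp (- lam) (- x) = cexp lam x.
Proof. by rewrite /cexp cReN cImN !mulrN !mulNr !opprK. Qed.

(** The reflection [t -> - t] carries [cexp lam] to [cexp (- lam)] and [J n] to a left ray, where
    the previous case applies. *)
Lemma L2_cexp_Jn lam : 0 < Im lam -> L2 (J n) (cexp lam).
Proof.
move=> l0; have l0' : Im (- lam) < 0 by rewrite cImN oppr_lt0.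
have mA : measurable (`]-oo, - alpha n]%classic : set (measurableTypeR R)) by [].
have L := L2_opp (L2_restr mA (L2_cexp_Nyc (- alpha n) l0')).
have mJ := measurable_J n alpha beta n.
have LJ := L2S (@measurableT _ _) mJ (@subsetT _ _) L.
apply: (L2_bound (C := 1) mJ _ LJ); first exact: cmeasurable_cexp.
move=> t; rewrite (JnE _ _ hn) /= in_itv/= andbT => at_.
by rewrite mem_set ?mulr1n ?cexpNN ?mul1r//= in_itv/= lerN2 ltW.
Qed.

Lemma resolvent_surjective lam h : Im lam != 0 -> H h ->
  exists f g, restriction P H f g /\ ae_eq mu D (fun x => g x - lam * f x) h.
Proof.
move=> tau0 /(orthocompP hn hab hc)[Lh horth].
have mD := measurable_Omega n alpha beta; have mJ k := measurable_J n alpha beta k.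
have mT : measurable (setT : set (measurableTypeR R)) by [].
have Lh0 := L2_restr mD Lh.
have [F [LF [acF dF]]] := exists_solution tau0 Lh0.
(* On a bounded interval, [K k] solves the periodicity equation. On the half-lines the whole
   correction is put where [cexp lam] is square integrable, and its constant solves the gluing
   equation. *)
pose K k := if k == 0%N then
    (if Im lam < 0 then (c^-1 * F (alpha n) - F (beta 1%N)) / cexp lam (beta 1%N) else 0)
  else if k == n then
    (if Im lam < 0 then 0 else (c * F (beta 1%N) - F (alpha n)) / cexp lam (alpha n))
  else (F (alpha k) - F (beta k.+1)) / (cexp lam (beta k.+1) - cexp lam (alpha k)).
pose phi k t := F t + K k * cexp lam t.
pose dphi k t := tpi * (lam * phi k t + h t *+ (t \in D)).
have acphi k : locally_ac setT (phi k).
  apply: locally_acD => //; apply: locally_acM; last exact: locally_ac_cexp.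
  by move=> x y _; exact: abs_continuous_cst.
have adphi k : ae_derivative setT (phi k) (dphi k).
  apply: (ae_imp dF) => t /(_ I) d _.
  have := is_cderive_add d (is_cderive_mul (is_cderive_cst (K k) t) (is_cderive_cexp lam t)).
  by congr (is_cderive _ _ _); rewrite /dphi /phi; ring.
have Lphi k : (k <= n)%N -> L2 (J k) (phi k).
  move=> kn; have LFJ := L2S mT (mJ k) (@subsetT _ _) LF.
  apply: L2D => //.
  have L0 j : L2 (J j) (fun t => 0 * cexp lam t).
    rewrite (_ : (fun t => _) = fun=> 0); first exact: L2_0.
    by apply/funext => t; rewrite mul0r.
  rewrite /K; have [->|k0] := eqVneq k 0%N.
    have [l0|l0] := ltP (Im lam) 0; last exact: L0.
    by apply: L2Z => //; exact: L2_cexp_J0.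
  have [->|kn'] := eqVneq k n.
    have [l0|l0] := ltP (Im lam) 0; first exact: L0.
    by apply: L2Z => //; apply: L2_cexp_Jn; rewrite lt_neqAle eq_sym tau0.
  by apply: L2Z => //; apply: L2_cexp_Jk => //; rewrite lt0n k0 ltn_neqAle kn'.
have n0 : (0 < n)%N by case: n hn.
have per k : (0 < k < n)%N -> phi k (alpha k) = phi k (beta k.+1).
  move=> k0n; have [k0 kn] := andP k0n; rewrite /phi /K gtn_eqF// ltn_eqF//.
  (* If the denominator vanished, [l_k lam] would be an integer and [lam] real. *)
  have dl : cexp lam (beta k.+1) - cexp lam (alpha k) != 0.
    apply/negP => /eqP e; have lk := len_gt0 hab k0n.
    have e1 : cexp lam (len alpha beta k) = 1.
      apply: (mulfI (cexp_neq0 lam (alpha k))).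
      rewrite -cexpD mulr1 /len addrC subrK.
      by apply/eqP; rewrite -subr_eq0 e.
    have [r lr] := resonant_real hab k0n ((cexp_eq1 lam (lt0r_neq0 lk)).1 e1).
    by move: tau0; rewrite lr /= eqxx.
  apply/eqP; rewrite -subr_eq0; apply/eqP; set a := cexp lam (alpha k) in dl *.
  set b := cexp lam (beta k.+1) in dl *.
  by field.
have glue : phi n (alpha n) = c * phi 0%N (beta 1%N).
  have cn0 := c_neq0 hc.
  have ea := cexp_neq0 lam (alpha n); have eb := cexp_neq0 lam (beta 1%N).
  rewrite /phi /K eqxx gtn_eqF//=; case: ifP => _.
    rewrite mul0r addr0 -mulrA mulVf// mulr1 addrC subrK mulrA mulfV// mul1r//.
  by rewrite -mulrA mulVf// mulr1 addrC subrK mul0r addr0.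
have Hphi k : (k <= n)%N -> [/\ locally_ac setT (phi k), L2 (J k) (phi k),
     L2 (J k) (dphi k) & ae_derivative (J k) (phi k) (dphi k)].
  move=> kn; split => //; first exact: Lphi.
  - apply: L2Z => //; apply: L2D => //; first by apply: L2Z => //; exact: Lphi.
    exact: (L2S mT (mJ k) (@subsetT _ _) Lh0).
  - by apply: (ae_imp (adphi k)) => t d _; exact: d.
have Pf := PB_pw hn hab Hphi per glue.
exists (pw n alpha beta phi), (fun x => tpi^-1 * pw n alpha beta dphi x).
split; last first.
  apply: ae_all => t [k kn Jt]; rewrite !(pwE hab _ kn Jt) /dphi.
  rewrite mulKf ?tpi_neq0// addrC addKr mem_set ?mulr1n//.
  by exists k.
split => //; apply/(orthocompP hn hab hc); split.
  by apply: L2_pw => // k kn; exact: Lphi.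
move=> k m k0n rm; have [r mr] := resonant_real hab k0n rm.
have [k0 kn] := andP k0n.
set a := alpha k; set b := beta k.+1.
have ab : a < b by exact: hab.2.
have mab : measurable (`[a, b]%classic : set (measurableTypeR R)) by [].
have Lp := L2_locally_ac a b (acphi k).
have Lh1 : L2 `[a, b]%classic (fun t => h t *+ (t \in D)) by exact: L2S Lh0.
have Le : L2 `[a, b]%classic (cexp (- r%:C)) by apply: L2_locally_ac (@locally_ac_cexp _ _ _).
have hE t : J k t -> h t = h t *+ (t \in D).
  by move=> Jt; rewrite mem_set ?mulr1n//; exact: (J_sub (ltnW kn)).
have fE t : J k t -> pw n alpha beta phi t = phi k t.
  by move=> Jt; rewrite (pwE hab _ (ltnW kn) Jt).
have := horth k m k0n rm; rewrite mr.
rewrite (L2dot_efun hab r k0n hE Lh1) (L2dot_efun hab r k0n fE Lp).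
set Ih := cintegral _ _; set If := cintegral _ _ => Ih0.
have [i1 i2] := integrable_ReIm_mul mab Lp Le.
have [j1 j2] := integrable_ReIm_mul mab Lh1 Le.
(* Both factors take equal values at [a] and [b], so the integral of [p'] is zero. It equals
   [tpi * ((lam - r) * If + Ih)]; as [Ih = 0] and [lam] is not real, [If = 0]. *)
pose p t := phi k t * cexp (- r%:C) t.
have dp : {ae mu, forall t, `]a, b[%classic t -> is_cderive p t
   (tpi * ((lam - r%:C) * (phi k t * cexp (- r%:C) t) +
     (h t *+ (t \in D)) * cexp (- r%:C) t))}.
  apply: (ae_imp (adphi k)) => t /(_ I) d _.
  have := is_cderive_mul d (is_cderive_cexp (- r%:C) t).
  by congr (is_cderive _ _ _); rewrite /dphi; ring.
have acp : abs_continuous `[a, b] p.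
  by apply: abs_continuousM; [exact: acphi|exact: abs_continuous_cexp].
have Lpe : forall z, mu.-integrable `[a, b] (EFin \o (fun t => Re (z * (phi k t * cexp (- r%:C) t)))) /\
   mu.-integrable `[a, b] (EFin \o (fun t => Im (z * (phi k t * cexp (- r%:C) t)))).
  move=> z; have [u1 u2] := integrable_ReIm_mul mab (L2Z z mab Lp) Le.
  split.
  - by rewrite (_ : (fun t => _) = fun t => Re (z * phi k t * cexp (- r%:C) t))//;
      apply/funext => t; rewrite mulrA.
  - by rewrite (_ : (fun t => _) = fun t => Im (z * phi k t * cexp (- r%:C) t))//;
      apply/funext => t; rewrite mulrA.
have [l1 l2] := Lpe (lam - r%:C).
have q1 := integrableDr mab l1 j1; have q2 := integrableDr mab l2 j2.
pose G t := (lam - r%:C) * (phi k t * cexp (- r%:C) t) + (h t *+ (t \in D)) * cexp (- r%:C) t.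
have G1 : mu.-integrable `[a, b] (EFin \o (fun t => Re (G t))).
  by rewrite (_ : (fun t => Re (G t)) = fun t => Re ((lam - r%:C) * (phi k t * cexp (- r%:C) t)) +
    Re ((h t *+ (t \in D)) * cexp (- r%:C) t))//; apply/funext => t; rewrite cReD.
have G2 : mu.-integrable `[a, b] (EFin \o (fun t => Im (G t))).
  by rewrite (_ : (fun t => Im (G t)) = fun t => Im ((lam - r%:C) * (phi k t * cexp (- r%:C) t)) +
    Im ((h t *+ (t \in D)) * cexp (- r%:C) t))//; apply/funext => t; rewrite cImD.
have t1 : mu.-integrable `[a, b] (EFin \o (fun t => Re (tpi * G t))).
  rewrite (_ : (fun t => _) = fun t => - (2 * pi) * Im (G t)); first exact: integrableZr.
  by apply/funext => t; rewrite cReM /= mul0r sub0r mulNr.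
have t2 : mu.-integrable `[a, b] (EFin \o (fun t => Im (tpi * G t))).
  rewrite (_ : (fun t => _) = fun t => (2 * pi) * Re (G t)); first exact: integrableZr.
  by apply/funext => t; rewrite cImM /= mul0r add0r.
have := cFTC (ltW ab) acp t1 t2 dp.
have -> : p b - p a = 0.
  apply/eqP; rewrite subr_eq0 /p -per//; apply/eqP; congr (_ * _).
  have lk := len_gt0 hab k0n.
  have : resonant (- r%:C) k.
    by move: rm; rewrite mr => -[z hz]; exists (- z); rewrite mulrN hz mulrNz.
  move=> /(cexp_eq1 _ (lt0r_neq0 lk)) e1.
  have -> : b = a + len alpha beta k by rewrite /len /a /b addrC subrK.
  by rewrite cexpD e1 mulr1.
rewrite cintegralZ// cintegralD// cintegralZ// -/Ih -/If Ih0 addr0 => /esym/eqP.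
rewrite mulf_eq0 (negPf tpi_neq0)/= mulf_eq0 => /orP[/eqP e|/eqP//].
by move: tau0; have -> : lam = r%:C; [apply/eqP; rewrite -subr_eq0 e|rewrite /= eqxx].
Qed.

End continuous_part.

(** * Identification of the continuous spectrum *)

Section continuous_spectrum.
Context {R : realType}.
Local Notation mu := (@lebesgue_measure R).
Local Notation normc := ComplexField.Normc.normc.
Local Notation Re := complex.Re.
Local Notation Im := complex.Im.
Variables (n : nat) (alpha beta : nat -> R) (c : R[i]).
Hypotheses (hn : (2 < n)%N) (hab : ordered_endpoints n alpha beta) (hc : `|c| = 1).
Implicit Types (f g h : R -> R[i]) (lam z w : R[i]).
Local Notation J := (Jint n alpha beta).
Local Notation D := (Omega n alpha beta).
Local Notation P := (PB alpha beta (block_B n c)).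
Local Notation efun := (efun n alpha beta).
Local Notation resonant := (resonant alpha beta).
Local Notation H := (orthocomp D
  (closed_span D (\bigcup_(lam in [set: R[i]]) eigenvectors D P lam))).

Lemma ae_neq (x : R) : {ae mu, forall t, t != x}.
Proof.
exists [set x]; split; [exact: measurable_set1|exact: lebesgue_measure_set1|].
by move=> t /= /negP; rewrite negbK => /eqP.
Qed.

(** For [t >= a], the primitive from [a] of the indicator of []a, a + 1[]. It is continued linearly
    to the left of [a], so that [a + 1] is its only corner. *)
Definition ramp (a t : R) : R[i] := (Num.min (t - a) 1)%:C.

Lemma locally_ac_ramp a : locally_ac setT (ramp a).
Proof.
move=> x y _; apply/abs_continuousP; split; last first.
  by apply: (@ac_lipschitz _ _ _ 0) => s t _ _; rewrite subrr normr0 mul0r.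
apply: (@ac_lipschitz _ _ _ 1) => s t st _ /=; rewrite mul1r ler_norml.
by case: (leP (t - a) 1) => h1; case: (leP (s - a) 1) => h2; apply/andP; split; lra.
Qed.

Lemma is_cderive_ramp (a t : R) : t != a + 1 ->
  is_cderive (ramp a) t (if t < a + 1 then 1 else 0).
Proof.
move=> ta; have [t1|t1] := ltP t (a + 1).
  have := is_cderive_add (is_cderive_id t) (is_cderive_cst (- a%:C) t).
  rewrite addr0; apply: is_cderive_near; near=> s.
  have s1 : s < a + 1 by near: s; exact: lt_nbhsl.
  rewrite /ramp min_l; last by rewrite lerBlDl ltW.
  by rewrite rmorphB.
have {}t1 : a + 1 < t by rewrite lt_neqAle eq_sym ta.
have := is_cderive_cst 1 t; apply: is_cderive_near; near=> s.
have s1 : a + 1 < s by near: s; exact: lt_nbhsr.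
by rewrite /ramp min_r// lerBrDl ltW.
Unshelve. all: by end_near. Qed.

Lemma resolvent_nonreal lam : Im lam != 0 -> in_resolvent_set D H (restriction P H) lam.
Proof.
move=> tau0; split.
- by move=> h Hh; exact: resolvent_surjective.
- move=> f g [Pfg _] e.
  have ef : eigenspace D P lam f.
    by exists g => //; apply: (ae_imp e) => t et Dt; apply/eqP; rewrite -subr_eq0 et.
  have [C [fC C0 Cn Ck]] := eigenspace_form hn hab hc ef.
  apply: ae_all => t [k kn Jt]; rewrite (fC k t kn Jt).
  suff -> : C k = 0 by rewrite mul0r.
  have [->//|k0] := eqVneq k 0%N.
  have [->//|kn'] := eqVneq k n.
  have k0n : (0 < k < n)%N by rewrite lt0n k0 ltn_neqAle kn'.
  have [//|/(resonant_real hab k0n)[r lr]] := Ck k k0n.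
  by move: tau0; rewrite lr /= eqxx.
- by exists (`|Im lam|^-1) => f g [Pfg _]; exact: (resolvent_bound hn hab hc).
Qed.

(* [f * cexp (- lam)] would have to grow by [tpi] across [`]a, a + 1[] and be
   constant afterwards, so no square integrable [f] solves [(P - lam) f = h]
   when [h] is [cexp lam] cut off to [`]a, a + 1[]. *)
Lemma real_in_spectrum (r : R) : ~ in_resolvent_set D H (restriction P H) r%:C.
Proof.
set lam : R[i] := r%:C; move=> [surj _ _].
have mD := measurable_Omega n alpha beta; have mJ k := measurable_J n alpha beta k.
set a := alpha n.
have n0 : (0 < n)%N by case: n hn.
have mA : measurable (`]a, a + 1[%classic : set (measurableTypeR R)) by [].
have AJ : `]a, a + 1[%classic `<=` J n.
  by rewrite (JnE _ _ hn); apply: subset_itvl; rewrite bnd_simp.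
pose hh j t := if j == n then cexp lam t *+ (t \in (`]a, a + 1[%classic : set R)) else 0.
pose h := pw n alpha beta hh.
have Lh : L2 D h.
  apply: L2_pw => // j jn; rewrite /hh; case: eqP => [->|_]; last exact: L2_0.
  apply: L2_patch => //.
  apply: (L2S _ mA _ (L2_locally_ac a (a + 1) (@locally_ac_cexp _ _ lam))) => //.
  by apply: subset_itvW; rewrite ?lexx.
(* [h] lives on [J n] and every test function on a bounded interval. *)
have Hh : H h.
  apply/(orthocompP hn hab hc); split => // k m k0n _.
  apply: etrans (L2dot0 D h); apply: cintegral_ext => t [j jn Jt].
  have [jk|jk] := eqVneq j k.
    rewrite /h (pwE hab _ jn Jt) /hh jk ltn_eqF ?mul0r//.
    by case/andP: k0n.
  by rewrite (efun0 hab _ jn jk Jt).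
have [f [g [[Pfg _] e]]] := surj h Hh.
have sf := PB_solves Pfg e.
(* The particular solution on [J n] that vanishes at [alpha n]. *)
pose psi t := tpi * (ramp a t * cexp lam t).
have acpsi : locally_ac setT psi.
  apply: locally_acM; first by move=> x y _; exact: abs_continuous_cst.
  by apply: locally_acM; [exact: locally_ac_ramp|exact: locally_ac_cexp].
have spsi : solves (J n) lam h psi.
  split; first exact: locally_acS acpsi.
  apply: (ae_imp (ae_neq (a + 1))) => t ta Jt.
  have at_ : a < t by move: Jt; rewrite (JnE _ _ hn) /= in_itv/= andbT.
  have := is_cderive_mul (is_cderive_cst tpi t)
    (is_cderive_mul (is_cderive_ramp ta) (is_cderive_cexp lam t)).
  congr (is_cderive _ _ _); rewrite /h (pwE hab _ (leqnn n) Jt) /hh eqxx.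
  have -> : (t \in (`]a, a + 1[%classic : set R)) = (t < a + 1).
    by apply/idP/idP; rewrite inE /= in_itv/= at_.
  by rewrite /psi; case: ifP => _; rewrite ?mulr1n ?mulr0n; ring.
have Kex k : exists K, (k <= n)%N -> forall t, J k t ->
    f t = (if k == n then psi t else 0) + K * cexp lam t.
  have [kn|nk] := leqP k n; last by exists 0.
  have [kn'|kn'] := eqVneq k n.
    subst k; have [|K HK] := solves_sub (@is_interval_J _ _ _ _ _) (sf n kn) spsi => //.
    by exists K => _ t Jt; rewrite HK.
  have s0 : solves (J k) lam (fun=> 0) (fun=> 0).
    split; first by move=> x y _; exact: abs_continuous_cst.
    apply: ae_all => t _; rewrite mulr0 addr0 mulr0; exact: is_cderive_cst.
  have [|K HK] := solves_sub (@is_interval_J _ _ _ _ _) (sf k kn) s0; last by exists K => _.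
  by move=> t Jt; rewrite /h (pwE hab _ kn Jt) /hh (negPf kn').
have [K HK] := choice Kex.
have acphi k : locally_ac setT (fun t => (if k == n then psi t else 0) + K k * cexp lam t).
  apply: locally_acD.
    by case: eqP => _ //; move=> x y _; exact: abs_continuous_cst.
  apply: locally_acM; last exact: locally_ac_cexp.
  by move=> x y _; exact: abs_continuous_cst.
have [_ bn] := @PB_boundary _ _ _ _ _ hn hab f g
  (fun k t => (if k == n then psi t else 0) + K k * cexp lam t) Pfg
  (fun k kn => conj (acphi k) (HK k kn)).
have Lf : L2 D f by have [[]] := Pfg.
(* On [J 0], [f] is a multiple of [cexp lam], which has modulus 1 there because [lam] is real. *)
have K0 : K 0%N = 0.
  apply: (L2_cst_cexp_J0 (n := n) (alpha := alpha) (beta := beta) (lam := lam)) => //.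
  have LfJ := L2S mD (mJ 0%N) (J_sub (leq0n n)) Lf.
  apply: (L2_bound (C := 1) (mJ 0%N) _ LfJ).
    by apply: cmeasurableM; [exact: cmeasurable_cst|exact: cmeasurable_cexp].
  by move=> t Jt; rewrite (HK 0%N (leq0n n) t Jt) ltn_eqF// add0r mul1r.
(* The gluing condition carries the zero value at [beta 1] to [alpha n], where [psi] vanishes too.
   Hence [f = psi] on [J n], of constant modulus 2 pi beyond [a + 1]. *)
have Kn : K n = 0.
  move: bn.
  rewrite eqxx ltn_eqF// K0 mul0r addr0 mulr0 /psi /ramp -/a subrr min_l//.
  rewrite mul0r mulr0 add0r => /eqP.
  by rewrite mulf_eq0 (negPf (cexp_neq0 _ _)) orbF => /eqP.
have AJ' : `]a + 1, +oo[%classic `<=` J n.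
  by rewrite (JnE _ _ hn); apply: subset_itvr; rewrite bnd_simp lerDl.
have LA : L2 `]a + 1, +oo[%classic f.
  apply: (L2S mD _ _ Lf) => //.
  by apply: subset_trans (J_sub (leqnn n)).
have pi0 := @pi_gt0 R.
apply: (@not_L2 _ `]a + 1, +oo[%classic f ((2 * pi) ^+ 2) _ _ _ _ LA) => //.
- by rewrite lebesgue_measure_itv/= ltry.
- by rewrite exprn_gt0// mulr_gt0.
- move=> t At; rewrite (HK n (leqnn n) t (AJ' t At)) eqxx Kn mul0r addr0.
  have at1 : a + 1 < t by move: At; rewrite /= in_itv/= andbT.
  rewrite /psi /ramp min_r; last by rewrite lerBrDl ltW.
  rewrite !normc_mul normc_cexp /= mulr0 mul0r oppr0 expR0 mulr1.
  rewrite !expr0n/= add0r addr0 expr1n sqrtr1 mulr1 sqrtr_sqr ger0_norm//.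
  by rewrite mulr_ge0// ltW.
Qed.

Lemma continuous_spectrumE : continuous_spectrum D P = range (real_complex R).
Proof.
apply/seteqP; split => lam.
- move=> spec; exists (Re lam) => //.
  have [l0|l0] := eqVneq (Im lam) 0; first by apply: complex_ext.
  by exfalso; apply: spec; exact: resolvent_nonreal.
- by move=> [r _ <-]; exact: real_in_spectrum.
Qed.

End continuous_spectrum.

(** * Density of the eigenvalues *)

Section counting.
Context {R : realType}.
Variables (n : nat) (alpha beta : nat -> R) (c : R[i]).
Hypotheses (hn : (2 < n)%N) (hab : ordered_endpoints n alpha beta) (hc : `|c| = 1).
Local Notation D := (Omega n alpha beta).
Local Notation P := (PB alpha beta (block_B n c)).
Local Notation l := (len alpha beta).
Local Notation resonant := (resonant alpha beta).

Lemma esum_cst1 (T : choiceType) (A : set T) (m : nat) (e : nat -> T) :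
  set_bij `I_m A e -> (\esum_(x in A) 1 = m%:R%:E :> \bar R)%E.
Proof.
move=> be; rewrite (reindex_esum _ _ e _ be)//.
rewrite esum_fset; [|exact: finite_II|by move=> i _; exact: lee01].
by rewrite -fsbig_ord sumEFin big_const_ord iter_addr_0.
Qed.

(** For [x <= y], the number of integers in [[l_k x, l_k y]]; the integer under [absz] is then
    nonnegative. *)
Definition resonant_count (k : nat) (x y : R) : nat :=
  absz (Num.floor (l k * y) - Num.ceil (l k * x) + 1).

Lemma resonant_count_int k (x y : R) : (0 < k < n)%N -> x <= y ->
  (resonant_count k x y)%:Z = Num.floor (l k * y) - Num.ceil (l k * x) + 1.
Proof.
move=> k0n xy; rewrite /resonant_count gez0_abs//.
have lk := len_gt0 hab k0n.
have h1 : l k * y < (Num.floor (l k * y) + 1)%:~R by exact: floorD1_gt.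
have h2 : (Num.ceil (l k * x) - 1)%:~R < l k * x by exact: ceilB1_lt.
have h3 : l k * x <= l k * y by rewrite ler_pM2l.
have : (Num.ceil (l k * x) - 1)%:~R < (Num.floor (l k * y) + 1)%:~R :> R.
  exact: lt_trans h2 (le_lt_trans h3 h1).
rewrite ltr_int; lia.
Qed.

Lemma resonant_count_bound k (x y : R) : (0 < k < n)%N -> x <= y ->
  `|(resonant_count k x y)%:R - l k * (y - x)| <= 1.
Proof.
move=> k0n xy.
have -> : (resonant_count k x y)%:R = (Num.floor (l k * y) - Num.ceil (l k * x) + 1)%:~R :> R.
  by rewrite -resonant_count_int.
have h1 : l k * y < (Num.floor (l k * y) + 1)%:~R by exact: floorD1_gt.
have h2 : (Num.ceil (l k * x) - 1)%:~R < l k * x by exact: ceilB1_lt.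
have h3 : (Num.floor (l k * y))%:~R <= l k * y by exact: floor_le.
have h4 : l k * x <= (Num.ceil (l k * x))%:~R by exact: ceil_ge.
move: h1 h2; rewrite !intrD mulrBr ler_norml !rmorphN/= => h1 h2.
by apply/andP; split; lra.
Qed.

(** Enumerates the resonant values in [[x, y]] by the consecutive integers [l_k lam], starting from
    the least one, [ceil (l_k x)]. *)
Lemma resonant_bij k (x y : R) : (0 < k < n)%N -> x <= y ->
  set_bij `I_(resonant_count k x y)
    (real_complex R @` `[x, y]%classic `&` [set lam | resonant lam k])
    (fun i => ((l k)^-1 * (Num.ceil (l k * x) + i%:Z)%:~R)%:C).
Proof.
move=> k0n xy; have lk := len_gt0 hab k0n.
have rc := resonant_count_int k0n xy.
split.
- move=> i /= im; split; last by apply/(resonantP hab _ k0n); eexists.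
  eexists; last reflexivity; rewrite /= in_itv/= ler_pdivlMl// ler_pdivrMl//.
  apply/andP; split.
    by apply: (le_trans (ceil_ge _)); rewrite ler_int lerDl.
  apply: (le_trans _ (floor_le _)); rewrite ler_int -lerBrDl -(lerD2r 1) -rc.
  by rewrite -PoszD lez_nat addn1.
- move=> i j _ _ /complexI /(mulfI (lt0r_neq0 _))/wrap[]; first by rewrite invr_gt0.
  by move=> /(@intr_inj R)/addrI [].
- move=> lam [[t txy <-] /(resonantP hab _ k0n)[z /complexI tz]].
  move: txy; rewrite /= in_itv/= tz => /andP[xt ty].
  have h1 : Num.ceil (l k * x) <= z.
    by rewrite ceil_le_int -ler_pdivlMl.
  have h2 : z <= Num.floor (l k * y).
    by rewrite floor_ge_int -ler_pdivrMl.
  exists (absz (z - Num.ceil (l k * x))); first by rewrite /=; lia.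
  by rewrite gez0_abs ?subr_ge0// addrCA subrr addr0.
Qed.

(** The multiplicity is a sum of indicators over [k], so the two summations can be exchanged; a
    value resonant for several [k] is counted once for each of them on both sides. *)
Lemma eigen_countE (x y : R) : x <= y ->
  eigen_count D P x y = (\sum_(1 <= k < n) (resonant_count k x y)%:R)%:E.
Proof.
move=> xy; rewrite /eigen_count.
under eq_esum => lam _ do rewrite (multiplicityE hn hab hc lam) natr_sum -sumEFin.
rewrite esum_sum; last by move=> lam k _ _; rewrite lee_fin.
rewrite -sumEFin; apply: eq_big_nat => k k0n.
rewrite -(esum_cst1 (resonant_bij k0n xy)).
rewrite (_ : _ `&` [set lam | resonant lam k] = (eigenvalues D P `&`
    (real_complex R @` `[x, y])) `&` [set lam | resonant lam k]); last first.
  apply/seteqP; split => [lam [rl rk]|lam [[_ rl] rk]]; split => //; split => //.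
  rewrite (eigenvaluesE hn hab hc); exists k => //.
  by move/(resonantP hab _ k0n) : rk => [z ->]; exists z.
rewrite [RHS]esum_mkcondr; apply: eq_esum => lam _.
by case: asboolP => rl; [rewrite mem_set|rewrite memNset].
Qed.

(** Each [k] contributes [2 N l_k] with an error of at most 1, so after division by [2 N] the total
    error is at most [n / (2 N)]. *)
Lemma eigen_count_cvg (a : R) :
  (eigen_count D P (a - N) (a + N) * ((2 * N)^-1)%:E)%E @[N --> +oo] -->
    (\sum_(1 <= k < n) l k)%:E.
Proof.
pose f (N : R) := (\sum_(1 <= k < n) (resonant_count k (a - N) (a + N))%:R) / (2 * N).
have fE (N : R) : 0 < N ->
    (eigen_count D P (a - N) (a + N) * ((2 * N)^-1)%:E)%E = (f N)%:E.
  by move=> N0; rewrite eigen_countE -?EFinM//; lra.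
apply: (@cvg_trans _ ((fun N => (f N)%:E) @ +oo)).
  apply: near_eq_cvg; near=> N; rewrite fE//; near: N; exact: nbhs_pinfty_gt.
apply: cvg_EFin; first by near=> N.
apply/cvgrPdist_le => e e0; near=> N.
have N0 : 0 < N by near: N; exact: nbhs_pinfty_gt.
have Ne : n%:R / e <= N by near: N; apply: nbhs_pinfty_ge; exact: num_real.
rewrite /= /f distrC.
have -> : (\sum_(1 <= k < n) (resonant_count k (a - N) (a + N))%:R) / (2 * N) -
    \sum_(1 <= k < n) l k =
    (\sum_(1 <= k < n) ((resonant_count k (a - N) (a + N))%:R - l k * ((a + N) - (a - N)))) / (2 * N).
  rewrite [in RHS]sumrB [in RHS]mulrBl -mulr_suml; congr (_ - _).
  by field; rewrite gt_eqF.
rewrite normrM [`|(2 * N)^-1|]ger0_norm ?invr_ge0 ?mulr_ge0 ?(ltW N0)//.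
rewrite ler_pdivrMr ?mulr_gt0//.
apply: (@le_trans _ _ n%:R).
  apply: (le_trans (ler_norm_sum _ _ _)).
  apply: (@le_trans _ _ (\sum_(1 <= k < n) 1)).
    apply: ler_sum_nat => k k0n; apply: resonant_count_bound => //; lra.
  by rewrite sumr_const_nat ler_nat leq_subr.
move: Ne; rewrite ler_pdivrMr// => h; apply: (le_trans h).
by rewrite mulrCA mulrC ler_peMl// ?ler1n// mulr_ge0// ltW.
Unshelve. all: by end_near. Qed.

End counting.

Theorem theorem3p20 (R : realType) (n : nat) (alpha beta : nat -> R)
    (c : R[i]) (B : 'M[R[i]]_n)
    (hn : (2 < n)%N)
    (hab : ordered_endpoints n alpha beta)
    (hc : `|c| = 1)
    (hU : B \is unitarymx)
    (hB : B = block_B n c) :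
  let D := Omega n alpha beta in
  let P := PB alpha beta B in
  let l := len alpha beta in
  [/\ continuous_spectrum D P = range (real_complex R),
      eigenvalues D P =
        \bigcup_(k in [set k | (1 <= k < n)%N])
          range (fun z : int => ((l k)^-1 * z%:~R)%:C),
      forall lam, eigenvalues D P lam ->
        multiplicity D P lam =
          (\sum_(1 <= k < n)
             `[< (exists z : int, (l k)%:C * lam = z%:~R)%R >])%N%:R%:E,
      eigenvalues D P 0 /\ multiplicity D P 0 = (n.-1)%:R%:E &
      forall a : R,
        (eigen_count D P (a - N) (a + N) * ((2 * N)^-1)%:E)%E @[N --> +oo] -->
          (\sum_(1 <= k < n) l k)%:E].
Proof.
move=> D P l; rewrite /P /l /D hB.
split.
- exact: (continuous_spectrumE hn hab hc).
- exact: (eigenvaluesE hn hab hc).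
- by move=> lam _; exact: (multiplicityE hn hab hc).
- exact: (eigenvalue0 hn hab hc).
- exact: (eigen_count_cvg hn hab hc).
Qed.
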